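(* Let $p=1+\frac{3}{2n}$ and $f(\xi)=|\xi|^{p-1}\xi$. Let $u_0\in L^1_1(\mathbb R^n)\cap L^\infty(\mathbb R^n)$ and let $u$ be the global solution with initial datum $u_0$. Then for every $q\in[1,\infty]$ there exists $C>0$ such that $$t^{\frac n2(1-\frac1q)}\|u(t)-\mathcal A_{0,1}(t)\|_q\le Ct^{-\frac12}\quad\text{for all }t>4.$$
   Context: Let $n\ge1$, $a\in\mathbb R^n\setminus\{0\}$. $\|\cdot\|_q$ is the $L^q(\mathbb R^n)$ norm; $L^1_1=\{\varphi\in L^1: x_j\varphi\in L^1\ \forall j\}$. $G_t(x)=(4\pi t)^{-n/2}e^{-|x|^2/(4t)}$, $e^{t\Delta}\varphi=G_t*\varphi$. The global solution for $u_0\in L^1\cap L^\infty$ is the unique $u\in (C\cap L^\infty)([0,\infty);L^1)\cap(C\cap L^\infty)((0,\infty);L^\infty)$ with $u(t)=e^{t\Delta}u_0+\int_0^ta\cdot\nabla e^{(t-s)\Delta}f(u(s))ds$ for all $t>0$. $\mathcal M_0(\varphi)=\int\varphi$; $\mathcal A_0(t)=\mathcal M_0(u_0)G_t$; $\mathcal A_{0,1}(t)=\mathcal A_0(t)+\int_0^ta\cdot\nabla e^{(t-s)\Delta}f(\mathcal A_0(s))ds$. *)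

(* Defs.v *)
From HB Require Import structures.
From mathcomp Require Import all_boot all_order all_algebra.
From mathcomp Require Import all_classical all_reals all_analysis.
Set Implicit Arguments. Unset Strict Implicit. Unset Printing Implicit Defensive.
Import Order.TTheory GRing.Theory Num.Theory.
Local Open Scope classical_set_scope.
Local Open Scope ring_scope.

Section Defs.
Variable R : realType.

(* n-dimensional Lebesgue integral of a nonnegative function on R^n,
   as an iterated integral (x_1, then (x_2,...,x_n)). *)
Fixpoint iint (n : nat) : (n.-tuple R -> \bar R) -> \bar R :=
  match n return (n.-tuple R -> \bar R) -> \bar R with
  | 0 => fun F => F [tuple]
  | m.+1 => fun F =>
      (\int[@lebesgue_measure R]_x iint (fun y : m.-tuple R => F [tuple of x :: y]))%E
  end.

Definition Int (n : nat) (g : n.-tuple R -> R) : R :=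
  fine (iint (fun x => (Num.max (g x) 0)%:E)) -
  fine (iint (fun x => (Num.max (- g x) 0)%:E)).

Definition vsub n (x y : n.-tuple R) : n.-tuple R := [tuple tnth x i - tnth y i | i < n].
Definition vaddsc n (x : n.-tuple R) (h : R) (a : n.-tuple R) : n.-tuple R :=
  [tuple tnth x i + h * tnth a i | i < n].
Definition sqnorm n (x : n.-tuple R) : R := \sum_(i < n) tnth x i ^+ 2.

Definition ess_sup_abs n (g : n.-tuple R -> R) : \bar R :=
  ereal_inf [set M : \bar R |
    iint (fun x => (if (M < `|g x|%:E)%E then 1 else 0)%:E) = 0%E].

Definition Lqnorm n (q : \bar R) (g : n.-tuple R -> R) : \bar R :=
  match q with
  | r%:E => poweR (iint (fun x => (`|g x| `^ r)%:E)) r^-1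
  | +oo%E => ess_sup_abs g
  | -oo%E => 0%E
  end.

Definition ae_eq n (g h : n.-tuple R -> R) : Prop :=
  iint (fun x => (if g x != h x then 1 else 0)%:E) = 0%E.

Definition gauss n (t : R) (x : n.-tuple R) : R :=
  (4 * pi * t) `^ (- (n%:R / 2)) * expR (- sqnorm x / (4 * t)).

Definition heat n (t : R) (phi : n.-tuple R -> R) (x : n.-tuple R) : R :=
  Int (fun y => gauss t (vsub x y) * phi y).

Definition dirder n (a : n.-tuple R) (g : n.-tuple R -> R) (x : n.-tuple R) : R :=
  derive1 (fun h : R => g (vaddsc x h a)) 0.

Definition duhamel n (a : n.-tuple R) (f : R -> R) (v : R -> n.-tuple R -> R)
    (t : R) (x : n.-tuple R) : R :=
  Rintegral (@lebesgue_measure R) `[0, t]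
    (fun s => dirder a (heat (t - s) (fun y => f (v s y))) x).

Definition fnl (p : R) (xi : R) : R := (`|xi| `^ (p - 1)) * xi.

Definition mass n (phi : n.-tuple R -> R) : R := Int phi.

Definition A0 n (u0 : n.-tuple R -> R) (t : R) (x : n.-tuple R) : R :=
  mass u0 * gauss t x.

Definition A01 n (a : n.-tuple R) (f : R -> R) (u0 : n.-tuple R -> R)
    (t : R) (x : n.-tuple R) : R :=
  A0 u0 t x + duhamel a f (A0 u0) t x.

Definition L11_Linf n (u0 : n.-tuple R -> R) : Prop :=
  measurable_fun setT u0 /\
  (Lqnorm 1%:E u0 < +oo)%E /\
  (forall j : 'I_n, (Lqnorm 1%:E (fun x => (tnth x j * u0 x)%R) < +oo)%E) /\
  (Lqnorm +oo%E u0 < +oo)%E.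

Definition global_solution n (a : n.-tuple R) (f : R -> R)
    (u0 : n.-tuple R -> R) (u : R -> n.-tuple R -> R) : Prop :=
  (forall t, 0 <= t -> measurable_fun setT (u t) /\ (Lqnorm 1%:E (u t) < +oo)%E) /\
  (forall t, 0 <= t -> forall eps : R, 0 < eps -> exists2 delta : R, 0 < delta &
     forall s, 0 <= s -> `|s - t| < delta ->
       (Lqnorm 1%:E (fun x => (u s x - u t x)%R) < eps%:E)%E) /\
  (exists M : R, forall t, 0 <= t -> (Lqnorm 1%:E (u t) <= M%:E)%E) /\
  (forall t, 0 < t -> (Lqnorm +oo%E (u t) < +oo)%E) /\
  (forall t, 0 < t -> forall eps : R, 0 < eps -> exists2 delta : R, 0 < delta &
     forall s, 0 < s -> `|s - t| < delta ->
       (Lqnorm +oo%E (fun x => (u s x - u t x)%R) < eps%:E)%E) /\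
  (exists M : R, forall t, 0 < t -> (Lqnorm +oo%E (u t) <= M%:E)%E) /\
  (forall t, 0 < t ->
     ae_eq (u t) (fun x => heat t u0 x + duhamel a f u t x)).

Definition qexp n (q : \bar R) : R :=
  match q with
  | r%:E => n%:R / 2 * (1 - r^-1)
  | _ => n%:R / 2
  end.

End Defs.

(* Main.v *)
(* Let D_t = a . grad G_t, so that D_t has size t^(-1/2) in L^1 and all estimates can be made in L^1 and in the supremum
   norm at once. The exponent satisfies (p - 1) n/2 = 3/4 > 1/2.

   Decay: the solution is Hoelder continuous in space and time for t > 1, so for small h its L^2 norm decreases over
   [t, t + h] as under the heat flow, up to O(h^(5/4)); the first order contribution of the flux is a total derivative and
   vanishes. Convexity of |e^(s Laplacian) u|_2^2 in s then forces the L^2 norm, hence the supremum, to become arbitrarily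
   small. From a time at which it is small, the Duhamel formula bootstraps |u(t)| <= C t^(-n/2).

   Asymptotics: with A = M_0 G_t, w = int_0^t D_(t-s) * f(A(s)) ds and the finite first moment of u_0, the decay gives
   u - A = O(t^(-1/4)) and u - A - w = O(t^(-3/8)) in the scaled norms. Hence f(u) - f(A) = p|A|^(p-1) w up to terms that
   are integrable in time. That linear term is odd in space, so it has mass zero, and its moment of order 1/2 gains half
   a derivative of the kernel: its Duhamel integral is O(t^(-1/2)), like those of the remainder and the linear part. *)

Require Import Defs.
From HB Require Import structures.
From mathcomp Require Import all_boot all_order all_algebra.
From mathcomp Require Import all_classical all_reals all_analysis.
From mathcomp Require Import measurable_realfun.
From mathcomp Require Import ring lra.
Import Order.TTheory GRing.Theory Num.Theory.
Import numFieldNormedType.Exports.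
Local Open Scope classical_set_scope.
Local Open Scope ring_scope.
Set Implicit Arguments.
Unset Strict Implicit.
Unset Printing Implicit Defensive.

(** * Lebesgue measure on tuples *)

Section LebesgueTuple.
Context {R : realType}.
Implicit Types (n : nat).

Notation leb := (@lebesgue_measure R).

(** The obstacle is data of arbitrary size. After a time shift [d] the Duhamel term gains
    [d^(-1/4)], but to close that estimate the solution has to be of size [d^(-n/2)] at some time,
    with [d] already fixed. Only the L^2 norm supplies such smallness, and no time derivative of the
    solution is at hand for an energy identity; a comparison with the heat flow over discrete steps
    replaces it. With Hoelder exponent [theta] in space and [theta/2] in time the error of a step is
    [O(h^(1/2 + theta))], against a gain of order [h]. This asks for [theta > 1/2], the Duhamel
    kernel allows [theta < 1], and [theta = 3/4] is taken.

    In the asymptotics the linearized flux has size [s^(-1)], just not integrable in time, and would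
    cost a logarithm; cancellation is needed to remove it. The rate [3/8] of the intermediate step
    has a similar origin: [f(u) - f(A)] is bounded by [s^(-1)] and by [s^(-3/4)], and is used
    through the power [s^(-7/8)] in between, which is integrable at zero. *)

Definition tcons n (p : R * n.-tuple R) : n.+1.-tuple R :=
  [tuple of p.1 :: p.2].
Definition tuncons n (x : n.+1.-tuple R) : R * n.-tuple R :=
  (thead x, [tuple of behead x]).

Lemma measurable_tcons n : measurable_fun setT (@tcons n).
Proof. by apply: measurable_cons; [exact: measurable_fst|exact: measurable_snd]. Qed.

Lemma measurable_tuncons n : measurable_fun setT (@tuncons n).
Proof. by apply/measurable_fun_pair; [exact: measurable_tnth|exact: measurable_behead]. Qed.

Lemma tconsK n : cancel (@tcons n) (@tuncons n).
Proof. by move=> [x y]; rewrite /tuncons /tcons theadE; congr pair; apply: val_inj. Qed.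

Section Step.
Variables (n : nat) (m : {sigma_finite_measure set (n.-tuple R) -> \bar R}).

(** The product measure carried over from pairs to tuples, so that [n]-dimensional integrals are
    integrals against one sigma-finite measure, open to Tonelli, Fubini and changes of variables. *)
Definition consm : set (n.+1.-tuple R) -> \bar R :=
  pushforward (leb \x m)%E (@tcons n).

Let pm : {measure set _ -> \bar R} :=
  measure_function_pushforward__canonical__measure_function_Measure (leb \x m)%E (@measurable_tcons n).

Let consm0 : consm set0 = 0%E. Proof. exact: (measure0 pm). Qed.
Let consm_ge0 A : (0 <= consm A)%E. Proof. exact: (measure_ge0 pm). Qed.
Let consm_sigma_additive : semi_sigma_additive consm.
Proof. exact: (@measure_semi_sigma_additive _ _ _ pm). Qed.

HB.instance Definition _ := isMeasure.Build _ _ _ consm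
  consm0 consm_ge0 consm_sigma_additive.

Let consm_sigma_finite : sigma_finite setT consm.
Proof.
have /sigma_finiteP[F [TF ndF Foo]] := sigma_finiteT leb.
have /sigma_finiteP[G [TG ndG Goo]] := sigma_finiteT m.
exists (fun k => @tuncons n @^-1` (F k `*` G k)).
  rewrite -preimage_bigcup (_ : \bigcup_k _ = setT) ?preimage_setT//.
  apply/seteqP; split => // -[x y] _.
  have : (\bigcup_i F i) x by rewrite -TF.
  have : (\bigcup_i G i) y by rewrite -TG.
  (* Both exhaustions are increasing, so the larger of the two indices serves both factors. *)
  move=> [k _ Gky] [l _ Flx]; exists (maxn k l) => //; split => /=.
  - by move: x Flx; exact/subsetPset/ndF/leq_maxr.
  - by move: y Gky; exact/subsetPset/ndG/leq_maxl.
move=> k; have [mFk Fk] := Foo k; have [mGk Gk] := Goo k; split.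
  by rewrite -[X in measurable X]setTI; apply: measurable_tuncons => //; exact: measurableX.
rewrite /consm /pushforward -comp_preimage.
rewrite (_ : _ \o _ = id) ?preimage_id.
  by rewrite product_measure1E// lte_mul_pinfty// ge0_fin_numE.
by apply/funext => p; exact: tconsK.
Qed.

HB.instance Definition _ := Measure_isSigmaFinite.Build _ _ _ consm consm_sigma_finite.

Lemma ge0_integral_consm (F : n.+1.-tuple R -> \bar R) :
  measurable_fun setT F -> (forall x, 0 <= F x)%E ->
  (\int[consm]_x F x = \int[leb]_x \int[m]_y F (tcons (x, y)))%E.
Proof.
move=> mF F0; rewrite /consm ge0_integral_pushforward//; last exact: measurable_tcons.
rewrite preimage_setT fubini_tonelli1//; last by move=> x; exact: F0.
by apply: measurableT_comp => //; exact: measurable_tcons.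
Qed.

End Step.

Fixpoint mu n : {sigma_finite_measure set (n.-tuple R) -> \bar R} :=
  match n with
  | 0 => (\d_([tuple] : 0.-tuple R) : {sigma_finite_measure set _ -> \bar R})
  | n'.+1 => (consm (mu n') : {sigma_finite_measure set _ -> \bar R})
  end.

(** The bridge from the iterated integrals of the statement to a genuine measure: one Tonelli step
    per coordinate. *)
Lemma iint_mu n (F : n.-tuple R -> \bar R) :
  measurable_fun setT F -> (forall x, 0 <= F x)%E ->
  (iint F = \int[mu n]_x F x)%E.
Proof.
elim: n F => [|n IH] F mF F0 /=.
  by rewrite integral_dirac// diracT mul1e.
rewrite ge0_integral_consm//; apply: eq_integral => x _.
rewrite -IH//; apply: (measurableT_comp mF).
apply: (measurableT_comp (@measurable_tcons n)).
exact: measurable_fun_pair.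
Qed.

End LebesgueTuple.

(** * Invariance under translations and point reflections *)

Section Affine.
Context {R : realType}.
Notation leb := (@lebesgue_measure R).

Let affine1 (e c : R) : measurableTypeR R -> measurableTypeR R := fun x => (e * x + c)%R.

Lemma measurable_affine1 (e c : R) : measurable_fun setT (affine1 e c).
Proof. by apply: measurable_funD => //; exact: measurable_funM. Qed.

(** Uniqueness of Lebesgue measure: the image measure agrees with it on half-open intervals. A
    reflection moves the closed end to the other side, which does not affect the length. *)
Lemma lebesgue_measure_affine (e c : R) (A : set R) : e = 1 \/ e = -1 ->
  measurable A -> leb (affine1 e c @^-1` A) = leb A.
Proof.
move=> he mA.
pose pm : {measure set (measurableTypeR R) -> \bar R} :=
  measure_function_pushforward__canonical__measure_function_Measure leb (measurable_affine1 e c).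
apply/esym; apply: (@lebesgue_measure_unique R pm) => // X [[a b]] _ <-.
rewrite /pm /= /pushforward /affine1.
case: he => ->.
  rewrite (_ : _ @^-1` _ = `]a - c, b - c]%classic).
    rewrite !lebesgue_measure_itv /= !lte_fin ltrD2r.
    by case: ifP => // _; rewrite -!EFinB; congr EFin; ring.
  by apply/seteqP; split => x /=; rewrite !in_itv /=; lra.
rewrite (_ : _ @^-1` _ = `[c - b, c - a[%classic).
  rewrite !lebesgue_measure_itv /= !lte_fin ltrD2l ltrN2.
  by case: ifP => // _; rewrite -!EFinB; congr EFin; ring.
by apply/seteqP; split => x /=; rewrite !in_itv /=; lra.
Qed.

Lemma ge0_integral_affine1 (e c : R) (f : R -> \bar R) : e = 1 \/ e = -1 ->
  measurable_fun setT f -> (forall x, 0 <= f x)%E ->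
  (\int[leb]_x f (e * x + c)%R = \int[leb]_x f x)%E.
Proof.
move=> he mf f0; transitivity (\int[pushforward leb (affine1 e c)]_x f x)%E.
  by rewrite ge0_integral_pushforward//; exact: measurable_affine1.
apply: eq_measure_integral => [|? A mA _]; first exact: measurable_affine1.
exact: lebesgue_measure_affine.
Qed.

(** Translations ([e = 1]) and point reflections ([e = -1]) in a single map, so that one induction
    on the dimension gives both invariances that convolutions use. *)
Definition vaff n (e : R) (c y : n.-tuple R) : n.-tuple R :=
  [tuple e * tnth y i + tnth c i | i < n].

Lemma measurable_vaff n e c : measurable_fun setT (@vaff n e c).
Proof.
apply/measurable_fun_tnthP => i.
rewrite (_ : _ \o _ = (fun x => e * x + tnth c i) \o (fun y => tnth y i)); last first.
  by apply/funext => y /=; rewrite tnth_mktuple.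
by apply: measurableT_comp; [exact: measurable_affine1|exact: measurable_tnth].
Qed.

Lemma vaff_tcons n e (c : n.+1.-tuple R) x y :
  vaff e c (tcons (x, y)) = tcons (e * x + thead c, vaff e [tuple of behead c] y).
Proof.
apply: eq_from_tnth => i; rewrite tnth_mktuple /tcons.
case: (unliftP ord0 i) => [j ->|->] /=.
  by rewrite !tnthS tnth_mktuple tnth_behead (_ : inord j.+1 = lift ord0 j)//;
    apply: val_inj; rewrite /= inordK// ltnS.
by rewrite !tnth0.
Qed.

Lemma ge0_integral_vaff n (e : R) (c : n.-tuple R) (F : n.-tuple R -> \bar R) :
  e = 1 \/ e = -1 -> measurable_fun setT F -> (forall x, 0 <= F x)%E ->
  (\int[mu n]_y F (vaff e c y) = \int[mu n]_y F y)%E.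
Proof.
move=> he; elim: n c F => [|n IH] c F mF F0 /=.
  rewrite !integral_dirac//; last by apply: (measurableT_comp mF); exact: measurable_vaff.
  by rewrite (tuple0 (vaff _ _ _)).
have mFv : measurable_fun setT (F \o vaff e c) by apply: (measurableT_comp mF); exact: measurable_vaff.
rewrite (ge0_integral_consm _ mFv); last by move=> x; exact: F0.
rewrite [RHS](ge0_integral_consm _ mF F0).
have mFc x : measurable_fun setT (fun y => F (tcons (x, y))).
  apply: (measurableT_comp mF); apply: (measurableT_comp (@measurable_tcons R n)).
  exact: measurable_fun_pair.
transitivity (\int[leb]_x (fun x => \int[mu n]_y F (tcons (x, y))) (e * x + thead c)%R)%E.
  apply: eq_integral => x _; rewrite -[RHS](IH [tuple of behead c])//.
  by apply: eq_integral => y _; rewrite /= vaff_tcons.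
apply: ge0_integral_affine1 => //; last by move=> x; exact: integral_ge0.
have := @measurable_fun_fubini_tonelli_F _ _ (measurableTypeR R) (n.-tuple R) R (mu n)
  (F \o @tcons R n).
apply => //; last by move=> x; exact: F0.
by apply: (measurableT_comp mF); exact: measurable_tcons.
Qed.

Lemma integral_vaff n (e : R) (c : n.-tuple R) (F : n.-tuple R -> \bar R) :
  e = 1 \/ e = -1 -> measurable_fun setT F ->
  (\int[mu n]_y F (vaff e c y) = \int[mu n]_y F y)%E.
Proof.
move=> he mF; rewrite integralE [RHS]integralE; congr (_ - _)%E.
- transitivity (\int[mu n]_y (F^\+)%E (vaff e c y))%E.
    by apply: eq_integral => y _; rewrite !funeposE.
  exact: (@ge0_integral_vaff n e c (F^\+)%E he (measurable_funepos mF) (fun x => funepos_ge0 F x)).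
- transitivity (\int[mu n]_y (F^\-)%E (vaff e c y))%E.
    by apply: eq_integral => y _; rewrite !funenegE.
  exact: (@ge0_integral_vaff n e c (F^\-)%E he (measurable_funeneg mF) (fun x => funeneg_ge0 F x)).
Qed.

Definition vopp n (y : n.-tuple R) : n.-tuple R := [tuple - tnth y i | i < n].
Definition vzero n : n.-tuple R := [tuple 0 | i < n].

Lemma vsubE n (x y : n.-tuple R) : vsub x y = vaff (-1) x y.
Proof. by apply: eq_from_tnth => i; rewrite !tnth_mktuple; ring. Qed.
Lemma vsubEr n (x y : n.-tuple R) : vsub x y = vaff 1 (vopp y) x.
Proof. by apply: eq_from_tnth => i; rewrite !tnth_mktuple; ring. Qed.
Lemma voppE n (y : n.-tuple R) : vopp y = vaff (-1) (vzero n) y.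
Proof. by apply: eq_from_tnth => i; rewrite !tnth_mktuple; ring. Qed.

Lemma measurable_vsub d (T : measurableType d) n (f g : T -> n.-tuple R) :
  measurable_fun setT f -> measurable_fun setT g ->
  measurable_fun setT (fun x => vsub (f x) (g x)).
Proof.
move=> /measurable_fun_tnthP mf /measurable_fun_tnthP mg; apply/measurable_fun_tnthP => i.
rewrite (_ : _ \o _ = (fun x => tnth (f x) i - tnth (g x) i)); last first.
  by apply/funext => x /=; rewrite tnth_mktuple.
by apply: measurable_funB; [exact: mf|exact: mg].
Qed.

End Affine.

(** * Extended integrals of nonnegative real functions *)

Section RealIntegrands.
Context {R : realType} {d} {T : measurableType d} (m : {measure set T -> \bar R}).

Lemma le_integral_EFin (f g : T -> R) :
  measurable_fun setT f -> measurable_fun setT g ->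
  (forall x, 0 <= f x) -> (forall x, f x <= g x) ->
  (\int[m]_x (f x)%:E <= \int[m]_x (g x)%:E)%E.
Proof.
move=> mf mg f0 fg; apply: ge0_le_integral => //; try exact/measurable_EFinP.
- by move=> x _; rewrite lee_fin.
- by move=> x _; rewrite lee_fin.
Qed.

Lemma integralZl_EFin (r : R) (f : T -> R) : 0 <= r -> measurable_fun setT f ->
  (forall x, 0 <= f x) -> (\int[m]_x (r * f x)%:E = r%:E * \int[m]_x (f x)%:E)%E.
Proof.
move=> r0 mf f0; under eq_integral do rewrite EFinM.
rewrite ge0_integralZl//; first exact/measurable_EFinP.
by move=> x _; rewrite lee_fin.
Qed.

Lemma integralD_EFin (f g : T -> R) :
  measurable_fun setT f -> measurable_fun setT g ->
  (forall x, 0 <= f x) -> (forall x, 0 <= g x) ->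
  (\int[m]_x (f x + g x)%:E = \int[m]_x (f x)%:E + \int[m]_x (g x)%:E)%E.
Proof.
move=> mf mg f0 g0; under eq_integral do rewrite EFinD.
rewrite ge0_integralD//; try exact/measurable_EFinP.
- by move=> x _; rewrite lee_fin.
- by move=> x _; rewrite lee_fin.
Qed.

Lemma measurable_norm (f : T -> R) : measurable_fun setT f -> measurable_fun setT (fun x => `|f x|).
Proof. by move=> mf; exact: measurableT_comp. Qed.

End RealIntegrands.

(** * Iterated real-valued integrals *)

Section Iterated.
Context {R : realType} {d1 d2} {T1 : measurableType d1} {T2 : measurableType d2}.

(** Positive and negative parts are integrated separately, so measurability is all that is asked:
    where the integral is infinite or undefined, [fine] still depends measurably on [x]. *)
Lemma measurable_Rintegral (m2 : {sigma_finite_measure set T2 -> \bar R}) (F : T1 * T2 -> R) :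
  measurable_fun setT F -> measurable_fun setT (fun x => \int[m2]_y F (x, y)).
Proof.
move=> mF; have mFE : measurable_fun setT (EFin \o F) by exact/measurable_EFinP.
have mp := @measurable_fun_fubini_tonelli_F _ _ T1 T2 R m2 _ (measurable_funepos mFE)
  (fun x => funepos_ge0 _ x).
have mn := @measurable_fun_fubini_tonelli_F _ _ T1 T2 R m2 _ (measurable_funeneg mFE)
  (fun x => funeneg_ge0 _ x).
apply: (measurableT_comp (f := fine)) => //.
rewrite (_ : (fun x => _) = (fun x => fubini_F m2 ((EFin \o F)^\+)%E x - fubini_F m2 ((EFin \o F)^\-)%E x)%E).
  by apply: emeasurable_funB.
apply/funext => x; rewrite integralE; congr (_ - _)%E; apply: eq_integral => y _.
  by rewrite !funeposE.
by rewrite !funenegE.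
Qed.

(** Integrability is asked of every slice, so that [fine] loses nothing in the inner integrals and
    Fubini for extended integrals carries over. *)
Lemma eq_Rintegral_fubini (m1 : {sigma_finite_measure set T1 -> \bar R})
    (m2 : {sigma_finite_measure set T2 -> \bar R}) (F : T1 * T2 -> R) :
  measurable_fun setT F ->
  (\int[m1]_x \int[m2]_y `|F (x, y)|%:E < +oo)%E ->
  (forall x, m2.-integrable setT (fun y => (F (x, y))%:E)) ->
  (forall y, m1.-integrable setT (fun x => (F (x, y))%:E)) ->
  \int[m1]_x \int[m2]_y F (x, y) = \int[m2]_y \int[m1]_x F (x, y).
Proof.
move=> mF Foo i2 i1; have mFE : measurable_fun setT (EFin \o F) by exact/measurable_EFinP.
rewrite /Rintegral; congr fine.
transitivity (\int[m1]_x \int[m2]_y (F (x, y))%:E)%E.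
  by apply: eq_integral => x _; rewrite fineK//; apply: integrable_fin_num.
transitivity (\int[m2]_y \int[m1]_x (F (x, y))%:E)%E; last first.
  by apply: eq_integral => x _; rewrite fineK//; apply: integrable_fin_num.
exact: (Fubini (proj2 (integrable12ltyP m1 m2 mFE) Foo)).
Qed.

End Iterated.

(** * Simultaneous bounds in L^1 and in the supremum norm *)

Section Bounds.
Context {R : realType} {n : nat}.
Implicit Types (g k : n.-tuple R -> R) (c N A : R).

Definition l1 A g := measurable_fun setT g /\ (\int[mu n]_x `|g x|%:E <= A%:E)%E.

(* With c = t^(-n/2) this records both endpoints, q = 1 and q = +oo, of a bound N t^(-n/2 (1 - 1/q)) on the L^q norm. *)
Definition hb c N g :=
  [/\ measurable_fun setT g, (\int[mu n]_x `|g x|%:E <= N%:E)%E & forall x, `|g x| <= N * c].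

Lemma hb_l1 c N g : hb c N g -> l1 N g. Proof. by case. Qed.
Lemma hb_meas c N g : hb c N g -> measurable_fun setT g. Proof. by case. Qed.

Lemma l1_ge0 A g : l1 A g -> 0 <= A.
Proof.
by case=> _ h; rewrite -lee_fin; apply: le_trans h; apply: integral_ge0 => x _; rewrite lee_fin.
Qed.

Lemma hb_ge0 c N g : hb c N g -> 0 <= N. Proof. by move/hb_l1/l1_ge0. Qed.

Lemma l1_integrable A g : l1 A g -> (mu n).-integrable setT (EFin \o g).
Proof.
case=> mg h; apply/integrableP; split; first exact/measurable_EFinP.
by apply: le_lt_trans (ltry A); apply: le_trans h.
Qed.

Lemma l1_mono A B g k : l1 A k -> measurable_fun setT g -> (forall x, `|g x| <= `|k x|) ->
  A <= B -> l1 B g.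
Proof.
move=> [mk hk] mg gk AB; split => //; apply: (@le_trans _ _ A%:E); last by rewrite lee_fin.
by apply: le_trans hk; apply: le_integral_EFin => //; exact: measurable_norm.
Qed.

Lemma hb_dom c c' N N' g k : hb c N k -> measurable_fun setT g -> (forall x, `|g x| <= `|k x|) ->
  N <= N' -> 0 <= c -> c <= c' -> hb c' N' g.
Proof.
move=> hk mg gk NN c0 cc; have [_ Hg] := l1_mono (hb_l1 hk) mg gk NN.
split => // x; apply: le_trans (gk x) _; apply: (@le_trans _ _ (N * c)); first by case: hk.
by apply: ler_pM => //; exact: hb_ge0 hk.
Qed.

Lemma hb_le c N N' g : hb c N g -> 0 <= c -> N <= N' -> hb c N' g.
Proof. by move=> hg c0 NN; apply: (hb_dom hg) => //; exact: hb_meas hg. Qed.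

Lemma l1D A B g k : l1 A g -> l1 B k -> l1 (A + B) (fun x => g x + k x).
Proof.
move=> [mg hg] [mk hk]; split; first exact: measurable_funD.
apply: (@le_trans _ _ (\int[mu n]_x (`|g x| + `|k x|)%:E)%E).
  apply: le_integral_EFin => //; last by move=> x; exact: ler_normD.
    by apply: measurable_norm; exact: measurable_funD.
  by apply: measurable_funD; exact: measurable_norm.
by rewrite integralD_EFin//; [rewrite EFinD leeD|exact: measurable_norm|exact: measurable_norm].
Qed.

Lemma hbD c N N' g k : hb c N g -> hb c N' k -> hb c (N + N') (fun x => g x + k x).
Proof.
move=> hg hk; have [m1 h1] := l1D (hb_l1 hg) (hb_l1 hk); split => // x.
by rewrite mulrDl; apply: le_trans (ler_normD _ _) _; apply: lerD; [case: hg|case: hk].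
Qed.

Lemma l1Z A g r : l1 A g -> l1 (`|r| * A) (fun x => r * g x).
Proof.
move=> [mg hg]; split; first exact: measurable_funM.
under eq_integral do rewrite normrM.
by rewrite integralZl_EFin//; [rewrite EFinM lee_wpmul2l|exact: measurable_norm].
Qed.

Lemma hbZ c N g r : hb c N g -> hb c (`|r| * N) (fun x => r * g x).
Proof.
move=> hg; have [m1 h1] := l1Z r (hb_l1 hg); split => // x.
by rewrite normrM -mulrA ler_wpM2l//; case: hg.
Qed.

Lemma hbN c N g : hb c N g -> hb c N (fun x => - g x).
Proof.
by move=> hg; have := hbZ (-1) hg; rewrite normrN1 mul1r; under eq_fun do rewrite mulN1r.
Qed.

Lemma hbB c N N' g k : hb c N g -> hb c N' k -> hb c (N + N') (fun x => g x - k x).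
Proof. by move=> hg hk; apply: hbD => //; exact: hbN. Qed.

Lemma hb_domZ c K N g k : hb c N k -> measurable_fun setT g -> 0 <= c ->
  (forall x, `|g x| <= K * `|k x|) -> hb c (`|K| * N) g.
Proof.
move=> hk mg c0 gk; apply: (hb_dom (hbZ K hk)) => // x.
by rewrite normrM; apply: le_trans (gk x) _; rewrite ler_wpM2r// ler_norm.
Qed.

Lemma l1_vaff A g e (z : n.-tuple R) : e = 1 \/ e = -1 -> l1 A g -> l1 A (fun x => g (vaff e z x)).
Proof.
move=> he [mg hg]; split; first by apply: (measurableT_comp mg); exact: measurable_vaff.
rewrite (@integral_vaff R n e z (fun x => `|g x|%:E) he)//.
by apply/measurable_EFinP; exact: measurableT_comp.
Qed.

Lemma hb_vaff c N g e (z : n.-tuple R) : e = 1 \/ e = -1 -> hb c N g -> hb c N (fun x => g (vaff e z x)).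
Proof.
by move=> he hg; have [m1 h1] := l1_vaff z he (hb_l1 hg); split => // x; case: hg.
Qed.

Lemma hb_shift c N g z : hb c N g -> hb c N (fun x => g (vsub x z)).
Proof. by move=> hg; under eq_fun do rewrite vsubEr; apply: hb_vaff => //; left. Qed.

Lemma hb_refl c N g z : hb c N g -> hb c N (fun x => g (vsub z x)).
Proof. by move=> hg; under eq_fun do rewrite vsubE; apply: hb_vaff => //; right. Qed.

(* Minkowski's integral inequality, in L^1 and in the supremum norm at once. *)
Lemma hb_integral d (T : measurableType d) (nu : {sigma_finite_measure set T -> \bar R})
    c B (b : T -> R) (F : T * n.-tuple R -> R) : 0 <= c ->
  measurable_fun setT F -> measurable_fun setT b ->
  (forall z, hb c (b z) (fun x => F (z, x))) -> (\int[nu]_z (b z)%:E <= B%:E)%E ->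
  (forall x, nu.-integrable setT (fun z => (F (z, x))%:E)) /\
  hb c B (fun x => \int[nu]_z F (z, x)).
Proof.
move=> c0 mF mb hF hB.
have mFx x : measurable_fun setT (fun z => F (z, x)).
  by apply: (measurableT_comp mF); exact: measurable_fun_pair.
have b0 z : 0 <= b z by exact: hb_ge0 (hF z).
have sup x : (\int[nu]_z `|F (z, x)|%:E <= (B * c)%:E)%E.
  apply: (@le_trans _ _ (\int[nu]_z (c * b z)%:E)%E).
    apply: le_integral_EFin => //; [exact: measurable_norm|exact: measurable_funM|].
    by move=> z; rewrite mulrC; case: (hF z).
  by rewrite integralZl_EFin// mulrC EFinM lee_wpmul2l.
have intF x : nu.-integrable setT (fun z => (F (z, x))%:E).
  apply/integrableP; split; first exact/measurable_EFinP.
  by apply: le_lt_trans (ltry (B * c)); exact: sup.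
have absF x : (`|\int[nu]_z F (z, x)|%:E <= \int[nu]_z `|F (z, x)|%:E)%E.
  rewrite EFin_normr_Rintegral//; last exact: intF.
  by apply: le_trans (le_abse_integral _ _ _) _ => //; exact/measurable_EFinP.
have mS : measurable_fun setT (F \o (fun p : n.-tuple R * T => (p.2, p.1))).
  by apply: (measurableT_comp mF); exact: measurable_fun_pair.
have mI := measurable_Rintegral nu mS.
split => //; split => //; last first.
  by move=> x; rewrite -lee_fin; apply: le_trans (absF x) (sup x).
have mA : measurable_fun setT (fun p : n.-tuple R * T => `|F (p.2, p.1)|%:E).
  by apply/measurable_EFinP; exact: measurableT_comp.
apply: (@le_trans _ _ (\int[mu n]_x \int[nu]_z `|F (z, x)|%:E)%E).
  apply: ge0_le_integral => //.
  - by apply/measurable_EFinP; exact: measurableT_comp.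
  - have := @measurable_fun_fubini_tonelli_F _ _ _ _ R nu _ mA; apply.
    by move=> p; rewrite lee_fin.
rewrite (@fubini_tonelli _ _ _ _ R (mu n) nu (fun p => `|F (p.2, p.1)|%:E))//=.
apply: le_trans hB; apply: ge0_le_integral => //.
- by move=> z _; apply: integral_ge0 => x _; rewrite lee_fin.
- have mA2 : measurable_fun setT (fun p : T * n.-tuple R => `|F p|%:E).
    by apply/measurable_EFinP; exact: measurableT_comp.
  have := @measurable_fun_fubini_tonelli_F _ _ _ _ R (mu n) _ mA2.
  rewrite /fubini_F; apply.
  by move=> p; rewrite lee_fin.
- exact/measurable_EFinP.
- by move=> z _; case: (hF z).
Qed.

End Bounds.

(** * Convolution *)

Section Convolution.
Context {R : realType} {n : nat}.
Implicit Types (g k : n.-tuple R -> R) (c N A B : R) (x y z : n.-tuple R).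

Definition cnv k g x : R := \int[mu n]_y (k (vsub x y) * g y).

Lemma vsubK x z : vsub x (vsub x z) = z.
Proof. by apply: eq_from_tnth => i; rewrite !tnth_mktuple; ring. Qed.

Lemma eq_Rintegral_vaff (F : n.-tuple R -> R) e z : e = 1 \/ e = -1 -> measurable_fun setT F ->
  \int[mu n]_y F (vaff e z y) = \int[mu n]_y F y.
Proof.
by move=> he mF; rewrite /Rintegral (@integral_vaff R n e z (EFin \o F) he)//; exact/measurable_EFinP.
Qed.

Lemma Rintegral_refl (F : n.-tuple R -> R) x : measurable_fun setT F ->
  \int[mu n]_y F (vsub x y) = \int[mu n]_y F y.
Proof.
move=> mF; rewrite -(eq_Rintegral_vaff x (or_intror erefl) mF).
by apply: eq_Rintegral => y _; rewrite vsubE.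
Qed.

Lemma Rintegral_shift (F : n.-tuple R -> R) x : measurable_fun setT F ->
  \int[mu n]_y F (vsub y x) = \int[mu n]_y F y.
Proof.
move=> mF; rewrite -(eq_Rintegral_vaff (vopp x) (or_introl erefl) mF).
by apply: eq_Rintegral => y _; rewrite vsubEr.
Qed.

Lemma measurable_vsub1 x : measurable_fun setT (fun y => vsub x y).
Proof. by apply: measurable_vsub => //; exact: measurable_cst. Qed.

Lemma measurable_vsub2 x : measurable_fun setT (fun y => vsub y x).
Proof. by apply: measurable_vsub => //; exact: measurable_cst. Qed.

Lemma cnvC k g : measurable_fun setT k -> measurable_fun setT g -> cnv k g = cnv g k.
Proof.
move=> mk mg; apply/funext => x; rewrite /cnv.
rewrite -(Rintegral_refl x (F := fun y => k (vsub x y) * g y)); last first.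
  by apply: measurable_funM => //; apply: measurableT_comp => //; exact: measurable_vsub1.
by apply: eq_Rintegral => y _; rewrite vsubK mulrC.
Qed.

Lemma hb_mul_l1 c N A k g : hb c N k -> l1 A g -> l1 (N * c * A) (fun y => k y * g y).
Proof.
move=> [mk _ hk] hg; have [mg _] := hg.
have Nc0 : 0 <= N * c by apply: le_trans (hk (vzero n)).
have := l1Z (N * c) hg; rewrite ger0_norm// => h.
apply: (l1_mono h) => //; first exact: measurable_funM.
by move=> y; rewrite normrM [leRHS]normrM (ger0_norm Nc0) ler_wpM2r.
Qed.

Lemma cnv_integrand_l1 c N A k g x : hb c N k -> l1 A g ->
  l1 (N * c * A) (fun y => k (vsub x y) * g y).
Proof. by move=> hk hg; apply: hb_mul_l1 => //; exact: hb_refl. Qed.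

Lemma cnv_integrable c N A k g x : hb c N k -> l1 A g ->
  (mu n).-integrable setT (fun y => (k (vsub x y) * g y)%:E).
Proof. by move=> hk hg; exact: l1_integrable (cnv_integrand_l1 x hk hg). Qed.

Lemma measurable_cnv_integrand k g : measurable_fun setT k -> measurable_fun setT g ->
  measurable_fun setT (fun p : n.-tuple R * n.-tuple R => k (vsub p.2 p.1) * g p.1).
Proof.
move=> mk mg; apply: measurable_funM; last exact: measurableT_comp.
by apply: measurableT_comp => //; apply: measurable_vsub.
Qed.

(** Young's inequality out of Minkowski's: the convolution superposes the translates of [k] with
    weights [g y], and each translate obeys the bounds of [k]. *)
Lemma cnv_hb c N A k g : 0 <= c -> hb c N k -> l1 A g -> hb c (N * A) (cnv k g).
Proof.
move=> c0 hk [mg hg].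
have mn : measurable_fun setT (fun y : n.-tuple R => `|g y| * N).
  by apply: measurable_funM => //; exact: measurable_norm.
apply: (hb_integral (b := fun y => `|g y| * N) c0 (measurable_cnv_integrand (hb_meas hk) mg) mn _ _).2.
  move=> z /=; have := hbZ (g z) (hb_shift z hk).
  by under eq_fun do rewrite mulrC.
under eq_integral do rewrite mulrC.
rewrite integralZl_EFin//; last exact: measurable_norm.
  by rewrite EFinM lee_wpmul2l// lee_fin; exact: hb_ge0 hk.
exact: hb_ge0 hk.
Qed.

(** By commutativity the second factor may carry the supremum bound instead; choosing between the
    two versions is what preserves decay in time in [hb_cnv]. *)
Lemma cnv_hb_r c N A k g : 0 <= c -> l1 A k -> hb c N g -> hb c (A * N) (cnv k g).
Proof.
move=> c0 hk hg; rewrite (mulrC A N) cnvC; [|by case: hk|exact: hb_meas hg].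
exact: cnv_hb.
Qed.

Lemma cnvDr c N A B k g h x : hb c N k -> l1 A g -> l1 B h ->
  cnv k (fun y => g y + h y) x = cnv k g x + cnv k h x.
Proof.
move=> hk hg hh; rewrite /cnv -RintegralD//; [|exact: cnv_integrable hk hg|exact: cnv_integrable hk hh].
by apply: eq_Rintegral => y _; rewrite mulrDr.
Qed.

Lemma cnvBr c N A B k g h x : hb c N k -> l1 A g -> l1 B h ->
  cnv k (fun y => g y - h y) x = cnv k g x - cnv k h x.
Proof.
move=> hk hg hh; rewrite /cnv -RintegralB//; [|exact: cnv_integrable hk hg|exact: cnv_integrable hk hh].
by apply: eq_Rintegral => y _; rewrite mulrBr.
Qed.

Lemma cnvZr c N A k g r x : hb c N k -> l1 A g -> cnv k (fun y => r * g y) x = r * cnv k g x.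
Proof.
move=> hk hg; rewrite /cnv -RintegralZl//; last exact: cnv_integrable hk hg.
by apply: eq_Rintegral => y _; rewrite mulrCA.
Qed.

Lemma cnv_vopp k g x : measurable_fun setT k -> measurable_fun setT g ->
  cnv k g (vopp x) = cnv (fun z => k (vopp z)) (fun z => g (vopp z)) x.
Proof.
move=> mk mg; rewrite /cnv.
rewrite -(eq_Rintegral_vaff (F := fun y => k (vsub (vopp x) y) * g y) (vzero n) (or_intror erefl)); last first.
  by apply: measurable_funM => //; apply: measurableT_comp => //; exact: measurable_vsub1.
apply: eq_Rintegral => y _; rewrite -voppE; congr (k _ * _).
by apply: eq_from_tnth => i; rewrite !tnth_mktuple; ring.
Qed.

(** Fubini with hypotheses phrased by [hb]. Associativity of convolution, the heat flow of a Duhamel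
    term and the pairing of such a term with a function are instances. *)
Lemma cnv_Rintegral d (T : measurableType d) (nu : {sigma_finite_measure set T -> \bar R})
    c c' N B (b : T -> R) (F : T * n.-tuple R -> R) k x : 0 <= c -> hb c' N k ->
  measurable_fun setT F -> measurable_fun setT b ->
  (forall s, hb c (b s) (fun x => F (s, x))) -> (\int[nu]_z (b z)%:E <= B%:E)%E ->
  cnv k (fun y => \int[nu]_s F (s, y)) x = \int[nu]_s cnv k (fun y => F (s, y)) x.
Proof.
move=> c0 hk mF mb hF hB; have [iF hI] := hb_integral c0 mF mb hF hB.
have mk := hb_meas hk.
pose H (p : n.-tuple R * T) := k (vsub x p.1) * F (p.2, p.1).
have mFs : measurable_fun setT (fun p : n.-tuple R * T => F (p.2, p.1)).
  by apply: (measurableT_comp mF); exact: measurable_fun_pair.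
have mH : measurable_fun setT H.
  apply: measurable_funM => //.
  by apply: (measurableT_comp mk); apply: measurable_vsub => //; exact: measurable_cst.
have b0 s : 0 <= b s by exact: hb_ge0 (hF s).
have mFx y : measurable_fun setT (fun s => F (s, y)).
  by apply: (measurableT_comp mF); exact: measurable_fun_pair.
have sup y : (\int[nu]_s `|F (s, y)|%:E <= (B * c)%:E)%E.
  apply: (@le_trans _ _ (\int[nu]_z (c * b z)%:E)%E).
    apply: le_integral_EFin => //; [exact: measurable_norm|exact: measurable_funM|].
    by move=> z; rewrite mulrC; case: (hF z).
  by rewrite integralZl_EFin// mulrC EFinM lee_wpmul2l.
have B0 : 0 <= B.
  by rewrite -lee_fin; apply: le_trans hB; apply: integral_ge0 => s _; rewrite lee_fin.
have hkx := hb_refl x hk.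
transitivity (\int[mu n]_y \int[nu]_s H (y, s)).
  by apply: eq_Rintegral => y _; rewrite -RintegralZl//; exact: iF.
rewrite eq_Rintegral_fubini//.
- have mHa := @measurable_fun_fubini_tonelli_F _ _ _ _ R nu (fun p => `|H p|%:E).
  apply: (@le_lt_trans _ _ (\int[mu n]_y (B * c * `|k (vsub x y)|)%:E)%E); last first.
    rewrite integralZl_EFin//; [|by rewrite mulr_ge0|by apply: measurable_norm; exact: hb_meas hkx].
    case: hkx => _ h _; apply: (@le_lt_trans _ _ ((B * c)%:E * N%:E)%E); last by rewrite -EFinM ltry.
    by rewrite lee_wpmul2l// lee_fin mulr_ge0.
  apply: ge0_le_integral => //.
  + by move=> y _; apply: integral_ge0 => s _; rewrite lee_fin.
  + apply: mHa; first by apply/measurable_EFinP; exact: measurable_norm.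
    by move=> p; rewrite lee_fin.
  + apply/measurable_EFinP; apply: measurable_funM => //.
    by apply: measurable_norm; exact: hb_meas hkx.
  + move=> y _; under eq_integral do rewrite normrM /=.
    rewrite (@integralZl_EFin _ _ _ nu _ (fun s => `|F (s, y)|))//; last exact: measurable_norm.
    by rewrite mulrC EFinM lee_wpmul2l.
- move=> y; apply: (@eq_integrable _ _ _ nu setT _ (fun s => (k (vsub x y))%:E * (F (s, y))%:E)%E) => //.
  exact: integrableZl.
- by move=> s; apply: l1_integrable; apply: (cnv_integrand_l1 x hk) (hb_l1 (hF s)).
Qed.

(** The inner convolution is an integral over translates of [k'], so [cnv_Rintegral] applies; a
    shift by [z] of the remaining variable then exhibits the convolution of the two kernels. *)
Lemma cnvA c c' N N' A k k' g : 0 <= c' -> hb c N k -> hb c' N' k' -> l1 A g ->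
  cnv k (cnv k' g) = cnv (cnv k k') g.
Proof.
move=> c0 hk hk' [mg hg]; apply/funext => x.
have mn : measurable_fun setT (fun y : n.-tuple R => `|g y| * N').
  by apply: measurable_funM => //; exact: measurable_norm.
rewrite {2}/cnv.
rewrite (@cnv_Rintegral _ _ (mu n) c' c N (N' * A) (fun y => `|g y| * N')
  (fun p => k' (vsub p.2 p.1) * g p.1))//.
- apply: eq_Rintegral => z _ /=.
  rewrite /cnv -RintegralZr//; last first.
    exact: (cnv_integrable (vsub x z) hk (hb_l1 hk')).
  rewrite -[RHS](Rintegral_shift z); last first.
    apply: measurable_funM => //; apply: measurable_funM.
      by apply: (measurableT_comp (hb_meas hk)); exact: measurable_vsub1.
    exact: hb_meas hk'.
  apply: eq_Rintegral => y _; rewrite mulrA; congr (k _ * _ * _).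
  by apply: eq_from_tnth => i; rewrite !tnth_mktuple; ring.
- exact: measurable_cnv_integrand (hb_meas hk') mg.
- move=> z /=; have := hbZ (g z) (hb_shift z hk').
  by under eq_fun do rewrite mulrC.
- under eq_integral do rewrite mulrC.
  rewrite integralZl_EFin//; last exact: measurable_norm.
    by rewrite EFinM lee_wpmul2l// lee_fin; exact: hb_ge0 hk'.
  exact: hb_ge0 hk'.
Qed.

End Convolution.

(** * Real powers and exponential inequalities *)

Section Powers.
Context {R : realType}.
Implicit Types x y r s : R.

Lemma powR_add x r s : 0 < x -> x `^ (r + s) = x `^ r * x `^ s.
Proof. by move=> x0; rewrite powRD// (gt_eqF x0) implybT. Qed.

Lemma powR_anti x y r : r <= 0 -> 0 < x -> x <= y -> y `^ r <= x `^ r.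
Proof.
move=> r0 x0 xy; rewrite -(opprK r) !(powRN _ (- r)) lef_pV2 ?posrE ?powR_gt0//; last exact: lt_le_trans xy.
by apply: ge0_ler_powR; rewrite ?nnegrE ?oppr_ge0 ?(ltW x0) ?(ltW (lt_le_trans x0 xy)).
Qed.

Lemma powR_mono x y r : 0 <= r -> 0 <= x -> x <= y -> x `^ r <= y `^ r.
Proof. by move=> r0 x0 xy; apply: ge0_ler_powR; rewrite ?nnegrE//; apply: le_trans xy. Qed.

Lemma powR_exp_mono x r s : 1 <= x -> r <= s -> x `^ r <= x `^ s.
Proof. by move=> x1 rs; apply: ler_powR. Qed.

Lemma powR_exp_anti x r s : 0 < x -> x <= 1 -> r <= s -> x `^ s <= x `^ r.
Proof.
move=> x0 x1 rs; have := @powR_exp_mono x^-1 r s; rewrite invf_ge1// x1 => /(_ isT rs).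
by rewrite -(powR_inv1 (ltW x0)) -!powRrM !mulN1r !powRN lef_pV2 ?posrE ?powR_gt0.
Qed.

(** Inversion is a [powR] on the nonnegative half-line, continued as an odd function. *)
Lemma measurable_inv d (T : measurableType d) (f : T -> R) :
  measurable_fun setT f -> measurable_fun setT (fun z : T => (f z)^-1).
Proof.
move=> mf; apply: (measurableT_comp (f := @GRing.inv R)) => //.
rewrite (_ : @GRing.inv R = (fun x => if 0 <= x then x `^ (-1) else - ((- x) `^ (-1)))).
  apply: measurable_fun_ifT => /=.
  - by apply: measurable_fun_ler => //; exact: measurable_cst.
  - exact: measurable_powR.
  - apply: measurableT_comp => //; apply: (measurableT_comp (f := fun x => x `^ (-1))) => //.
apply/funext => x; case: ifPn => x0; first by rewrite powR_inv1.
by rewrite powR_inv1 ?invrN ?opprK// oppr_ge0 ltW// ltNge.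
Qed.

(** The exponent [1/8] is what remains of the Gaussian [1/4] when half of the decay is kept: it pays
    for one factor [|z| / sqrt t] at the price of doubling the time. *)
Lemma mul_expR_le x : x * expR (- (x ^+ 2 / 8)) <= 2.
Proof.
rewrite expRN ler_pdivrMr ?expR_gt0//.
have := expR_ge1Dx (x ^+ 2 / 8).
have := sqr_ge0 (x - 2); nra.
Qed.

(** For [x - y <= 1] this is [1 - exp (-u) <= u], half of the decay at [y] absorbing the factor
    [2 y + 1]; for [x - y > 1] the left side alone is small enough. *)
Lemma expR_sqr_diff x y : 0 <= y -> y <= x ->
  expR (- y ^+ 2) - expR (- x ^+ 2) <= 4 * (x - y) * expR (- (y ^+ 2 / 2)).
Proof.
move=> y0 yx; set d := x - y; have d0 : 0 <= d by rewrite subr_ge0.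
have -> : x ^+ 2 = y ^+ 2 + d * (2 * y + d) by rewrite /d; ring.
rewrite opprD expRD -{1}(mulr1 (expR _)) -mulrBr.
have -> : - y ^+ 2 = - (y ^+ 2 / 2) + - (y ^+ 2 / 2) by field.
set q := y ^+ 2 / 2; rewrite expRD -[leLHS]mulrA (mulrC (4 * d)) ler_wpM2l ?expR_ge0//.
have := expR_ge1Dx (- (d * (2 * y + d))); set E := expR (- (d * _)) => hE.
have E0 : 0 < E by exact: expR_gt0.
have q0 : expR (- q) <= 1 by rewrite -expR0 ler_expR oppr_le0 /q; nra.
have q1 := expR_gt0 (- q).
have [d1|d1] := leP d 1; last by nra.
apply: (@le_trans _ _ (expR (- q) * (d * (2 * y + 1)))).
  by rewrite ler_pM2l//; nra.
rewrite expRN mulrC ler_pdivrMr ?expR_gt0//.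
have := expR_ge1Dx q; rewrite /q => hq.
have : (2 * y + 1) <= 4 * expR (y ^+ 2 / 2) by nra.
nra.
Qed.

End Powers.

(** * Euclidean inner product and norm *)

Section Euclidean.
Context {R : realType} {n : nat}.
Implicit Types (x y z w a : n.-tuple R).

Definition dot a z : R := \sum_(i < n) tnth a i * tnth z i.
Definition nrm z : R := Num.sqrt (sqnorm z).

Lemma sqnorm_ge0 z : 0 <= sqnorm z.
Proof. by apply: sumr_ge0 => i _; exact: sqr_ge0. Qed.

Lemma nrm_ge0 z : 0 <= nrm z. Proof. exact: sqrtr_ge0. Qed.

Lemma nrm_sqr z : nrm z ^+ 2 = sqnorm z.
Proof. by rewrite sqr_sqrtr// sqnorm_ge0. Qed.

Lemma dotC a z : dot a z = dot z a.
Proof. by apply: eq_bigr => i _; rewrite mulrC. Qed.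

Lemma dotBr a z w : dot a (vsub z w) = dot a z - dot a w.
Proof. by rewrite /dot -sumrB; apply: eq_bigr => i _; rewrite tnth_mktuple mulrBr. Qed.

Lemma dot_vopp a z : dot a (vopp z) = - dot a z.
Proof. by rewrite /dot -sumrN; apply: eq_bigr => i _; rewrite tnth_mktuple mulrN. Qed.

Lemma sqnorm_vopp z : sqnorm (vopp z) = sqnorm z.
Proof. by apply: eq_bigr => i _; rewrite tnth_mktuple sqrrN. Qed.

Lemma nrm_vopp z : nrm (vopp z) = nrm z. Proof. by rewrite /nrm sqnorm_vopp. Qed.

Lemma sqnormB z w : sqnorm (vsub z w) = sqnorm z - 2 * dot z w + sqnorm w.
Proof.
rewrite /sqnorm /dot mulr_sumr -sumrB -big_split; apply: eq_bigr => i _.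
by rewrite tnth_mktuple /=; ring.
Qed.

Lemma sqnorm_vaddsc z h a : sqnorm (vaddsc z h a) = sqnorm z + 2 * h * dot z a + h ^+ 2 * sqnorm a.
Proof.
rewrite /sqnorm /dot !mulr_sumr -!big_split; apply: eq_bigr => i _.
by rewrite tnth_mktuple /=; ring.
Qed.

(** Cauchy-Schwarz, from the nonnegativity of the quadratic [h |-> |a + h z|^2]. *)
Lemma dot_le a z : `|dot a z| <= nrm a * nrm z.
Proof.
rewrite -(@ler_pXn2r _ 2)// ?nnegrE ?mulr_ge0 ?nrm_ge0// real_normK ?num_real// exprMn !nrm_sqr.
have Q h : 0 <= sqnorm a + 2 * h * dot a z + h ^+ 2 * sqnorm z.
  by rewrite -sqnorm_vaddsc sqnorm_ge0.
have A0 := sqnorm_ge0 a; have Z0 := sqnorm_ge0 z.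
have [Z|Z] := eqVneq (sqnorm z) 0.
  have [->|D0] := eqVneq (dot a z) 0; first by rewrite expr0n /= mulr_ge0.
  (* With [|z| = 0] the quadratic is affine in [h]; here it would take the value [-1]. *)
  have := Q (- ((sqnorm a + 1) / (2 * dot a z))); rewrite Z mulr0 addr0.
  by rewrite (_ : _ + _ = -1); [lra|field].
have Zp : 0 < sqnorm z by rewrite lt_neqAle eq_sym Z.
(* The minimizer of the quadratic. *)
have := Q (- (dot a z / sqnorm z)).
rewrite (_ : _ + _ = sqnorm a - dot a z ^+ 2 / sqnorm z); last by field.
by rewrite subr_ge0 ler_pdivrMr.
Qed.

Lemma nrm_sub_le z w : nrm z - nrm w <= nrm (vsub z w).
Proof.
have [h|h] := leP (nrm z) (nrm w); first by apply: le_trans (nrm_ge0 _); rewrite subr_le0.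
rewrite -(@ler_pXn2r _ 2)// ?nnegrE ?nrm_ge0 ?subr_ge0 ?(ltW h)// nrm_sqr sqnormB.
have := dot_le z w; rewrite -!nrm_sqr => hd; have := ler_norm (dot z w).
by nra.
Qed.

Lemma nrm_vsubC z w : nrm (vsub z w) = nrm (vsub w z).
Proof. by congr Num.sqrt; rewrite !sqnormB (dotC w); ring. Qed.

Lemma vsub_shift z y : vsub (vsub z y) z = vopp y.
Proof. by apply: eq_from_tnth => i; rewrite !tnth_mktuple; ring. Qed.

Lemma measurable_dot d (T : measurableType d) a (f : T -> n.-tuple R) :
  measurable_fun setT f -> measurable_fun setT (fun t : T => dot a (f t)).
Proof.
move=> /measurable_fun_tnthP mf; apply: measurable_sum => i.
by apply: measurable_funM => //; exact: mf.
Qed.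

Lemma measurable_sqnorm d (T : measurableType d) (f : T -> n.-tuple R) :
  measurable_fun setT f -> measurable_fun setT (fun t : T => sqnorm (f t)).
Proof.
move=> /measurable_fun_tnthP mf; apply: measurable_sum => i.
by apply: (measurable_funX 2); exact: mf.
Qed.

Lemma measurable_nrm d (T : measurableType d) (f : T -> n.-tuple R) :
  measurable_fun setT f -> measurable_fun setT (fun t : T => nrm (f t)).
Proof.
move=> mf; rewrite /nrm; under eq_fun do rewrite -powR12_sqrt ?sqnorm_ge0//.
by apply: (measurableT_comp (@measurable_powR R 2^-1)); exact: measurable_sqnorm.
Qed.

End Euclidean.

(** * The mass of the Gaussian *)

Section GaussIntegral.
Context {R : realType}.

Lemma gauss_ge0 n t (z : n.-tuple R) : 0 <= gauss t z.
Proof. by rewrite mulr_ge0 ?powR_ge0 ?expR_ge0. Qed.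

Lemma measurable_gauss n d (T : measurableType d) (f : T -> R) (g : T -> n.-tuple R) :
  measurable_fun setT f -> measurable_fun setT g ->
  measurable_fun setT (fun x => gauss (f x) (g x)).
Proof.
move=> mf mg; apply: measurable_funM.
  apply: (measurableT_comp (@measurable_powR R (- (n%:R / 2)))).
  by apply: measurable_funM => //; exact: measurable_cst.
apply: (measurableT_comp (@measurable_expR R)); apply: measurable_funM.
  by apply: measurableT_comp => //; exact: measurable_sqnorm.
by apply: measurable_inv; apply: measurable_funM => //; exact: measurable_cst.
Qed.

Lemma sqnorm_tcons n x (y : n.-tuple R) : sqnorm (tcons (x, y)) = x ^+ 2 + sqnorm y.
Proof.
rewrite /sqnorm big_ord_recl tnth0; congr (_ + _).
by apply: eq_bigr => i _; rewrite tnthS.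
Qed.

(** In one variable the heat kernel at time [t] is the normal density of variance [2 t], whose mass
    is known; the kernel factors over the coordinates. *)
Lemma gauss_tcons n (t x : R) (y : n.-tuple R) : 0 < t ->
  gauss t (tcons (x, y)) = normal_pdf 0 (Num.sqrt (2 * t)) x * gauss t y.
Proof.
move=> t0; have s0 : Num.sqrt (2 * t) != 0 by rewrite gt_eqF// sqrtr_gt0 mulr_gt0.
have p0 : 0 < 4 * pi * t by rewrite !mulr_gt0 ?pi_gt0.
rewrite normal_pdfE// /normal_peak /normal_fun /gauss sqnorm_tcons.
rewrite (_ : - (n.+1%:R / 2) = - (2^-1) + - (n%:R / 2) :> R); last by rewrite -addn1 natrD; field.
rewrite powR_add// (_ : - (x ^+ 2 + sqnorm y) / (4 * t) = - x ^+ 2 / (4 * t) + - sqnorm y / (4 * t)) ?expRD ?subr0; last by ring.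
rewrite sqr_sqrtr ?mulr_ge0 ?(ltW t0)// powRN powR12_sqrt ?(ltW p0)//.
rewrite (_ : 2 * t * pi *+ 2 = 4 * pi * t); last by ring.
rewrite (_ : 2 * t *+ 2 = 4 * t); last by ring.
by rewrite !mulrA; congr (_ * _); rewrite -!mulrA; congr (_ * _); rewrite mulrC.
Qed.

Lemma integral_gauss n (t : R) : 0 < t -> (\int[mu n]_z (gauss t z)%:E = 1)%E.
Proof.
move=> t0; elim: n => [|n IH].
  rewrite /= integral_dirac//; last first.
    by apply/measurable_EFinP; apply: measurable_gauss => //; exact: measurable_cst.
  by rewrite diracT mul1e /gauss /sqnorm big_ord0 !oppr0 !mul0r !oppr0 powRr0 expR0 mulr1.
rewrite /= ge0_integral_consm.
- under eq_integral => x _.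
    under eq_integral => y _ do rewrite (gauss_tcons x y t0).
    rewrite integralZl_EFin ?normal_pdf_ge0//; last first.
    + by move=> z; exact: gauss_ge0.
    + by apply: measurable_gauss => //; exact: measurable_cst.
    rewrite IH mule1.
    over.
  exact: integral_normal_pdf.
- by apply/measurable_EFinP; apply: measurable_gauss => //; exact: measurable_cst.
- by move=> x; rewrite lee_fin gauss_ge0.
Qed.

End GaussIntegral.

(** * Pointwise bounds for the heat kernel and its directional derivative *)

Section HeatKernel.
Context {R : realType} {n : nat}.
Implicit Types (x y z w a : n.-tuple R) (t s : R).

(** The scale of the supremum norm at time [t], relative to that of L^1. *)
Definition cc t : R := t `^ (- (n%:R / 2)).
(** The price of replacing a time by its double in [gauss] or in [cc]. *)
Definition cG : R := 2 `^ (n%:R / 2).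
(* The derivative of [gauss t] in the direction a. *)
Definition Dk a t z : R := - (dot a z / (2 * t)) * gauss t z.

Lemma cc_ge0 t : 0 <= cc t. Proof. exact: powR_ge0. Qed.

Lemma cc_anti s t : 0 < s -> s <= t -> cc t <= cc s.
Proof. by move=> s0 st; apply: powR_anti => //; rewrite oppr_le0 divr_ge0. Qed.

Lemma cG_ge1 : 1 <= cG.
Proof. by have := @powR_exp_mono R 2 0 (n%:R / 2); rewrite powRr0; apply; [lra|rewrite divr_ge0]. Qed.

Lemma gauss_vopp t z : gauss t (vopp z) = gauss t z.
Proof. by rewrite /gauss sqnorm_vopp. Qed.

Lemma Dk_vopp a t z : Dk a t (vopp z) = - Dk a t z.
Proof. by rewrite /Dk gauss_vopp dot_vopp; ring. Qed.

Lemma measurable_gauss1 t : measurable_fun setT (@gauss R n t).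
Proof. by apply: measurable_gauss => //; exact: measurable_cst. Qed.

Lemma measurable_Dk a d (T : measurableType d) (f : T -> R) (g : T -> n.-tuple R) :
  measurable_fun setT f -> measurable_fun setT g ->
  measurable_fun setT (fun v : T => Dk a (f v) (g v)).
Proof.
move=> mf mg; apply: measurable_funM; last exact: measurable_gauss.
apply: measurableT_comp => //; apply: measurable_funM; first exact: measurable_dot.
by apply: measurable_inv; apply: measurable_funM => //; exact: measurable_cst.
Qed.

Lemma measurable_Dk1 a t : measurable_fun setT (Dk a t).
Proof. by apply: measurable_Dk => //; exact: measurable_cst. Qed.

Lemma gauss_le_cc t z : 0 < t -> gauss t z <= cc t.
Proof.
move=> t0; rewrite /gauss -[leRHS]mulr1; apply: ler_pM; rewrite ?powR_ge0 ?expR_ge0//.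
  apply: powR_anti => //.
  by have := @pi_ge2 R; nra.
rewrite -expR0 ler_expR mulNr oppr_le0 divr_ge0 ?sqnorm_ge0//.
by rewrite mulr_ge0// ltW.
Qed.

Lemma hb_gauss t : 0 < t -> hb (cc t) 1 (@gauss R n t).
Proof.
move=> t0; split; first exact: measurable_gauss1.
- under eq_integral do rewrite ger0_norm ?gauss_ge0//.
  by rewrite integral_gauss.
- by move=> x; rewrite ger0_norm ?gauss_ge0// mul1r gauss_le_cc.
Qed.

(** Half of the exponent is split off exactly. The split factor is then spent on polynomial factors
    and on differences, while a Gaussian at time [2 t] survives. *)
Lemma gauss_double t z : 0 < t ->
  gauss t z = cG * expR (- (sqnorm z / (8 * t))) * gauss (2 * t) z.
Proof.
move=> t0; have p0 : 0 < 4 * pi * t by rewrite !mulr_gt0 ?pi_gt0.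
rewrite /gauss (_ : 4 * pi * (2 * t) = 2 * (4 * pi * t)); last by ring.
rewrite (powRM _ (ler0n _ 2) (ltW p0)) (powRN 2) -/cG.
rewrite (_ : - sqnorm z / (4 * t) = - (sqnorm z / (8 * t)) + - sqnorm z / (4 * (2 * t))); last first.
  by field; rewrite gt_eqF.
rewrite expRD; have := cG_ge1; move: cG => c c1; field.
by rewrite gt_eqF//; apply: lt_le_trans c1.
Qed.

Lemma gauss_le_double t z : 0 < t -> gauss t z <= cG * gauss (2 * t) z.
Proof.
move=> t0; rewrite gauss_double// ler_wpM2r ?gauss_ge0//.
rewrite -[leRHS]mulr1 ler_wpM2l//; first by apply: le_trans cG_ge1.
by rewrite -expR0 ler_expR oppr_le0 divr_ge0 ?sqnorm_ge0// mulr_ge0// ltW.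
Qed.

Lemma nrm_gauss_le t z : 0 < t ->
  nrm z * gauss t z <= 2 * Num.sqrt t * cG * gauss (2 * t) z.
Proof.
move=> t0; rewrite gauss_double// [leLHS]mulrA ler_wpM2r ?gauss_ge0//.
have s0 : 0 < Num.sqrt t by rewrite sqrtr_gt0.
have := mul_expR_le (nrm z / Num.sqrt t).
rewrite expr_div_n nrm_sqr sqr_sqrtr ?(ltW t0)//.
rewrite (_ : sqnorm z / t / 8 = sqnorm z / (8 * t)); last by field; rewrite gt_eqF.
rewrite mulrAC ler_pdivrMr// => h.
have c0 := le_trans ler01 cG_ge1.
by rewrite mulrCA (mulrC cG) ler_wpM2r.
Qed.

Lemma sqrt_powRV t : 0 < t -> (Num.sqrt t)^-1 = t `^ (- (1 / 2)).
Proof. by move=> t0; rewrite powRN mul1r powR12_sqrt// ltW. Qed.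

Lemma Dk_le a t z : 0 < t -> `|Dk a t z| <= nrm a * cG * t `^ (- (1 / 2)) * gauss (2 * t) z.
Proof.
move=> t0; rewrite /Dk normrM normrN normrM (ger0_norm (gauss_ge0 _ _)).
have i0 : 0 < (2 * t)^-1 by rewrite invr_gt0 mulr_gt0.
rewrite (gtr0_norm i0); have s0 : 0 < Num.sqrt t by rewrite sqrtr_gt0.
apply: (@le_trans _ _ (nrm a / (2 * t) * (nrm z * gauss t z))).
  rewrite [leRHS]mulrA ler_wpM2r ?gauss_ge0// mulrAC ler_wpM2r ?(ltW i0)//.
  exact: dot_le.
rewrite -sqrt_powRV//.
apply: (@le_trans _ _ (nrm a / (2 * t) * (2 * Num.sqrt t * cG * gauss (2 * t) z))).
  by apply: ler_wpM2l; [rewrite mulr_ge0 ?nrm_ge0// ltW|exact: nrm_gauss_le].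
have tE : t = Num.sqrt t ^+ 2 by rewrite sqr_sqrtr// ltW.
rewrite {1}tE; move: (Num.sqrt t) s0 => s s0; rewrite le_eqVlt; apply/orP; left; apply/eqP.
by field; rewrite gt_eqF.
Qed.

(** The kernel is radial: in terms of [r z = |z| / (2 sqrt t)] this is [expR_sqr_diff] with the
    reverse triangle inequality. The order of the norms decides which point keeps the remaining
    Gaussian. *)
Lemma gauss_diff t z w : 0 < t -> nrm z <= nrm w ->
  `|gauss t w - gauss t z| <= 2 * cG * (nrm (vsub w z) / Num.sqrt t) * gauss (2 * t) z.
Proof.
move=> t0 zw; have s0 : 0 < Num.sqrt t by rewrite sqrtr_gt0.
have tE : Num.sqrt t ^+ 2 = t by rewrite sqr_sqrtr// ltW.
pose r z := nrm z / (2 * Num.sqrt t).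
have rE v : expR (- sqnorm v / (4 * t)) = expR (- (r v) ^+ 2).
  congr expR; rewrite /r expr_div_n nrm_sqr exprMn tE; field; by rewrite gt_eqF.
have rz : r z <= r w by rewrite ler_wpM2r// invr_ge0 mulr_ge0// ltW.
have r0 : 0 <= r z by rewrite divr_ge0 ?nrm_ge0// mulr_ge0// ltW.
have := expR_sqr_diff r0 rz.
have -> : gauss (2 * t) z = gauss t z / (cG * expR (- (sqnorm z / (8 * t)))).
  rewrite [in RHS](gauss_double z t0) mulrAC mulfV ?mul1r// mulf_neq0 ?gt_eqF ?expR_gt0//.
  exact: lt_le_trans cG_ge1.
rewrite distrC /gauss !rE -mulrBr => h.
rewrite ger0_norm; last first.
  by rewrite mulr_ge0 ?powR_ge0// subr_ge0 ler_expR lerN2 lerXn2r ?nnegrE// (le_trans r0).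
have -> : expR (- (sqnorm z / (8 * t))) = expR (- (r z ^+ 2 / 2)).
  congr expR; rewrite /r expr_div_n nrm_sqr exprMn tE; field; by rewrite gt_eqF.
have -> : expR (- r z ^+ 2) = expR (- (r z ^+ 2 / 2)) * expR (- (r z ^+ 2 / 2)).
  by rewrite -expRD; congr expR; field.
rewrite [leRHS](_ : _ = (4 * pi * t) `^ (- (n%:R / 2)) *
  (4 * (nrm (vsub w z) / (2 * Num.sqrt t)) * expR (- (r z ^+ 2 / 2)))); last first.
  have := cG_ge1; move: cG => c c1.
  have := expR_gt0 (- (r z ^+ 2 / 2)); move: (expR _) => E E0.
  by field; rewrite !gt_eqF//; apply: lt_le_trans c1.
apply: ler_wpM2l; first exact: powR_ge0.
rewrite -expRD in h *; have -> : - (r z ^+ 2 / 2) - r z ^+ 2 / 2 = - r z ^+ 2 by field.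
apply: le_trans h _; apply: ler_wpM2r; first exact: expR_ge0.
apply: ler_wpM2l => //; rewrite /r -mulrBl ler_wpM2r ?invr_ge0 ?mulr_ge0 ?(ltW s0)//.
exact: nrm_sub_le.
Qed.

(** Product rule for differences. The term with [gauss t w - gauss t z] leaves a factor [|z|], whose
    absorption doubles the time once more; hence the Gaussians at [4 t]. *)
Lemma Dk_diff a t z w : 0 < t -> nrm z <= nrm w ->
  `|Dk a t w - Dk a t z| <=
  3 * nrm a * cG ^+ 2 * (nrm (vsub w z) / t) * (gauss (4 * t) w + gauss (4 * t) z).
Proof.
move=> t0 zw; have s0 : 0 < Num.sqrt t by rewrite sqrtr_gt0.
have t20 : 0 < 2 * t by rewrite mulr_gt0.
have -> : Dk a t w - Dk a t z =
    - (2 * t)^-1 * (dot a (vsub w z) * gauss t w + dot a z * (gauss t w - gauss t z)).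
  by rewrite dotBr /Dk; ring.
have c0 := lt_le_trans ltr01 cG_ge1; have a0 := nrm_ge0 a; have d0 := nrm_ge0 (vsub w z).
have i0 : 0 < (2 * t)^-1 by rewrite invr_gt0.
rewrite normrM normrN (gtr0_norm i0).
have g4 (v : n.-tuple R) : gauss t v <= cG ^+ 2 * gauss (4 * t) v.
  apply: le_trans (gauss_le_double v t0) _; rewrite expr2 -mulrA ler_wpM2l ?(ltW c0)//.
  by have := gauss_le_double v t20; rewrite mulrA -natrM.
have h1 : `|dot a (vsub w z) * gauss t w| <= nrm a * nrm (vsub w z) * (cG ^+ 2 * gauss (4 * t) w).
  by rewrite normrM (ger0_norm (gauss_ge0 _ _)); apply: ler_pM; rewrite ?gauss_ge0 ?dot_le.
have hz : nrm z * gauss (2 * t) z <= 3 * Num.sqrt t * cG * gauss (4 * t) z.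
  have := nrm_gauss_le z t20; rewrite mulrA -natrM => h; apply: le_trans h _.
  rewrite ler_wpM2r ?gauss_ge0// ler_wpM2r ?(ltW c0)// sqrtrM// mulrA ler_wpM2r ?(ltW s0)//.
  have := @sqr_sqrtr R 2 (ler0n _ _); have := sqrtr_ge0 (2 : R).
  by move: (Num.sqrt _) => q; nra.
have h2 : `|dot a z * (gauss t w - gauss t z)| <=
    nrm a * nrm (vsub w z) * (6 * cG ^+ 2 * gauss (4 * t) z).
  rewrite normrM; apply: (@le_trans _ _ ((nrm a * nrm z) *
      (2 * cG * (nrm (vsub w z) / Num.sqrt t) * gauss (2 * t) z))).
    by apply: ler_pM => //; [exact: dot_le|exact: gauss_diff].
  rewrite [leLHS](_ : _ = nrm a * nrm (vsub w z) * (2 * cG / Num.sqrt t) * (nrm z * gauss (2 * t) z)); last by ring.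
  apply: (@le_trans _ _ (nrm a * nrm (vsub w z) * (2 * cG / Num.sqrt t) *
      (3 * Num.sqrt t * cG * gauss (4 * t) z))).
    by apply: ler_wpM2l => //; rewrite !mulr_ge0// ?invr_ge0 ?(ltW s0) ?(ltW c0).
  rewrite le_eqVlt; apply/orP; left; apply/eqP.
  by field; rewrite gt_eqF.
apply: (@le_trans _ _ ((2 * t)^-1 * (nrm a * nrm (vsub w z) * (cG ^+ 2 * gauss (4 * t) w) +
    nrm a * nrm (vsub w z) * (6 * cG ^+ 2 * gauss (4 * t) z)))).
  by apply: ler_wpM2l; [exact: ltW|apply: le_trans (ler_normD _ _) _; exact: lerD].
rewrite [leRHS](_ : _ = (2 * t)^-1 * (6 * (nrm a * nrm (vsub w z) * cG ^+ 2) *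
  (gauss (4 * t) w + gauss (4 * t) z))); last by field; rewrite gt_eqF.
apply: ler_wpM2l; first exact: ltW.
have P0 : 0 <= nrm a * nrm (vsub w z) * cG ^+ 2 by rewrite !mulr_ge0 ?(ltW c0).
have := gauss_ge0 (4 * t) w; have := gauss_ge0 (4 * t) z; nra.
Qed.

End HeatKernel.

Arguments cc {R} n t.
Arguments cG {R} n.

(** * Norms and moments of kernels; the semigroup law *)

Section KernelBounds.
Context {R : realType} {n : nat}.
Implicit Types (x y z w a : n.-tuple R) (t s r K e m th : R) (g : n.-tuple R -> R) (k : R -> n.-tuple R -> R).

(* A kernel of size t^-e in L^1 (and t^(-e-n/2) in the supremum norm) that is Lipschitz at scale sqrt t in both norms. *)
Definition kb K e (k : R -> n.-tuple R -> R) := forall t, 0 < t ->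
  hb (cc n t) (K * t `^ (- e)) (k t) /\
  forall y, hb (cc n t) (K * t `^ (- e) * Num.min 1 (nrm y * t `^ (- (1 / 2))))
    (fun z => k t (vsub z y) - k t z).

(** Displacements beyond [sqrt t] are handled by the triangle inequality, smaller ones by the
    pointwise bound. That bound presupposes an order of the two norms, and either order yields the
    same sum of Gaussians, of mass two. *)
Lemma kb_gauss_bound K e m (k : R -> n.-tuple R -> R) : 0 <= K -> 1 <= m ->
  (forall t, measurable_fun setT (k t)) ->
  (forall t z, 0 < t -> `|k t z| <= K * t `^ (- e) * gauss (m * t) z) ->
  (forall t z w, 0 < t -> nrm z <= nrm w -> `|k t w - k t z| <=
    K * t `^ (- e) * (nrm (vsub w z) * t `^ (- (1 / 2))) * (gauss (m * t) w + gauss (m * t) z)) ->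
  kb (2 * K) e k.
Proof.
move=> K0 m1 mk bk dk t t0.
have mt0 : 0 < m * t by rewrite mulr_gt0// (lt_le_trans _ m1).
have ccm : cc n (m * t) <= cc n t by apply: (@cc_anti R n t) => //; rewrite ler_peMl// ltW.
have T0 : 0 <= K * t `^ (- e) by rewrite mulr_ge0// powR_ge0.
have hg := @hb_gauss R n _ mt0.
have hk : hb (cc n t) (K * t `^ (- e)) (k t).
  have := hb_domZ (K := K * t `^ (- e)) hg (mk t) (cc_ge0 _).
  rewrite (ger0_norm T0) mulr1 => h; apply: (hb_dom (h _) (mk t) _ _ (cc_ge0 _) ccm) => // z.
  by rewrite (ger0_norm (gauss_ge0 _ _)) bk.
split; first by apply: (hb_le hk (cc_ge0 _)); rewrite -mulrA ler_peMl// ler1n.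
move=> y; set r := nrm y * _; have r0 : 0 <= r by rewrite mulr_ge0 ?nrm_ge0 ?powR_ge0.
have mky : measurable_fun setT (fun z => k t (vsub z y) - k t z).
  by apply: measurable_funB => //; apply: measurableT_comp => //; exact: measurable_vsub2.
have [r1|r1] := leP 1 r.
  rewrite mulr1; have := hbB (hb_shift y hk) hk; congr hb; ring.
have hs := hbD (hb_shift y hg) hg.
have := hb_domZ (K := K * t `^ (- e) * r) hs mky (cc_ge0 _).
rewrite (ger0_norm (mulr_ge0 T0 r0)) => h.
apply: (hb_dom (h _) mky _ _ (cc_ge0 _) ccm) => //; last first.
  by rewrite le_eqVlt; apply/orP; left; apply/eqP; ring.
move=> z; rewrite [X in _ <= _ * X]ger0_norm ?addr_ge0 ?gauss_ge0//.
have [zy|/ltW zy] := leP (nrm z) (nrm (vsub z y)).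
  by have := dk t _ _ t0 zy; rewrite vsub_shift nrm_vopp.
have := dk t _ _ t0 zy; rewrite distrC nrm_vsubC vsub_shift nrm_vopp.
by rewrite (addrC (gauss _ z)).
Qed.

Lemma gauss_kb : kb (4 * cG n) 0 (@gauss R n).
Proof.
have c1 := @cG_ge1 R n.
rewrite (_ : 4 * _ = 2 * (2 * cG n)); last by ring.
apply: (@kb_gauss_bound _ _ 2); rewrite ?ler1n//.
- by rewrite mulr_ge0// (le_trans ler01).
- exact: measurable_gauss1.
- move=> t z t0; rewrite oppr0 powRr0 mulr1 ger0_norm ?gauss_ge0//.
  apply: le_trans (gauss_le_double z t0) _; have := gauss_ge0 (2 * t) z; nra.
- move=> t z w t0 zw; apply: le_trans (gauss_diff t0 zw) _.
  rewrite oppr0 powRr0 mulr1 -sqrt_powRV// ler_wpM2l ?lerDr ?gauss_ge0//.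
  by rewrite !mulr_ge0 ?nrm_ge0 ?invr_ge0 ?sqrtr_ge0// (le_trans ler01).
Qed.

Lemma Dk_kb a : kb (6 * nrm a * cG n ^+ 2) (1 / 2) (Dk a).
Proof.
have c1 := @cG_ge1 R n; have a0 := nrm_ge0 a.
rewrite (_ : 6 * _ * _ = 2 * (3 * nrm a * cG n ^+ 2)); last by ring.
apply: (@kb_gauss_bound _ _ 4); rewrite ?ler1n//.
- by rewrite !mulr_ge0// (le_trans ler01).
- exact: measurable_Dk1.
- move=> t z t0; apply: le_trans (Dk_le a z t0) _.
  have := @gauss_le_double R n (2 * t) z; rewrite mulr_gt0// mulrA -natrM => /(_ isT) h.
  have p0 := powR_ge0 t (- (1 / 2)); have g0 := gauss_ge0 (4 * t) z.
  apply: (@le_trans _ _ (nrm a * cG n * t `^ (- (1 / 2)) * (cG n * gauss (4 * t) z))).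
    by apply: ler_wpM2l; [rewrite !mulr_ge0// (le_trans ler01)|exact: h].
  rewrite [leLHS](_ : _ = nrm a * t `^ (- (1 / 2)) * gauss (4 * t) z * cG n ^+ 2); last by ring.
  rewrite [leRHS](_ : _ = 3 * (nrm a * t `^ (- (1 / 2)) * gauss (4 * t) z * cG n ^+ 2)); last by ring.
  have P0 : 0 <= nrm a * t `^ (- (1 / 2)) * gauss (4 * t) z * cG n ^+ 2.
    have c0 : 0 <= cG n := le_trans ler01 c1.
    exact: (mulr_ge0 (mulr_ge0 (mulr_ge0 a0 p0) g0) (exprn_ge0 2 c0)).
  lra.
- move=> t z w t0 zw; apply: le_trans (Dk_diff a t0 zw) _.
  rewrite le_eqVlt; apply/orP; left; apply/eqP; rewrite -sqrt_powRV//.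
  have tE : t = Num.sqrt t ^+ 2 by rewrite sqr_sqrtr// ltW.
  have s0 : 0 < Num.sqrt t by rewrite sqrtr_gt0.
  rewrite {1}tE; move: (gauss _ w + _) (Num.sqrt t) s0 => G s s0; field.
  by rewrite gt_eqF.
Qed.

Lemma min1_le_powR r th : 0 <= r -> 0 <= th -> th <= 1 -> Num.min 1 r <= r `^ th.
Proof.
move=> r0 h0 h1; have [r1|r1] := leP 1 r.
  by have := powR_exp_mono r1 h0; rewrite powRr0.
have [->|rn0] := eqVneq r 0; first exact: powR_ge0.
have := @powR_exp_anti R r th 1; rewrite powRr1//; apply => //; last exact: ltW.
by rewrite lt_neqAle eq_sym rn0.
Qed.

(** As [min 1 r <= r^th], a Lipschitz kernel has every Hoelder exponent [th <= 1] at the cost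
    [t^(-th/2)]. For [th < 1] the time singularity of [Dk] stays integrable. *)
Lemma kb_holder K e k th t y : 0 <= K -> kb K e k -> 0 <= th -> th <= 1 -> 0 < t ->
  hb (cc n t) (K * t `^ (- (e + th / 2)) * nrm y `^ th) (fun z => k t (vsub z y) - k t z).
Proof.
move=> K0 hk h0 h1 t0; have [_ /(_ y) h] := hk t t0; apply: (hb_le h (cc_ge0 _)).
have r0 : 0 <= nrm y * t `^ (- (1 / 2)) by rewrite mulr_ge0 ?nrm_ge0 ?powR_ge0.
rewrite opprD powR_add// -!mulrA; apply: ler_wpM2l => //; apply: ler_wpM2l; first exact: powR_ge0.
apply: le_trans (min1_le_powR r0 h0 h1) _.
rewrite powRM ?nrm_ge0 ?powR_ge0// -powRrM mulrC.
by rewrite (_ : - (1 / 2) * th = - (th / 2)); last by ring.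
Qed.

Lemma nrm_powR_gauss_le th t z : 0 <= th -> th <= 1 -> 0 < t ->
  nrm z `^ th * gauss t z <= 3 * cG n * t `^ (th / 2) * gauss (2 * t) z.
Proof.
move=> h0 h1 t0; have s0 : 0 < Num.sqrt t by rewrite sqrtr_gt0.
pose r := nrm z / Num.sqrt t; have r0 : 0 <= r by rewrite divr_ge0 ?nrm_ge0// ltW.
have -> : nrm z = Num.sqrt t * r by rewrite /r mulrC divfK// gt_eqF.
rewrite powRM// ?(ltW s0)// -powR12_sqrt ?(ltW t0)// -powRrM (mulrC 2^-1).
have rth : r `^ th <= 1 + r.
  have [r1|/ltW r1] := leP 1 r; first by have := powR_exp_mono r1 h1; rewrite powRr1//; lra.
  by have := powR_mono h0 r0 r1; rewrite powR1; lra.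
have P0 := powR_ge0 t (th / 2).
have c1 := @cG_ge1 R n.
rewrite -mulrA (mulrC (3 * cG n)) -[leRHS]mulrA ler_wpM2l//.
apply: (@le_trans _ _ ((1 + r) * gauss t z)); first by rewrite ler_wpM2r ?gauss_ge0.
rewrite mulrDl mul1r; have h2 : r * gauss t z <= 2 * cG n * gauss (2 * t) z.
  rewrite /r mulrAC ler_pdivrMr//; apply: le_trans (nrm_gauss_le z t0) _.
  by rewrite le_eqVlt; apply/orP; left; apply/eqP; ring.
have := gauss_le_double z t0; lra.
Qed.

Lemma nrm_powR_Dk_le a th t z : 0 <= th -> th <= 1 -> 0 < t ->
  nrm z `^ th * `|Dk a t z| <= 3 * nrm a * cG n ^+ 2 * 2 `^ (th / 2) * t `^ (- (1 / 2) + th / 2) * gauss (4 * t) z.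
Proof.
move=> h0 h1 t0.
have t20 : 0 < 2 * t by rewrite mulr_gt0.
have c1 := @cG_ge1 R n; have a0 := nrm_ge0 a.
have P0 := powR_ge0 t (- (1 / 2)).
apply: (@le_trans _ _ (nrm a * cG n * t `^ (- (1 / 2)) * (nrm z `^ th * gauss (2 * t) z))).
  by rewrite mulrCA ler_wpM2l ?powR_ge0// Dk_le.
have := nrm_powR_gauss_le z h0 h1 t20; rewrite mulrA -natrM => h.
apply: (@le_trans _ _ (nrm a * cG n * t `^ (- (1 / 2)) * (3 * cG n * (2 * t) `^ (th / 2) * gauss (4 * t) z))).
  by rewrite ler_wpM2l// !mulr_ge0// (le_trans ler01).
rewrite powRM// ?(ltW t0)// powR_add// le_eqVlt; apply/orP; left; apply/eqP; ring.
Qed.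

Lemma Rintegral_gauss t : 0 < t -> \int[mu n]_z gauss t z = 1.
Proof. by move=> t0; rewrite /Rintegral integral_gauss. Qed.

Lemma Rintegral_odd g : measurable_fun setT g -> (forall z, g (vopp z) = - g z) ->
  (mu n).-integrable setT (EFin \o g) -> \int[mu n]_z g z = 0.
Proof.
move=> mg og ig; have := eq_Rintegral_vaff (vzero n) (or_intror erefl) mg.
rewrite (_ : Rintegral _ _ _ = - \int[mu n]_y g y); first lra.
rewrite -[RHS]mulN1r -RintegralZl//; apply: eq_Rintegral => y _.
by rewrite -voppE og mulN1r.
Qed.

Lemma hb_Dk a t : 0 < t -> hb (cc n t) (6 * nrm a * cG n ^+ 2 * t `^ (- (1 / 2))) (Dk a t).
Proof. by move=> t0; have [] := Dk_kb a t0. Qed.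

Lemma Rintegral_Dk a t : 0 < t -> \int[mu n]_z Dk a t z = 0.
Proof.
move=> t0; apply: Rintegral_odd; [exact: measurable_Dk1|exact: Dk_vopp|].
exact: l1_integrable (hb_l1 (hb_Dk a t0)).
Qed.

Definition vscale (l : R) x : n.-tuple R := vaff l (vzero n) x.

Lemma dot_vscale a l x : dot a (vscale l x) = l * dot a x.
Proof. by rewrite /dot mulr_sumr; apply: eq_bigr => i _; rewrite !tnth_mktuple; ring. Qed.

Lemma sqnorm_vscale l x : sqnorm (vscale l x) = l ^+ 2 * sqnorm x.
Proof. by rewrite /sqnorm mulr_sumr; apply: eq_bigr => i _; rewrite !tnth_mktuple; ring. Qed.

(** Completing the square in [y]: the product is a Gaussian about [t/(s+t) x] at the time
    [s t / (s+t)]. The semigroup law is the integral of this identity. *)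
Lemma gauss_mul s t x y : 0 < s -> 0 < t ->
  gauss s (vsub x y) * gauss t y =
  gauss (s + t) x * gauss (s * t / (s + t)) (vsub y (vscale (t / (s + t)) x)).
Proof.
move=> s0 t0; have st0 : 0 < s + t by rewrite addr_gt0.
have pi0 := @pi_gt0 R.
rewrite /gauss mulrACA [RHS]mulrACA; congr (_ * _).
  rewrite -!powRM ?mulr_ge0 ?divr_ge0 ?invr_ge0 ?(ltW s0) ?(ltW t0) ?(ltW pi0) ?(ltW st0)//.
  by congr (_ `^ _); field; rewrite gt_eqF.
rewrite -!expRD; congr expR; rewrite !sqnormB dot_vscale sqnorm_vscale (dotC x y).
by field; rewrite !gt_eqF.
Qed.

Lemma cnv_gauss_gauss s t : 0 < s -> 0 < t -> cnv (@gauss R n s) (gauss t) = gauss (s + t).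
Proof.
move=> s0 t0; apply/funext => x; rewrite /cnv.
under eq_Rintegral do rewrite gauss_mul//.
have r0 : 0 < s * t / (s + t) by rewrite divr_gt0 ?mulr_gt0 ?addr_gt0.
have hg := hb_shift (vscale (t / (s + t)) x) (@hb_gauss R n _ r0).
rewrite RintegralZl//; last exact: l1_integrable (hb_l1 hg).
by rewrite (Rintegral_shift _ (measurable_gauss1 _)) Rintegral_gauss// mulr1.
Qed.

(** Computed without differentiating under the integral: after completing the square, [a . y] splits
    into a part that is odd about the centre [v], which integrates to zero, and the constant
    [a . v]. *)
Lemma cnv_gauss_Dk a s t : 0 < s -> 0 < t -> cnv (@gauss R n s) (Dk a t) = Dk a (s + t).
Proof.
move=> s0 t0; apply/funext => x; rewrite /cnv.
have st0 : 0 < s + t by rewrite addr_gt0.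
pose r := s * t / (s + t); pose v := vscale (t / (s + t)) x.
have r0 : 0 < r by rewrite divr_gt0 ?mulr_gt0.
have E y : gauss s (vsub x y) * Dk a t y = gauss (s + t) x *
    (r / t * Dk a r (vsub y v) - dot a x / (2 * (s + t)) * gauss r (vsub y v)).
  rewrite {1}/Dk mulrCA gauss_mul// -/r -/v /Dk dotBr /v dot_vscale.
  by rewrite /r; field; rewrite !gt_eqF.
under eq_Rintegral do rewrite E.
have hg := hbZ (dot a x / (2 * (s + t))) (hb_shift v (@hb_gauss R n _ r0)).
have hD := hbZ (r / t) (hb_shift v (hb_Dk a r0)).
rewrite RintegralZl//; last exact: l1_integrable (hb_l1 (hbB hD hg)).
rewrite RintegralB//; [|exact: l1_integrable (hb_l1 hD)|exact: l1_integrable (hb_l1 hg)].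
rewrite RintegralZl//; last exact: l1_integrable (hb_l1 (hb_shift v (hb_Dk a r0))).
rewrite RintegralZl//; last exact: l1_integrable (hb_l1 (hb_shift v (@hb_gauss R n _ r0))).
rewrite (Rintegral_shift _ (measurable_gauss1 _)) Rintegral_gauss//.
rewrite (Rintegral_shift _ (measurable_Dk1 _ _)) Rintegral_Dk//.
by rewrite /Dk; ring.
Qed.

End KernelBounds.

(** * Lipschitz, Hoelder and Taylor bounds for the nonlinearity *)

Section PowerNonlinearity.
Context {R : realType}.
Implicit Types (p x y m : R).

Lemma fnlN p x : fnl p (- x) = - fnl p x.
Proof. by rewrite /fnl normrN mulrN. Qed.

Lemma normr_fnl p x : `|fnl p x| = `|x| `^ (p - 1) * `|x|.
Proof. by rewrite /fnl normrM ger0_norm// powR_ge0. Qed.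

Lemma measurable_fnl p d (T : measurableType d) (f : T -> R) :
  measurable_fun setT f -> measurable_fun setT (fun z => fnl p (f z)).
Proof.
move=> mf; apply: measurable_funM => //.
by apply: (measurableT_comp (@measurable_powR R (p - 1))); exact: measurable_norm.
Qed.

Lemma fnl_pos p x : 1 <= p -> 0 <= x -> fnl p x = x `^ p.
Proof.
move=> p1 x0; rewrite /fnl ger0_norm//; have [->|x1] := eqVneq x 0.
  by rewrite mulr0 powR0// gt_eqF// (lt_le_trans _ p1).
rewrite -{2}(powRr1 x0) -powR_add ?subrK//.
by rewrite lt_neqAle eq_sym x1.
Qed.

(* Read off Young's inequality. *)
Lemma powR_tangent p x y : 1 < p -> 0 <= x -> 0 <= y ->
  x `^ p - y `^ p <= p * x `^ (p - 1) * (x - y).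
Proof.
move=> p1 x0 y0; have p0 : 0 < p := lt_trans ltr01 p1.
have pm0 : 0 < p - 1 by rewrite subr_gt0.
have := @conjugate_powR R (x `^ (p - 1)) y (p / (p - 1)) p.
rewrite powR_ge0 y0 divr_gt0// p0 => /(_ isT isT isT isT) h.
have {h} : x `^ (p - 1) * y <= (x `^ (p - 1)) `^ (p / (p - 1)) / (p / (p - 1)) + y `^ p / p.
  by apply: h; field; rewrite !gt_eqF.
rewrite -powRrM (_ : (p - 1) * (p / (p - 1)) = p); last by field; rewrite gt_eqF.
have xE : x `^ p = x `^ (p - 1) * x by rewrite -fnl_pos ?(ltW p1)// /fnl ger0_norm.
rewrite invf_div => h.
have : p * (x `^ (p - 1) * y) <= (p - 1) * x `^ p + y `^ p.
  have := ler_wpM2l (ltW p0) h; rewrite mulrDr.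
  rewrite (_ : p * (x `^ p * ((p - 1) / p)) = (p - 1) * x `^ p); last by field; rewrite gt_eqF.
  by rewrite (_ : p * (y `^ p / p) = y `^ p)//; field; rewrite gt_eqF.
by rewrite xE; lra.
Qed.

(** For equal signs this is the tangent inequality of the convex power; for opposite signs
    [|x - y| = |x| + |y|] and the two terms are bounded one by one. *)
Lemma fnl_lip p m x y : 1 < p -> `|x| <= m -> `|y| <= m ->
  `|fnl p x - fnl p y| <= p * m `^ (p - 1) * `|x - y|.
Proof.
move=> p1; have pm0 : 0 <= p - 1 by rewrite subr_ge0 ltW.
have p0 : 0 < p := lt_trans ltr01 p1.
wlog x0 : x y / 0 <= x => [H|].
  have [x0|/ltW x0] := leP 0 x; first exact: H.
  move=> hx hy; have := H (- x) (- y); rewrite !fnlN oppr_ge0 !normrN => /(_ x0 hx hy).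
  by rewrite -!opprD !normrN.
have [y0|/ltW y0] := leP 0 y.
  wlog yx : x y x0 y0 / y <= x => [H|].
    have [yx|/ltW xy] := leP y x; first exact: H.
    by move=> hx hy; rewrite distrC (distrC x); exact: H.
  move=> hx hy; rewrite !(fnl_pos (ltW p1))//.
  rewrite !ger0_norm ?subr_ge0//; last exact: powR_mono (ltW p0) _ _.
  apply: le_trans (powR_tangent p1 x0 y0) _; rewrite ler_wpM2r ?subr_ge0//.
  by rewrite ler_wpM2l ?(ltW p0)// powR_mono// (le_trans (ler_norm x)).
move=> hx hy.
have e : `|x - y| = `|x| + `|y| by rewrite (ler0_norm y0) !ger0_norm// subr_ge0 (le_trans y0).
rewrite e; apply: le_trans (ler_normB _ _) _; rewrite !normr_fnl mulrDr.
have H z : `|z| <= m -> `|z| `^ (p - 1) * `|z| <= p * m `^ (p - 1) * `|z|.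
  move=> hz; rewrite ler_wpM2r//; have := powR_mono pm0 (normr_ge0 z) hz.
  have := powR_ge0 m (p - 1); nra.
by apply: lerD; exact: H.
Qed.

(** The inequality [u <= u^th] on [[0, 1]], taken at the complementary fractions [y / x] and
    [(x - y) / x]. *)
Lemma powR_subadd th x y : 0 <= y -> y <= x -> 0 < th -> th <= 1 ->
  x `^ th - y `^ th <= (x - y) `^ th.
Proof.
move=> y0 yx h0 h1; have [x0|x0] := leP x 0.
  have -> : x = 0 by apply/eqP; rewrite eq_le x0 (le_trans y0).
  by rewrite (_ : y = 0) ?subrr ?powR_ge0//; apply/eqP; rewrite eq_le y0 (le_trans yx).
have K u : 0 <= u -> u <= x -> u / x <= (u / x) `^ th.
  move=> u0 ux; have r0 : 0 <= u / x by rewrite divr_ge0// ltW.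
  have r1 : u / x <= 1 by rewrite ler_pdivrMr// mul1r.
  have := min1_le_powR r0 (ltW h0) h1; rewrite min_r//.
have := K y y0 yx; have := K (x - y); rewrite subr_ge0 gerBl => /(_ yx y0).
have xy0 : 0 <= x - y by rewrite subr_ge0.
have xi : 0 <= x^-1 by rewrite invr_ge0 ltW.
rewrite !powRM// => h1' h2'.
have xx : x `^ th * (x^-1) `^ th = 1.
  by rewrite -powRM ?(ltW x0)// mulfV ?powR1// gt_eqF.
have X0 : 0 < x `^ th by rewrite powR_gt0.
have : 1 <= ((x - y) `^ th + y `^ th) * x^-1 `^ th.
  by rewrite mulrDl; apply: le_trans (lerD h1' h2'); rewrite -mulrDl subrK mulfV// gt_eqF.
move=> /(ler_wpM2l (ltW X0)); rewrite mulr1 mulrCA xx mulr1; lra.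
Qed.

(** The power [al] is the convex power [al / th] of the power [th]: the tangent inequality reduces
    to exponent [th], where subadditivity concludes. *)
Lemma powR_holder al th m x y : 0 < th -> th <= 1 -> th <= al ->
  `|x| <= m -> `|y| <= m ->
  `| `|x| `^ al - `|y| `^ al| <= al / th * m `^ (al - th) * `|x - y| `^ th.
Proof.
move=> h0 h1 hal; wlog yx : x y / `|y| <= `|x| => [H|].
  have [yx|/ltW xy] := leP `|y| `|x|; first exact: H.
  by move=> hx hy; rewrite distrC (distrC x); exact: H.
move=> hx hy; have al0 : 0 < al := lt_le_trans h0 hal.
have nx := normr_ge0 x; have ny := normr_ge0 y.
have XY : `|y| `^ th <= `|x| `^ th by apply: powR_mono => //; exact: ltW.
rewrite ger0_norm; last by rewrite subr_ge0; apply: powR_mono => //; exact: ltW.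
have r1 : 1 <= al / th by rewrite ler_pdivlMr// mul1r.
have S : `|x| `^ th - `|y| `^ th <= `|x - y| `^ th.
  apply: le_trans (powR_subadd ny yx h0 h1) _; apply: powR_mono; first exact: ltW.
    by rewrite subr_ge0.
  exact: lerB_dist.
have D0 : 0 <= `|x| `^ th - `|y| `^ th by rewrite subr_ge0.
have [r1'|rn] := eqVneq (al / th) 1.
  rewrite r1' mul1r; have -> : al = th by rewrite -[LHS](@divfK _ th) ?r1' ?mul1r// gt_eqF.
  have [m0|m0] := eqVneq m 0; last by rewrite subrr powRr0 mul1r.
  by rewrite subrr powRr0 mul1r.
have rl : 1 < al / th by rewrite lt_neqAle eq_sym rn.
have := powR_tangent rl (powR_ge0 `|x| th) (powR_ge0 `|y| th).
rewrite -!powRrM (_ : th * (al / th) = al); last by field; rewrite gt_eqF.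
rewrite (_ : th * (al / th - 1) = al - th); last by field; rewrite gt_eqF.
move=> h; apply: le_trans h _; apply: ler_pM => //.
  by rewrite mulr_ge0 ?powR_ge0// (le_trans ler01).
rewrite ler_wpM2l ?(le_trans ler01)// powR_mono// subr_ge0//.
Qed.

(* Across a sign change every single term is already of the size of the right-hand side. *)
Lemma fnl_taylor p th m x y : 1 < p -> 0 < th -> th <= 1 -> th <= p - 1 ->
  `|x| <= m -> `|y| <= m ->
  `|fnl p y - fnl p x - p * `|x| `^ (p - 1) * (y - x)| <=
  3 * p * ((p - 1) / th + 1) * m `^ (p - 1 - th) * `|y - x| `^ (1 + th).
Proof.
move=> p1 h0 h1 hp; have p0 : 0 < p := lt_trans ltr01 p1.
have al0 : 0 < p - 1 by rewrite subr_gt0.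
wlog x0 : x y / 0 <= x => [H|].
  have [x0|/ltW x0] := leP 0 x; first exact: H.
  move=> hx hy; have := H (- x) (- y); rewrite !fnlN oppr_ge0 !normrN => /(_ x0 hx hy).
  rewrite (_ : - fnl p y - _ - _ = - (fnl p y - fnl p x - p * `|x| `^ (p - 1) * (y - x))); last by ring.
  by rewrite (_ : - y - - x = - (y - x)) ?normrN//; ring.
move=> hx hy; set C := (p - 1) / th; have C0 : 0 <= C by rewrite divr_ge0// ltW.
have dE : `|y - x| `^ (1 + th) = `|y - x| `^ th * `|y - x|.
  have [->|d0] := eqVneq `|y - x| 0; last first.
    by rewrite (addrC 1) powR_add ?powRr1// lt_neqAle eq_sym d0 normr_ge0.
  by rewrite mulr0 powR0// gt_eqF// addr_gt0.
have P0 := powR_ge0 m (p - 1 - th); have Q0 := powR_ge0 `|y - x| th.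
have D0 := normr_ge0 (y - x).
have PQ0 : 0 <= m `^ (p - 1 - th) * `|y - x| `^ th * `|y - x| by rewrite !mulr_ge0.
rewrite dE; have [y0|y0] := leP 0 y.
  rewrite !(fnl_pos (ltW p1))// (ger0_norm x0).
  have t1 := powR_tangent p1 y0 x0; have t2 := powR_tangent p1 x0 y0.
  have hh := powR_holder h0 h1 hp hy hx; rewrite (ger0_norm x0) (ger0_norm y0) -/C in hh.
  have : `|y `^ p - x `^ p - p * x `^ (p - 1) * (y - x)| <=
      p * (y `^ (p - 1) - x `^ (p - 1)) * (y - x).
    by rewrite ger0_norm; lra.
  move=> h; apply: le_trans h _; apply: le_trans (ler_norm _) _; rewrite !normrM (gtr0_norm p0).
  apply: (@le_trans _ _ (p * (C * m `^ (p - 1 - th) * `|y - x| `^ th) * `|y - x|)).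
    by rewrite ler_wpM2r// ler_wpM2l// ltW.
  rewrite [leLHS](_ : _ = p * C * (m `^ (p - 1 - th) * `|y - x| `^ th * `|y - x|)); last by ring.
  rewrite [leRHS](_ : _ = 3 * p * (C + 1) * (m `^ (p - 1 - th) * `|y - x| `^ th * `|y - x|)); last by ring.
  by rewrite ler_wpM2r//; nra.
have e : `|y - x| = x - y by rewrite ltr0_norm ?opprB// subr_lt0 (lt_le_trans y0).
have al0' : 0 <= p - 1 := ltW al0.
have K z : 0 <= z -> z <= m -> z <= x - y ->
    z `^ (p - 1) <= m `^ (p - 1 - th) * `|y - x| `^ th.
  move=> z0 zm zd; have [->|zn] := eqVneq z 0; first by rewrite powR0 ?mulr_ge0// gt_eqF.
  have zp : 0 < z by rewrite lt_neqAle eq_sym zn.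
  have -> : z `^ (p - 1) = z `^ (p - 1 - th) * z `^ th by rewrite -powR_add// subrK.
  apply: ler_pM; rewrite ?powR_ge0//.
    by apply: powR_mono => //; rewrite subr_ge0.
  by rewrite e; apply: powR_mono => //; exact: ltW.
have kx : x `^ (p - 1) <= m `^ (p - 1 - th) * `|y - x| `^ th.
  by apply: K => //; [exact: le_trans (ler_norm x) hx|rewrite lerBrDr gerDl ltW].
have ky : `|y| `^ (p - 1) <= m `^ (p - 1 - th) * `|y - x| `^ th.
  by apply: K => //; rewrite (ltr0_norm y0) lerDr.
rewrite [leRHS](_ : _ = 3 * p * (C + 1) * (m `^ (p - 1 - th) * `|y - x| `^ th * `|y - x|)); last by ring.
apply: le_trans (ler_normB _ _) _; apply: le_trans (lerD (ler_normB _ _) (lexx _)) _.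
rewrite !normr_fnl !normrM (gtr0_norm p0) (ger0_norm (powR_ge0 _ _)) (ger0_norm x0).
move: kx ky PQ0; rewrite (ltr0_norm y0) e.
move: (m `^ _ * _) (x `^ _) (powR_ge0 x (p - 1)) ((- y) `^ _) (powR_ge0 (- y) (p - 1)) => A X X0 Y Y0 XA YA A0.
have XA0 : 0 <= A by lra.
apply: (@le_trans _ _ (A * (x - y) + A * (x - y) + p * A * (x - y))).
  by apply: lerD; [apply: lerD; apply: ler_pM => //; lra|rewrite -!mulrA ler_wpM2l ?(ltW p0)// ler_wpM2r//; lra].
have B0 : 0 <= A * (x - y) by apply: mulr_ge0 => //; lra.
rewrite [leLHS](_ : _ = (2 + p) * (A * (x - y))); last by ring.
rewrite ler_wpM2r//; nra.
Qed.

End PowerNonlinearity.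

(** * Power weights integrated in time *)

Section TimeIntegrals.
Context {R : realType}.
Notation leb := (@lebesgue_measure R).
Implicit Types (a b e t s : R).

Lemma continuous_powR e s : 0 < s -> {for s, continuous (fun r : R => r `^ e)}.
Proof.
move=> s0; have [d _] := @is_derive1_powR R e s s0.
by apply: differentiable_continuous; exact/derivable1_diffP.
Qed.

Lemma integral_powR_cc a b e : 0 < a -> a < b -> e != 0 ->
  (\int[leb]_(s in `[a, b]) (s `^ (e - 1))%:E = ((b `^ e - a `^ e) / e)%:E)%E.
Proof.
move=> a0 ab e0; have b0 := lt_trans a0 ab.
have D s : 0 < s -> is_derive s 1 (fun r : R => e^-1 * r `^ e) (s `^ (e - 1)).
  move=> s0; have := @is_derive1_powR R e s s0 => h.
  have -> : (fun r : R => e^-1 * r `^ e) = e^-1 \*: (@powR R ^~ e) by [].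
  by apply: is_derive_eq; rewrite /GRing.scale /= mulrA mulVf// mul1r.
have C s : 0 < s -> {for s, continuous (fun r : R => e^-1 * r `^ e)}.
  by move=> s0; have [d _] := D s s0; apply: differentiable_continuous; exact/derivable1_diffP.
rewrite (@continuous_FTC2 R (fun s => s `^ (e - 1)) (fun r => e^-1 * r `^ e) a b ab).
- by rewrite -EFinB -mulrBr mulrC.
- apply: continuous_in_subspaceT => s; rewrite inE/= in_itv/= => /andP[as_ _].
  by apply: continuous_powR; exact: lt_le_trans as_.
- split.
  + by move=> s; rewrite in_itv/= => /andP[as_ _]; have [] := D s (lt_trans a0 as_).
  + by apply: cvg_at_right_filter; exact: C.
  + by apply: cvg_at_left_filter; exact: C.
- move=> s; rewrite in_itv/= => /andP[as_ _]; rewrite derive1E.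
  by have [_] := D s (lt_trans a0 as_).
Qed.

Lemma measurable_if_itv d (T : measurableType d) (u v f : T -> R) :
  measurable_fun setT u -> measurable_fun setT v -> measurable_fun setT f ->
  measurable_fun setT (fun z => if 0 < u z < v z then f z else 0).
Proof.
move=> mu mv mf; apply: measurable_fun_ifT => //.
apply: measurable_and => /=; exact: measurable_fun_ltr.
Qed.

Lemma measurable_if_itv1 t (f : R -> R) : measurable_fun setT f ->
  measurable_fun setT (fun s => if 0 < s < t then f s else 0).
Proof. by move=> mf; apply: measurable_if_itv => //; exact: measurable_id. Qed.

(** The fundamental theorem of calculus needs a closed interval away from the singularity at zero;
    monotone convergence exhausts []0, t]]. *)
Lemma integral_powR_le t b : 0 < t -> b < 1 ->
  (\int[leb]_s (if 0 < s < t then s `^ (- b) else 0)%:E <= (t `^ (1 - b) / (1 - b))%:E)%E.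
Proof.
move=> t0 b1; have e0 : 0 < 1 - b by rewrite subr_gt0.
(* [k.+2] keeps the interval nondegenerate already for [k = 0]. *)
pose F k := `[t / k.+2%:R, t]%classic.
have Ft k : 0 < t / k.+2%:R by rewrite divr_gt0.
have FF k : (\int[leb]_(s in F k) (s `^ (- b))%:E <= (t `^ (1 - b) / (1 - b))%:E)%E.
  have := @integral_powR_cc (t / k.+2%:R) t (1 - b) (Ft k).
  rewrite (_ : 1 - b - 1 = - b); last by ring.
  rewrite ltr_pdivrMr// ltr_pMr// ltr1n gt_eqF// => /(_ isT isT) ->.
  by rewrite lee_fin ler_wpM2r ?invr_ge0 ?(ltW e0)// gerBl powR_ge0.
have mphi : measurable_fun setT (fun s : R => (s `^ (- b))%:E).
  by apply/measurable_EFinP; exact: measurable_powR.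
have FU : \bigcup_k F k = `]0, t]%classic.
  apply/seteqP; split => s /=.
    by move=> [k _]; rewrite /F /= !in_itv/= => /andP[h ->]; rewrite (lt_le_trans _ h).
  rewrite in_itv/= => /andP[s0 st]; have ts : 0 <= t / s by rewrite divr_ge0// ltW.
  exists (Num.bound (t / s)) => //; rewrite /F /= in_itv/= st andbT ler_pdivrMr// mulrC -ler_pdivrMr//.
  by apply: le_trans (ltW (archi_boundP ts)) _; rewrite ler_nat -addn2 leq_addr.
have := @ge0_nondecreasing_set_cvg_integral _ (measurableTypeR R) R F (fun s : R => (s `^ (- b))%:E) leb.
have h1 : {homo F : n m / (n <= m)%N >-> (n <= m)%O}.
  move=> k m km; rewrite subsetEset => s; rewrite /F /= !in_itv/= => /andP[h ->].
  rewrite andbT; apply: le_trans h; rewrite ler_pM2l// lef_pV2 ?posrE//.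
  by rewrite ler_nat.
move=> /(_ h1); have h2 i : measurable (F i) by exact: measurable_itv.
move=> /(_ h2); have h3 i : measurable_fun (F i) (fun s : R => (s `^ (- b))%:E).
  exact: measurable_funTS.
move=> /(_ h3); have h4 i x : F i x -> (0 <= (x `^ (- b))%:E)%E.
  by rewrite lee_fin powR_ge0.
move=> /(_ h4) cF; rewrite FU in cF.
apply: (@le_trans _ _ (\int[leb]_(s in `]0%R, t]) (s `^ (- b))%:E)%E).
  rewrite [leRHS]integral_mkcond; apply: ge0_le_integral => //.
  - by move=> s _; rewrite lee_fin; case: ifP => // _; rewrite powR_ge0.
  - by apply/measurable_EFinP; apply: measurable_if_itv1; exact: measurable_powR.
  - by apply/(measurable_restrictT _ _).1 => //; exact: measurable_funTS.
  - move=> s _; rewrite patchE; case: ifPn => [/andP[s0 st]|_].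
      by rewrite mem_set//= in_itv/= s0 ltW.
    by case: ifPn => // _; rewrite lee_fin powR_ge0.
rewrite -(cvg_lim _ cF)//.
by apply: lime_le; [apply: cvgP cF|apply: nearW].
Qed.

Lemma integral_powR_tail t (k : R) : 0 < k ->
  (\int[leb]_s (if 1 <= s < t then s `^ (- 1 - k) else 0)%:E <= (k^-1)%:E)%E.
Proof.
move=> k0; have [t1|t1] := leP t 1.
  rewrite integral0_eq ?lee_fin ?invr_ge0 ?(ltW k0)// => s _.
  by case: ifPn => // /andP[s1 st]; have := lt_le_trans (le_lt_trans s1 st) t1; rewrite ltxx.
apply: (@le_trans _ _ (\int[leb]_(s in `[1%R, t]) (s `^ (- k - 1))%:E)%E).
  rewrite [leRHS]integral_mkcond; apply: ge0_le_integral => //.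
  - by move=> s _; rewrite lee_fin; case: ifP => // _; rewrite powR_ge0.
  - apply/measurable_EFinP; apply: measurable_fun_ifT => //.
    by apply: measurable_and => /=; [exact: measurable_fun_ler|exact: measurable_fun_ltr].
  - apply/(measurable_restrictT _ _).1 => //; apply: measurable_funTS.
    by apply/measurable_EFinP; exact: measurable_powR.
  - move=> s _; rewrite patchE; case: ifPn => [/andP[s0 st]|_].
      by rewrite mem_set//= ?in_itv/= ?s0 ?(ltW st)// (addrC (- k)).
    by case: ifPn => // _; rewrite lee_fin powR_ge0.
rewrite integral_powR_cc ?oppr_eq0 ?gt_eqF// lee_fin powR1.
rewrite invrN mulrN -mulNr opprB ler_pdivrMr// mulVf ?gt_eqF//.
by rewrite gerBl powR_ge0.
Qed.

Lemma integral_if_refl t (f : R -> R) : measurable_fun setT f -> (forall s, 0 <= f s) ->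
  (\int[leb]_s (if 0 < s < t then f (t - s) else 0)%:E =
   \int[leb]_s (if 0 < s < t then f s else 0)%:E)%E.
Proof.
move=> mf f0; rewrite -[RHS](@ge0_integral_affine1 R (-1) t (fun s => (if 0 < s < t then f s else 0)%:E)).
- apply: eq_integral => s _; rewrite mulN1r (addrC (- s)) subr_gt0 andbC.
  by rewrite gtrBl.
- by right.
- by apply/measurable_EFinP; exact: measurable_if_itv1.
- by move=> s; rewrite lee_fin; case: ifP.
Qed.

(** An upper bound for the Euler Beta integral, found by cutting at [t/2]: on each half the regular
    factor is at most its value at the midpoint. *)
Definition betaC a b := 2 `^ a / (1 - b) + 2 `^ b / (1 - a).

Lemma measurable_powRs (d : measure_display) (T : measurableType d) (f : T -> R) e :
  measurable_fun setT f -> measurable_fun setT (fun z => f z `^ e).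
Proof. by move=> mf; exact: (measurableT_comp (@measurable_powR R e)). Qed.

Lemma integral_beta_le t a b : 0 < t -> 0 <= a -> a < 1 -> 0 <= b -> b < 1 ->
  (\int[leb]_s (if 0 < s < t then (t - s) `^ (- a) * s `^ (- b) else 0)%:E
    <= (betaC a b * t `^ (1 - a - b))%:E)%E.
Proof.
move=> t0 a0 a1 b0 b1; have t2 : 0 < t / 2 by rewrite divr_gt0.
have E0 c : 0 <= (t / 2) `^ (- c) by exact: powR_ge0.
have mp e : measurable_fun setT (fun s : R => s `^ e) by exact: measurable_powR.
have mr : measurable_fun setT (fun s : R => t - s) by apply: measurable_funB => //; exact: measurable_cst.
apply: (@le_trans _ _ (\int[leb]_s ((t / 2) `^ (- a) * (if 0 < s < t then s `^ (- b) else 0) +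
    (t / 2) `^ (- b) * (if 0 < s < t then (t - s) `^ (- a) else 0))%:E)%E).
  apply: le_integral_EFin.
  - by apply: measurable_if_itv1; apply: measurable_funM => //; exact: measurable_powRs.
  - by apply: measurable_funD; apply: measurable_funM => //; apply: measurable_if_itv1 => //; exact: measurable_powRs.
  - by move=> s; case: ifP => // _; rewrite mulr_ge0 ?powR_ge0.
  - move=> s; case: ifPn => [/andP[s0 st]|_]; last by rewrite !mulr0 addr0.
    have [st2|st2] := leP s (t / 2).
      rewrite -[leLHS]addr0 lerD ?mulr_ge0 ?powR_ge0// ler_wpM2r ?powR_ge0//.
      by apply: powR_anti; rewrite ?oppr_le0//; lra.
    rewrite -[leLHS]add0r lerD ?mulr_ge0 ?powR_ge0// mulrC ler_wpM2r ?powR_ge0//.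
    by apply: powR_anti; rewrite ?oppr_le0 ?(ltW st2).
have p0 e s : 0 <= (if 0 < s < t then s `^ e else 0) by case: ifP => // _; exact: powR_ge0.
have q0 e s : 0 <= (if 0 < s < t then (t - s) `^ e else 0) by case: ifP => // _; exact: powR_ge0.
have m1 e : measurable_fun setT (fun s : R => if 0 < s < t then s `^ e else 0) by exact: measurable_if_itv1.
have m2 e : measurable_fun setT (fun s : R => if 0 < s < t then (t - s) `^ e else 0).
  by apply: measurable_if_itv1; exact: measurable_powRs.
have M1 : measurable_fun setT (fun s : R => (t / 2) `^ (- a) * (if 0 < s < t then s `^ (- b) else 0)).
  by apply: measurable_funM.
have M2 : measurable_fun setT (fun s : R => (t / 2) `^ (- b) * (if 0 < s < t then (t - s) `^ (- a) else 0)).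
  by apply: measurable_funM.
rewrite integralD_EFin; [|exact: M1|exact: M2|by move=> s; exact: mulr_ge0|by move=> s; exact: mulr_ge0].
rewrite !integralZl_EFin//; try exact: m1; try exact: m2.
rewrite (@integral_if_refl t (fun s => s `^ (- a)))//; last by move=> s; exact: powR_ge0.
apply: (@le_trans _ _ (((t / 2) `^ (- a))%:E * (t `^ (1 - b) / (1 - b))%:E +
   ((t / 2) `^ (- b))%:E * (t `^ (1 - a) / (1 - a))%:E)%E).
  by apply: leeD; apply: lee_wpmul2l; rewrite ?lee_fin//; exact: integral_powR_le.
rewrite -!EFinM -EFinD lee_fin le_eqVlt; apply/orP; left; apply/eqP.
have H c : (t / 2) `^ (- c) = t `^ (- c) * 2 `^ c.
  rewrite powRM ?(ltW t0)// -powR_inv1// -powRrM; congr (_ * _ `^ _); ring.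
rewrite /betaC !H (_ : 1 - a - b = - a + (1 - b)); last by ring.
rewrite mulrDl powR_add// {2}(_ : - a + (1 - b) = - b + (1 - a)); last by ring.
by rewrite ?powR_add//; ring.
Qed.

(** Time integrals are taken over the whole line with a cutoff, so that measurability and Fubini
    concern total functions. Passing from [[0, t]] drops the endpoints, among them [s = t], where
    [heat 0] has no meaning. *)
Lemma Rintegral_itv_if t (f : R -> R) : measurable_fun setT (fun s => if 0 < s < t then f s else 0) ->
  \int[leb]_(s in `[0, t]) f s = \int[leb]_s (if 0 < s < t then f s else 0).
Proof.
move=> mf.
have mfo : measurable_fun `]0, t[ f.
  apply: (@eq_measurable_fun _ _ _ _ _ (fun s => if 0 < s < t then f s else 0)).
    by move=> s; rewrite inE/= in_itv/= => ->.
  exact: measurable_funTS.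
have [t0|t0] := leP t 0.
  have [->|tn] := eqVneq t 0.
    rewrite set_itv1 Rintegral_set1 (_ : (fun s => _) = (fun=> 0)).
      by rewrite Rintegral_cst// mul0r.
    by apply/funext => s; case: ifPn => // /andP[s0 s1]; have := lt_trans s0 s1; rewrite ltxx.
  rewrite set_itv_ge; last by rewrite bnd_simp -ltNge lt_neqAle tn.
  rewrite Rintegral_set0 (_ : (fun s => _) = (fun=> 0)).
    by rewrite Rintegral_cst// mul0r.
  by apply/funext => s; case: ifPn => // /andP[s0 s1]; have := lt_le_trans (lt_trans s0 s1) t0; rewrite ltxx.
have mfE : measurable_fun `]0, t[ (EFin \o f) by exact/measurable_EFinP.
have mfc : measurable_fun `]0, t] (EFin \o f) by exact/emeasurable_fun_itv_bndo_bndcP.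
rewrite /Rintegral; congr fine.
rewrite -integral_itv_obnd_cbnd// -integral_itv_bndo_bndc// [LHS]integral_mkcond.
by apply: eq_integral => s _; rewrite patchE mem_setE in_itv /=; case: ifP.
Qed.

End TimeIntegrals.

(** * Directional derivatives of the heat flow and the vanishing flux *)

Section DirectionalDerivative.
Context {R : realType} {n : nat}.
Implicit Types (x y z a : n.-tuple R) (t s h c N A : R) (g : n.-tuple R -> R).

(** This replaces differentiation under the integral: a quadratic remainder that is uniform in the
    point survives integration against an L^1 function. *)
Lemma derive1_taylor2 (f : R -> R) (L C : R) :
  (forall h, `|f h - f 0 - h * L| <= C * h ^+ 2) -> derive1 f 0 = L.
Proof.
move=> H; have C0 : 0 <= C by have := H 1; rewrite expr1n mulr1; exact: le_trans.
apply: cvg_lim => //; apply/cvgrPdist_le => e e0.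
have d0 : 0 < e / (C + 1) by rewrite divr_gt0// ltr_pwDr.
near=> h.
have h0 : h != 0 by near: h; exact: nbhs_dnbhs_neq.
have hd : `|h| <= e / (C + 1).
  by near: h; apply: dnbhs0_le.
have -> : L - h^-1 *: (f (h + 0) - f 0) = h^-1 * (h * L - (f h - f 0)).
  by rewrite addr0 /GRing.scale /=; field.
rewrite normrM normfV.
rewrite ler_pdivrMl ?normr_gt0// distrC.
apply: le_trans (H h) _; rewrite -real_normK ?num_real// expr2 mulrA mulrC ler_wpM2l//.
apply: le_trans (ler_wpM2l C0 hd) _; rewrite mulrCA ler_piMr ?(ltW e0)//.
by rewrite ler_pdivrMr ?ltr_pwDr// mul1r lerDl.
Unshelve. all: by end_near. Qed.

Lemma vaddscE z h a : vaddsc z h a = vsub z (vscale (- h) a).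
Proof. by apply: eq_from_tnth => i; rewrite !tnth_mktuple; ring. Qed.

Lemma nrm_vscale h a : nrm (vscale h a) = `|h| * nrm a.
Proof. by rewrite /nrm sqnorm_vscale sqrtrM ?sqr_ge0// sqrtr_sqr. Qed.

Lemma is_derive_gauss t z a h : 0 < t ->
  is_derive h 1 (fun r : R => gauss t (vaddsc z r a)) (Dk a t (vaddsc z h a)).
Proof.
move=> t0; set P := (4 * pi * t) `^ (- (n%:R / 2)).
(* Along a line the exponent is a quadratic polynomial and can be differentiated symbolically. *)
pose q : {poly R} := (- (4 * t)^-1) *: ((sqnorm z)%:P + (2 * dot z a) *: 'X + sqnorm a *: 'X^2).
have qE r : - sqnorm (vaddsc z r a) / (4 * t) = q.[r].
  rewrite /q sqnorm_vaddsc !(hornerZ, hornerD, hornerM, hornerC, hornerX, hornerXn); field; by rewrite gt_eqF.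
have -> : (fun r : R => gauss t (vaddsc z r a)) = P \*: (expR \o horner q).
  by apply/funext => r; rewrite /gauss -/P qE.
have dq : is_derive h 1 (horner q) (q^`().[h]) by exact: is_derive_poly.
have de := is_derive1_comp (is_derive_expR q.[h]) dq.
apply: (is_derive_eq (is_deriveZ P de)); rewrite /GRing.scale /= /Dk /gauss -/P qE.
have -> : dot a (vaddsc z h a) = dot z a + h * sqnorm a.
  rewrite /dot /sqnorm mulr_sumr -big_split; apply: eq_bigr => i _; rewrite tnth_mktuple /=; ring.
rewrite /q !(derivZ, derivD, derivC, derivX, derivXn) !(hornerZ, hornerD, hornerM, hornerC, hornerX, hornerXn) /=.
by field; rewrite gt_eqF.
Qed.

(** Mean value theorem on the line through [z], then the supremum half of [Dk_kb], by which the
    directional derivative is Lipschitz. *)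
Lemma gauss_taylor t z a h : 0 < t ->
  `|gauss t (vaddsc z h a) - gauss t z - h * Dk a t z| <=
  6 * nrm a ^+ 2 * cG n ^+ 2 * t^-1 * cc n t * h ^+ 2.
Proof.
move=> t0; set K := 6 * _ * _ * _ * _.
have z0 : vaddsc z 0 a = z by apply: eq_from_tnth => i; rewrite !tnth_mktuple mul0r addr0.
have lip s : `|Dk a t (vaddsc z s a) - Dk a t z| <= K * `|s|.
  have [_ /(_ (vscale (- s) a)) [_ _ /(_ z)]] := Dk_kb a t0.
  rewrite -vaddscE => H; apply: le_trans H _; rewrite nrm_vscale normrN.
  set D := 6 * nrm a * cG n ^+ 2; have D0 : 0 <= D.
    by rewrite !mulr_ge0 ?nrm_ge0// ?(le_trans ler01 (cG_ge1))//.
  set r := `|s| * nrm a * _.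
  apply: (@le_trans _ _ (D * t `^ (- (1 / 2)) * r * cc n t)).
    apply: ler_wpM2r; first exact: cc_ge0.
    by apply: ler_wpM2l; [apply: mulr_ge0 => //; exact: powR_ge0|rewrite ge_min lexx orbT].
  rewrite le_eqVlt; apply/orP; left; apply/eqP; rewrite /r /K /D.
  have -> : t^-1 = t `^ (- (1 / 2)) * t `^ (- (1 / 2)).
    by rewrite -powR_add// -powR_inv1 ?(ltW t0)//; congr (_ `^ _); field.
  ring.
have DD s : is_derive s 1 (fun r : R => gauss t (vaddsc z r a)) (Dk a t (vaddsc z s a)).
  exact: is_derive_gauss.
have CC s : {for s, continuous (fun r : R => gauss t (vaddsc z r a))}.
  by have [d _] := DD s; apply: differentiable_continuous; exact/derivable1_diffP.
have K0 : 0 <= K by have := lip 1; rewrite normr1 mulr1; exact: le_trans.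
have mvt b c : b < c -> exists2 s, b <= s <= c &
    gauss t (vaddsc z c a) - gauss t (vaddsc z b a) = Dk a t (vaddsc z s a) * (c - b).
  move=> bc; have [|s] := @MVT R _ _ b c bc (fun s _ => DD s).
    by apply: continuous_subspaceT => s; exact: CC.
  by rewrite in_itv/= => /andP[bs sc] E; exists s; rewrite ?(ltW bs) ?(ltW sc).
have [->|hn] := eqVneq h 0; first by rewrite z0 subrr mul0r subrr normr0 expr0n /= mulr0.
have fin s : `|s| <= `|h| -> `|h * (Dk a t (vaddsc z s a) - Dk a t z)| <= K * h ^+ 2.
  move=> sh; rewrite normrM -real_normK ?num_real// expr2 mulrCA ler_wpM2l//.
  by apply: le_trans (lip s) _; rewrite ler_wpM2l.
have [h0|h0] := ltP 0 h.
  have [s /andP[s0 sh]] := mvt 0 h h0; rewrite z0 subr0 => ->.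
  by rewrite mulrC -mulrBr; apply: fin; rewrite !ger0_norm// ltW.
have {}h0 : h < 0 by rewrite lt_neqAle hn.
have [s /andP[s0 sh]] := mvt h 0 h0; rewrite z0 sub0r => E.
have -> : gauss t (vaddsc z h a) - gauss t z = h * Dk a t (vaddsc z s a) by lra.
by rewrite -mulrBr; apply: fin; rewrite !ler0_norm ?lerN2// ltW.
Qed.

Lemma vsub_vaddsc x y h a : vsub (vaddsc x h a) y = vaddsc (vsub x y) h a.
Proof. by apply: eq_from_tnth => i; rewrite !tnth_mktuple; ring. Qed.

Lemma Rintegral_l1_le A g : l1 A g -> `|\int[mu n]_z g z| <= A.
Proof.
move=> hg; have [mg h] := hg; rewrite -lee_fin EFin_normr_Rintegral//; last exact: l1_integrable hg.
by apply: le_trans h; apply: le_abse_integral => //; exact/measurable_EFinP.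
Qed.

Lemma cnv_gauss_taylor t a g A x h : 0 < t -> l1 A g ->
  `|cnv (gauss t) g (vaddsc x h a) - cnv (gauss t) g x - h * cnv (Dk a t) g x| <=
  6 * nrm a ^+ 2 * cG n ^+ 2 * t^-1 * cc n t * h ^+ 2 * A.
Proof.
move=> t0 hg; set K := 6 * _ * _ * _ * _ * _.
have hG := @hb_gauss R n _ t0; have hD := hb_Dk a t0.
pose k z := gauss t (vaddsc z h a) - gauss t z - h * Dk a t z.
have mk : measurable_fun setT k.
  apply: measurable_funB; last by apply: measurable_funM => //; exact: measurable_Dk1.
  apply: measurable_funB; last exact: measurable_gauss1.
  under eq_fun do rewrite vaddscE; apply: measurable_gauss; first exact: measurable_cst.
  exact: measurable_vsub2.
have i1 := cnv_integrable (vaddsc x h a) hG hg.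
have i2 := cnv_integrable x hG hg.
have i3 := cnv_integrable x hD hg.
rewrite (_ : _ - _ - _ = \int[mu n]_y (k (vsub x y) * g y)).
  apply: Rintegral_l1_le; have [mg _] := hg.
  have K0 : 0 <= K by apply: le_trans (gauss_taylor x a h t0).
  have := l1Z K hg; rewrite (ger0_norm K0) => hK; apply: (l1_mono hK) => //.
    by apply: measurable_funM => //; apply: (measurableT_comp mk); exact: measurable_vsub1.
  move=> y; rewrite normrM [leRHS]normrM (ger0_norm K0) ler_wpM2r//; exact: gauss_taylor.
rewrite /cnv -RintegralZl// -RintegralB// -RintegralB//.
- by apply: eq_Rintegral => y _; rewrite vsub_vaddsc /k; ring.
- exact: (integrableB _ i1 i2).
- have := integrableZl measurableT h i3; apply: eq_integrable => // y _.
Qed.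

Lemma cnv_gauss_dirder t a g A x : 0 < t -> l1 A g ->
  dirder a (cnv (gauss t) g) x = cnv (Dk a t) g x.
Proof.
move=> t0 hg; apply: (@derive1_taylor2 _ _ (6 * nrm a ^+ 2 * cG n ^+ 2 * t^-1 * cc n t * A)) => h.
have z0 : vaddsc x 0 a = x by apply: eq_from_tnth => i; rewrite !tnth_mktuple mul0r addr0.
by rewrite z0; apply: le_trans (cnv_gauss_taylor a x h t0 hg) _; rewrite mulrAC.
Qed.

(** [Int] subtracts the [fine] values of two iterated integrals; integrability makes both finite, so
    the difference is the true integral. *)
Lemma IntE g : (mu n).-integrable setT (EFin \o g) -> Int g = \int[mu n]_x g x.
Proof.
move=> ig; have mg : measurable_fun setT g by apply/measurable_EFinP; case/integrableP: ig.
rewrite /Int !iint_mu.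
- rewrite /Rintegral [in RHS]integralE [RHS]fineB.
  + by congr (fine _ - fine _); apply: eq_integral => x _; rewrite ?funeposE ?funenegE -?EFinN -EFin_max.
  + exact: integrable_pos_fin_num.
  + exact: integrable_neg_fin_num.
- by apply/measurable_EFinP; apply: measurable_maxr => //; exact: measurableT_comp.
- by move=> x; rewrite lee_fin le_max lexx orbT.
- by apply/measurable_EFinP; exact: measurable_maxr.
- by move=> x; rewrite lee_fin le_max lexx orbT.
Qed.

Lemma heat_cnv t g A x : 0 < t -> l1 A g -> heat t g x = cnv (gauss t) g x.
Proof. by move=> t0 hg; rewrite /heat IntE//; exact: cnv_integrable (@hb_gauss R n _ t0) hg. Qed.

Lemma dirder_heat t a g A x : 0 < t -> l1 A g -> dirder a (heat t g) x = cnv (Dk a t) g x.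
Proof.
move=> t0 hg; have -> : heat t g = cnv (gauss t) g by apply/funext => z; exact: heat_cnv hg.
exact: cnv_gauss_dirder hg.
Qed.

(** [|r|^(p+1) / (p+1)] is a convex primitive of [f = fnl p], so its first order remainders at [u]
    and at [v] are both nonnegative. Their sum is [(f v - f u) (v - u)], which the Lipschitz bound
    controls. *)
Lemma fnl_primitive p (m u v : R) : 1 < p -> `|u| <= m -> `|v| <= m ->
  `| `|v| `^ (p + 1) / (p + 1) - `|u| `^ (p + 1) / (p + 1) - fnl p u * (v - u)| <=
  p * m `^ (p - 1) * (v - u) ^+ 2.
Proof.
move=> p1 hu hv; have p0 : 0 < p := lt_trans ltr01 p1.
have pp : 0 < p + 1 by rewrite addr_gt0.
have T (r s : R) : fnl p r * (s - r) <= `|s| `^ (p + 1) / (p + 1) - `|r| `^ (p + 1) / (p + 1).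
  have := @powR_tangent R (p + 1) `|r| `|s|; rewrite ltrDr p0 => /(_ isT (normr_ge0 _) (normr_ge0 _)).
  rewrite addrK; have -> : `|r| `^ p = `|r| `^ (p - 1) * `|r|.
    by rewrite -fnl_pos ?(ltW p1)// /fnl normr_id.
  rewrite -mulrBl ler_pdivlMr// /fnl.
  have P0 := powR_ge0 `|r| (p - 1); have := ler_norm (r * s); rewrite normrM.
  have : `|r| * `|r| = r * r by rewrite -normrM ger0_norm// -expr2 sqr_ge0.
  move: (`|r| `^ (p - 1)) P0 => P P0 e1 e2 e3.
  have e4 := ler_wpM2l (ltW pp) (ler_wpM2l P0 e2).
  rewrite (_ : (p + 1) * (P * `|r|) * (`|r| - `|s|) =
    (p + 1) * P * (`|r| * `|r|) - (p + 1) * (P * (`|r| * `|s|))) in e3; last by ring.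
  by rewrite e1 in e3; lra.
have h1 := T u v; have h2 := T v u.
have : `|fnl p v - fnl p u| * `|v - u| <= p * m `^ (p - 1) * (v - u) ^+ 2.
  rewrite -real_normK ?num_real// expr2 mulrA ler_wpM2r//; exact: fnl_lip.
apply: le_trans; rewrite -normrM; apply: le_trans (ler_norm _).
by rewrite ger0_norm; nra.
Qed.

(* The flux term of the energy identity is a total derivative: differentiate the translation-invariant
   integral of a primitive of f along the direction a. *)
Lemma flux0 p t a c N g : 1 < p -> 0 < t -> 0 <= c -> hb c N g ->
  \int[mu n]_x (fnl p (cnv (gauss t) g x) * cnv (Dk a t) g x) = 0.
Proof.
move=> p1 t0 c0 hg; have p0 : 0 < p := lt_trans ltr01 p1.
have pp : 0 < p + 1 by rewrite addr_gt0.
have pm1 : 0 <= p - 1 by rewrite subr_ge0 ltW.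
set W := cnv (gauss t) g; set W' := cnv (Dk a t) g.
have hW : hb c N W by rewrite -(mul1r N); apply: cnv_hb_r => //; exact: hb_l1 (@hb_gauss R n _ t0).
set D := 6 * nrm a * cG n ^+ 2.
have hW' : hb c (D * t `^ (- (1 / 2)) * N) W' by apply: cnv_hb_r => //; exact: hb_l1 (hb_Dk a t0).
pose m := N * c; have mW x : `|W x| <= m by case: hW.
pose Ph (r : R) : R := `|r| `^ (p + 1) / (p + 1).
have mPh : measurable_fun setT (fun x => Ph (W x)).
  apply: measurable_funM => //; apply: measurable_powRs; apply: measurable_norm; exact: hb_meas hW.
have N0 := hb_ge0 hg; have m0 : 0 <= m by rewrite mulr_ge0.
have hPh : hb c (m `^ p * N) (fun x => Ph (W x)).
  rewrite -(ger0_norm (powR_ge0 m p)); apply: (hb_domZ hW mPh c0) => x.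
  rewrite /Ph ger0_norm ?divr_ge0 ?powR_ge0 ?(ltW pp)// ler_pdivrMr//.
  have -> : `|W x| `^ (p + 1) = `|W x| `^ p * `|W x|.
    rewrite -!(fnl_pos (p := _)) ?normr_ge0 ?lerDr ?(ltW p1) ?(ltW p0)//.
    rewrite {1}/fnl normr_id addrK; congr (_ * _).
    by rewrite fnl_pos// ltW.
  have := powR_mono (ltW p0) (normr_ge0 (W x)) (mW x).
  move=> h; apply: (@le_trans _ _ (m `^ p * `|W x|)); first by rewrite ler_wpM2r.
  by rewrite ler_peMr ?mulr_ge0 ?powR_ge0// lerDr ltW.
have mF : measurable_fun setT (fun x => fnl p (W x)) by apply: measurable_fnl; exact: hb_meas hW.
have hF : hb c (m `^ (p - 1) * N) (fun x => fnl p (W x)).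
  rewrite -(ger0_norm (powR_ge0 m (p - 1))); apply: (hb_domZ hW mF c0) => x.
  by rewrite normr_fnl ler_wpM2r// powR_mono.
set I := Rintegral _ _ _.
have mg := hb_meas hg.
pose K1 := 6 * nrm a ^+ 2 * cG n ^+ 2 * t^-1 * cc n t * N.
pose K2 := 4 * cG n * t `^ (- (1 / 2)) * nrm a * N.
have hWh h : hb c (K2 * `|h|) (fun x => W (vaddsc x h a) - W x).
  have [_ /(_ (vscale (- h) a))] := @gauss_kb R n t t0; rewrite oppr0 powRr0 mulr1 => hk.
  have := cnv_hb_r c0 (hb_l1 hk) hg.
  rewrite (_ : cnv _ g = (fun x => W (vaddsc x h a) - W x)).
    move=> H; apply: (hb_le H) => //; rewrite nrm_vscale normrN /K2.
    set r := `|h| * _ * _; have c1 := le_trans ler01 (@cG_ge1 R n).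
    apply: (@le_trans _ _ (4 * cG n * r * N)); last by rewrite /r le_eqVlt; apply/orP; left; apply/eqP; ring.
    by rewrite ler_wpM2r// ler_wpM2l ?mulr_ge0// ge_min lexx orbT.
  have hG := @hb_gauss R n _ t0.
  apply/funext => x; rewrite /W /cnv -RintegralB//.
  - by apply: eq_Rintegral => y _; rewrite vsub_vaddsc vaddscE; ring.
  - exact: cnv_integrable hG (hb_l1 hg).
  - exact: cnv_integrable hG (hb_l1 hg).
pose K := K1 * (m `^ (p - 1) * N) + p * m `^ (p - 1) * (K2 * c) * K2.
(* The integral of [Ph (W (x + h a)) - Ph (W x)] is zero, so [h * I] is the integral of a second
   order remainder. *)
have main h : `|h * I| <= K * h ^+ 2.
  have K10 : 0 <= K1.
    by have := cnv_gauss_taylor a (vzero n) 1 t0 (hb_l1 hg); rewrite expr1n mulr1; exact: le_trans.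
  have hPhh : hb c (m `^ p * N) (fun x => Ph (W (vaddsc x h a))).
    by under eq_fun do rewrite vaddscE; exact: (hb_shift _ hPh).
  pose E x := h * (fnl p (W x) * W' x) - (Ph (W (vaddsc x h a)) - Ph (W x)).
  have l1FW : l1 (N * c * p * 0 + `|m `^ (p - 1) * N * c * (D * t `^ (- (1 / 2)) * N)|) (fun x => fnl p (W x) * W' x).
    have := hb_mul_l1 hF (hb_l1 hW') => H; apply: (l1_mono H) => //; first by case: H.
    by rewrite mulr0 add0r; exact: ler_norm.
  have aux (r s q : R) : s = q -> r = r - (s - q) by move=> ->; rewrite subrr subr0.
  have -> : h * I = \int[mu n]_x E x.
    rewrite RintegralB//.
    - rewrite RintegralZl//; last exact: l1_integrable l1FW.
      rewrite RintegralB//; [|exact: l1_integrable (hb_l1 hPhh)|exact: l1_integrable (hb_l1 hPh)].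
      apply: aux; apply: etrans; last exact: (Rintegral_shift (vscale (- h) a) mPh).
      by apply: eq_Rintegral => x _; rewrite vaddscE.
    - exact: l1_integrable (l1Z h l1FW).
    - exact: l1_integrable (hb_l1 (hbB hPhh hPh)).
  (* Two errors: [f(W)] times the Taylor remainder of [W] along [a], and the remainder of the
     primitive. *)
  have lA := l1Z (K1 * h ^+ 2) (hb_l1 hF).
  have lB := l1Z (p * m `^ (p - 1) * (K2 * `|h| * c)) (hb_l1 (hWh h)).
  have K20 : 0 <= K2 by have := hb_ge0 (hWh 1); rewrite normr1 mulr1.
  have pm0 : 0 <= p * m `^ (p - 1) := mulr_ge0 (ltW p0) (powR_ge0 _ _).
  have q0 : 0 <= p * m `^ (p - 1) * (K2 * `|h| * c).
    exact: (mulr_ge0 pm0 (mulr_ge0 (mulr_ge0 K20 (normr_ge0 h)) c0)).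
  have r0 : 0 <= K1 * h ^+ 2 := mulr_ge0 K10 (sqr_ge0 h).
  have tri (r f w d q k1 k2 : R) : `|d - r * w| <= k1 -> `|q - f * d| <= k2 ->
      `|r * (f * w) - q| <= k1 * `|f| + k2.
    move=> H1 H2; rewrite (_ : _ - q = - f * (d - r * w) - (q - f * d)); last by ring.
    apply: le_trans (ler_normB _ _) _; apply: lerD => //.
    by rewrite normrM normrN mulrC ler_wpM2r.
  have absl1 B u : l1 B u -> l1 B (fun x : n.-tuple R => `|u x|).
    move=> hu; apply: (l1_mono hu) => //; first by apply: measurable_norm; case: hu.
    by move=> x; rewrite normr_id.
  apply: Rintegral_l1_le; apply: (l1_mono (l1D (absl1 _ _ lA) (absl1 _ _ lB))).
  - apply: measurable_funB; first by apply: measurable_funM => //; case: l1FW.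
    exact: measurable_funB (hb_meas hPhh) mPh.
  - move=> x; rewrite [leRHS]ger0_norm ?addr_ge0//.
    have e1 := @fnl_primitive p m (W x) (W (vaddsc x h a)) p1 (mW x) (mW _).
    have e2 := cnv_gauss_taylor a x h t0 (hb_l1 hg).
    rewrite -/W -/W' in e2.
    have e3 : `|W (vaddsc x h a) - W x| <= K2 * `|h| * c by case: (hWh h).
    apply: le_trans (tri h _ _ _ _ _ _ e2 e1) _; apply: lerD.
      rewrite [leRHS]normrM (ger0_norm r0) le_eqVlt; apply/orP; left; apply/eqP; rewrite /K1; ring.
    rewrite [leRHS]normrM (ger0_norm q0) -[in leLHS]real_normK ?num_real// expr2 mulrA.
    by apply: ler_wpM2r => //; exact: ler_wpM2l.
  - rewrite (ger0_norm r0) (ger0_norm q0) le_eqVlt; apply/orP; left; apply/eqP.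
    rewrite /K -[h ^+ 2]real_normK ?num_real//; ring.
apply/eqP; apply: contraT => I0; have aI : 0 < `|I| by rewrite normr_gt0.
have K0 : 0 <= K by have := main 1; rewrite expr1n mulr1; apply: le_trans.
(* Small enough to contradict [h |I| <= K h^2]. *)
pose h := `|I| / (K + 1); have h0 : 0 < h by rewrite divr_gt0// ltr_pwDr.
have := main h; rewrite normrM (gtr0_norm h0) expr2 mulrCA ler_pM2l// => H.
have : K * h < `|I|.
  by rewrite /h mulrCA gtr_pMr// ltr_pdivrMr ?ltr_pwDr// mul1r ltrDl.
by rewrite ltNge H.
Qed.

End DirectionalDerivative.

(** * Equality almost everywhere *)

Section AlmostEverywhere.
Context {R : realType} {d} {T : measurableType d} (m : {measure set T -> \bar R}).

Definition eqae (f g : T -> R) := m [set x | f x != g x] = 0%E.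

Lemma measurable_neq (f g : T -> R) : measurable_fun setT f -> measurable_fun setT g ->
  measurable [set x | f x != g x].
Proof.
move=> mf mg; rewrite (_ : [set x | _] = ~` ((fun x => f x - g x) @^-1` [set 0])).
  apply: measurableC; rewrite -[X in measurable X]setTI.
  by apply: measurable_funB.
apply/seteqP; split => x /=.
  by move=> /eqP h /eqP; rewrite subr_eq0 => /eqP.
by move=> h; apply/eqP => e; apply: h; rewrite e subrr.
Qed.

Lemma eqae_sym (f g : T -> R) : eqae f g -> eqae g f.
Proof. by rewrite /eqae; under eq_set do rewrite eq_sym. Qed.

Lemma eqae_dom (f g f' g' : T -> R) :
  measurable_fun setT f -> measurable_fun setT g ->
  measurable_fun setT f' -> measurable_fun setT g' ->
  (forall x, f x = g x -> f' x = g' x) -> eqae f g -> eqae f' g'.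
Proof.
move=> mf mg mf' mg' H e; apply/eqP; rewrite eq_le measure_ge0 andbT -[leRHS]e.
apply: le_measure; rewrite ?inE; try exact: measurable_neq.
by move=> x /= /eqP h; apply/eqP => /H.
Qed.

Lemma eqae_trans (f g h : T -> R) :
  measurable_fun setT f -> measurable_fun setT g -> measurable_fun setT h ->
  eqae f g -> eqae g h -> eqae f h.
Proof.
move=> mf mg mh fg gh; apply/eqP; rewrite eq_le measure_ge0 andbT.
apply: (@le_trans _ _ (m ([set x | f x != g x] `|` [set x | g x != h x]))).
  apply: le_measure; rewrite ?inE; try exact: measurable_neq.
    by apply: measurableU; exact: measurable_neq.
  move=> x /= /eqP fh; have [e|] := eqVneq (f x) (g x); last by left.
  by right; rewrite -e; exact/eqP.
apply: le_trans (measureU2 m (measurable_neq mf mg) (measurable_neq mg mh)) _.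
apply: (@le_trans _ _ (0 + 0)%E); last by rewrite adde0.
by apply: leeD; rewrite le_eqVlt; apply/orP; left; apply/eqP; [exact: fg|exact: gh].
Qed.

Lemma integral_eqae (f g : T -> R) : measurable_fun setT f -> measurable_fun setT g ->
  eqae f g -> (\int[m]_x (f x)%:E = \int[m]_x (g x)%:E)%E.
Proof.
move=> mf mg e; apply: ae_eq_integral => //; try exact/measurable_EFinP.
exists [set x | f x != g x]; split => //; first exact: measurable_neq.
by move=> x /= h; apply/eqP => fg; apply: h => _; rewrite fg.
Qed.

Lemma Rintegral_eqae (f g : T -> R) : measurable_fun setT f -> measurable_fun setT g ->
  eqae f g -> \int[m]_x f x = \int[m]_x g x.
Proof. by move=> mf mg e; rewrite /Rintegral (integral_eqae mf mg e). Qed.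

End AlmostEverywhere.

(** * Duhamel integrals *)

Section Duhamel.
Context {R : realType} {n : nat}.
Notation leb := (@lebesgue_measure R).
Implicit Types (x y z a : n.-tuple R) (t s h c B : R) (g v : R -> n.-tuple R -> R).

Definition jm g := measurable_fun setT (fun q : R * n.-tuple R => g q.1 q.2).

(** The extension by zero outside []0, t[] makes the time integral run over the whole line, and the
    kernel is never taken at a nonpositive time. *)
Definition duhk a g t (q : R * n.-tuple R) : R :=
  if 0 < q.1 < t then cnv (Dk a (t - q.1)) (g q.1) q.2 else 0.

Definition duh a g t x : R := \int[leb]_s duhk a g t (s, x).

Lemma jm1 g s : jm g -> measurable_fun setT (g s).
Proof.
move=> mg; apply: (@measurableT_comp _ _ _ _ _ _ (fun q : R * n.-tuple R => g q.1 q.2) _ (fun y => (s, y))) => //.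
exact: measurable_fun_pair.
Qed.

Lemma jm_shift g t0 : jm g -> jm (fun s => g (t0 + s)).
Proof.
move=> mg; apply: (@measurableT_comp _ _ _ _ _ _ (fun q : R * n.-tuple R => g q.1 q.2) _ (fun q : R * n.-tuple R => (t0 + q.1, q.2))) => //.
apply: measurable_fun_pair => //=; apply: measurable_funD => //; exact: measurable_cst.
Qed.

Lemma jm_fnl p g : jm g -> jm (fun s x => fnl p (g s x)).
Proof. exact: measurable_fnl. Qed.

Lemma measurable_cnv_Dk a d (T : measurableType d) (u : T -> R) (w : T -> n.-tuple R)
    (g : T -> n.-tuple R -> R) :
  measurable_fun setT u -> measurable_fun setT w ->
  measurable_fun setT (fun q : T * n.-tuple R => g q.1 q.2) ->
  measurable_fun setT (fun q : T => cnv (Dk a (u q)) (g q) (w q)).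
Proof.
move=> mu' mw mg.
apply: (@measurable_Rintegral _ _ _ T _ (mu n) (fun p : T * n.-tuple R =>
  Dk a (u p.1) (vsub (w p.1) p.2) * g p.1 p.2)).
apply: measurable_funM => //; apply: measurable_Dk; first exact: measurableT_comp.
by apply: measurable_vsub => //; exact: measurableT_comp.
Qed.

Lemma measurable_duhk a g t : jm g -> measurable_fun setT (duhk a g t).
Proof.
move=> mg; apply: measurable_if_itv => //.
apply: (@measurable_cnv_Dk a _ _ (fun q : R * n.-tuple R => t - q.1) snd (fun q : R * n.-tuple R => g q.1)) => //.
  by apply: measurable_funB => //; exact: measurable_cst.
apply: (@measurableT_comp _ _ _ _ _ _ (fun q : R * n.-tuple R => g q.1 q.2) _ (fun q : (R * n.-tuple R) * n.-tuple R => (q.1.1, q.2))) => //.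
by apply: measurable_fun_pair => //; exact: measurableT_comp.
Qed.

Lemma hb_0 c : hb c 0 (fun _ : n.-tuple R => 0 : R).
Proof.
split.
- exact: measurable_cst.
- by rewrite integral0_eq// => x _; rewrite normr0.
- by move=> x; rewrite normr0 mul0r.
Qed.

(** Minkowski's inequality in time: an integrable bound for the slices suffices. Integrability at
    every single [x] comes along and is what linearity, as in [duhB], asks for. *)
Lemma duh_hb a g t c (b : R -> R) B : 0 <= c -> jm g -> measurable_fun setT b ->
  (forall s, 0 < s -> s < t -> hb c (b s) (cnv (Dk a (t - s)) (g s))) ->
  (\int[leb]_s (if 0 < s < t then b s else 0)%:E <= B%:E)%E ->
  (forall x, leb.-integrable setT (fun s => (duhk a g t (s, x))%:E)) /\ hb c B (duh a g t).
Proof.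
move=> c0 mg mb H hB.
apply: (@hb_integral R n _ _ leb c B (fun s => if 0 < s < t then b s else 0) (duhk a g t)) => //.
- exact: measurable_duhk.
- exact: measurable_if_itv1.
- move=> s; rewrite /duhk /=; case: ifPn => [/andP[s0 st]|_]; first exact: H.
  exact: hb_0.
Qed.

Definition CD a : R := 6 * nrm a * cG n ^+ 2.

Lemma CD_ge0 a : 0 <= CD a.
Proof.
have c0 : 0 <= cG n :> R := le_trans ler01 (@cG_ge1 R n).
exact: mulr_ge0 (mulr_ge0 (ler0n _ 6) (nrm_ge0 a)) (exprn_ge0 2 c0).
Qed.

Lemma l1_Dk a t : 0 < t -> l1 (CD a * t `^ (- (1 / 2))) (Dk a t).
Proof. by move=> t0; exact: hb_l1 (hb_Dk a t0). Qed.

Lemma integral_half_le t (K : R) : 0 < t -> 0 <= K ->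
  (\int[leb]_s (if (0 < s < t)%R then (K * (t - s) `^ (- (1 / 2)))%R else 0%R)%:E <= (2 * t `^ (1 / 2) * K)%:E)%E.
Proof.
move=> t0 K0; rewrite (@integral_if_refl R t (fun s => K * s `^ (- (1 / 2)))); last 2 first.
- by apply: measurable_funM => //; exact: measurable_powR.
- by move=> s; exact: mulr_ge0 K0 (powR_ge0 _ _).
rewrite (_ : (fun s => _) = (fun s : R => (K * (if 0 < s < t then s `^ (- (1 / 2)) else 0))%:E)); last first.
  by apply/funext => s; case: ifP => // _; rewrite mulr0.
rewrite integralZl_EFin//.
- apply: (@le_trans _ _ (K%:E * (t `^ (1 - 1 / 2) / (1 - 1 / 2))%:E)%E).
    by apply: lee_wpmul2l; [rewrite lee_fin|apply: integral_powR_le => //; lra].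
  rewrite -EFinM lee_fin le_eqVlt; apply/orP; left; apply/eqP.
  by rewrite (_ : 1 - 1 / 2 = 1 / 2 :> R); [field|field].
- by apply: measurable_if_itv1; exact: measurable_powR.
- by move=> s; case: ifP => // _; exact: powR_ge0.
Qed.

Lemma duh_hb1 a g t c B : 0 <= c -> 0 < t -> jm g -> (forall s, 0 < s -> s < t -> hb c B (g s)) ->
  (forall x, leb.-integrable setT (fun s => (duhk a g t (s, x))%:E)) /\
  hb c (2 * CD a * t `^ (1 / 2) * B) (duh a g t).
Proof.
move=> c0 t0 mg hg.
have B0 : 0 <= B.
  have t2 : 0 < t / 2 by rewrite divr_gt0.
  by have := hb_ge0 (hg (t / 2) t2 _); apply; lra.
have cd0 : 0 <= CD a * B := mulr_ge0 (CD_ge0 a) B0.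
apply: (@duh_hb a g t c (fun s => CD a * B * (t - s) `^ (- (1 / 2)))) => //.
- apply: measurable_funM => //; apply: measurable_powRs.
  by apply: measurable_funB => //; exact: measurable_cst.
- move=> s s0 st; rewrite mulrAC; apply: cnv_hb_r => //; last exact: hg.
  by apply: l1_Dk; rewrite subr_gt0.
- apply: le_trans (integral_half_le t0 cd0) _.
  by rewrite lee_fin le_eqVlt; apply/orP; left; apply/eqP; ring.
Qed.

Lemma duhB a g v t x :
  leb.-integrable setT (fun s => (duhk a g t (s, x))%:E) ->
  leb.-integrable setT (fun s => (duhk a v t (s, x))%:E) ->
  (forall s, 0 < s -> s < t -> exists c B, [/\ 0 <= c, hb c B (g s) & hb c B (v s)]) ->
  duh a g t x - duh a v t x = duh a (fun s y => g s y - v s y) t x.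
Proof.
move=> ig iv H; rewrite /duh -RintegralB//; apply: eq_Rintegral => s _.
rewrite /duhk /=; case: ifPn => [/andP[s0 st]|_]; last by rewrite subrr.
have [c [B [c0 hg hv]]] := H s s0 st; have ts : 0 < t - s by rewrite subr_gt0.
by rewrite (cnvBr x (hb_Dk a ts) (hb_l1 hg) (hb_l1 hv)).
Qed.

(** Convolution ignores null sets, yet its equality holds at every point; this is how an equation
    valid almost everywhere becomes one valid everywhere. *)
Lemma cnv_eqae k (g1 g2 : n.-tuple R -> R) x : measurable_fun setT k ->
  measurable_fun setT g1 -> measurable_fun setT g2 -> eqae (mu n) g1 g2 ->
  cnv k g1 x = cnv k g2 x.
Proof.
move=> mk m1 m2 e; have mkx : measurable_fun setT (fun y => k (vsub x y)).
  by apply: (measurableT_comp mk); exact: measurable_vsub1.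
apply: Rintegral_eqae; try exact: measurable_funM.
apply: (eqae_dom m1 m2 _ _ _ e); try exact: measurable_funM.
by move=> y ->.
Qed.

Lemma duh_eqae a g v t x : jm g -> jm v -> (forall s, 0 < s -> s < t -> eqae (mu n) (g s) (v s)) ->
  duh a g t x = duh a v t x.
Proof.
move=> mg mv e; apply: eq_Rintegral => s _; rewrite /duhk /=; case: ifPn => // /andP[s0 st].
by apply: cnv_eqae; [exact: measurable_Dk1|exact: jm1|exact: jm1|exact: e].
Qed.

Lemma eqae_point (f g : R -> R) r : (forall s, s != r -> f s = g s) -> eqae leb f g.
Proof.
move=> H; apply/eqP; rewrite eq_le measure_ge0 andbT.
rewrite -[leRHS](lebesgue_measure_set1 r); apply: le_outer_measure => s /= fg.
by apply/eqP; apply: contraNT fg => /H ->.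
Qed.

Lemma Rintegral_affine1 (f : R -> R) r : measurable_fun setT f ->
  \int[leb]_s f (s - r) = \int[leb]_s f s.
Proof.
move=> mf; rewrite /Rintegral; congr fine.
have mfE : measurable_fun setT (EFin \o f) by exact/measurable_EFinP.
rewrite integralE [RHS]integralE; congr (_ - _)%E.
- rewrite -[RHS](@ge0_integral_affine1 R 1 (- r) _ (or_introl erefl) (measurable_funepos mfE) (fun u => funepos_ge0 _ u)).
  by apply: eq_integral => s _; rewrite mul1r !funeposE.
- rewrite -[RHS](@ge0_integral_affine1 R 1 (- r) _ (or_introl erefl) (measurable_funeneg mfE) (fun u => funeneg_ge0 _ u)).
  by apply: eq_integral => s _; rewrite mul1r !funenegE.
Qed.

Lemma measurable_duhk1 a g t x : jm g -> measurable_fun setT (fun s => duhk a g t (s, x)).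
Proof.
move=> mg; apply: (measurableT_comp (measurable_duhk a t mg)); exact: measurable_fun_pair.
Qed.

Lemma cnv_gauss_cnv_Dk a s t c B (g : n.-tuple R -> R) : 0 < s -> 0 < t -> hb c B g ->
  cnv (gauss s) (cnv (Dk a t) g) = cnv (Dk a (s + t)) g.
Proof.
move=> s0 t0 hg; rewrite (cnvA (@cc_ge0 R n t) (@hb_gauss R n _ s0) (hb_Dk a t0) (hb_l1 hg)).
by rewrite cnv_gauss_Dk.
Qed.

(** The time integral is cut at [t0]; by the semigroup law [G_t * D_(t0 - s) = D_(t0 + t - s)] the
    earlier piece is the heat flow of the Duhamel term at [t0]. *)
Lemma duh_restart a g t0 t c B x : 0 <= c -> jm g -> (forall s, hb c B (g s)) -> 0 < t0 -> 0 < t ->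
  duh a g (t0 + t) x = cnv (gauss t) (duh a g t0) x + duh a (fun s => g (t0 + s)) t x.
Proof.
move=> c0 mg hg t00 t1.
have mg' := jm_shift t0 mg.
have tt : 0 < t0 + t by rewrite addr_gt0.
have [iT _] := duh_hb1 a c0 tt mg (fun s _ _ => hg s).
have [i2 _] := duh_hb1 a c0 t1 mg' (fun s _ _ => hg (t0 + s)).
have hG := @hb_gauss R n _ t1.
pose F1 s := if 0 < s < t0 then cnv (Dk a (t0 + t - s)) (g s) x else 0.
pose F2 s := duhk a (fun s => g (t0 + s)) t (s - t0, x).
have mF1 : measurable_fun setT F1.
  have := measurable_duhk1 a (t0 + t) x mg => m1.
  rewrite (_ : F1 = (fun s => if 0 < s < t0 then duhk a g (t0 + t) (s, x) else 0)).
    exact: measurable_if_itv1.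
  apply/funext => s; rewrite /F1 /duhk /=; case: ifPn => // /andP[-> st0].
  by rewrite (lt_trans st0) ?ltrDl.
have mF2 : measurable_fun setT F2.
  apply: (@measurableT_comp _ _ _ _ _ _ (fun s => duhk a (fun s => g (t0 + s)) t (s, x)) _ (fun s : R => s - t0)).
    exact: measurable_duhk1.
  by apply: measurable_funB => //; exact: measurable_cst.
(* At [s = t0] both cutoffs vanish while the whole integrand need not; a single time is
   negligible. *)
have E s : s != t0 -> duhk a g (t0 + t) (s, x) = F1 s + F2 s.
  move=> st; rewrite /F1 /F2 /duhk /= subr_gt0 ltrBlDr (addrC t).
  rewrite (_ : t - (s - t0) = t0 + t - s); last by ring.
  rewrite (_ : t0 + (s - t0) = s); last by ring.
  have [s0|s0] := ltP s t0.
    have -> : t0 < s = false by apply/negbTE; rewrite -leNgt ltW.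
    by rewrite /= addr0 (lt_trans s0) ?ltrDl//.
  have st0 : t0 < s by rewrite lt_neqAle eq_sym st.
  by rewrite st0 (lt_trans t00 st0) /= add0r.
have lF2 : leb.-integrable setT (EFin \o F2).
  apply/integrableP; split; first exact/measurable_EFinP.
  case/integrableP: (i2 x) => _; apply: le_lt_trans.
  have ma : measurable_fun setT (fun s => `|duhk a (fun s => g (t0 + s)) t (s, x)|%:E).
    by apply/measurable_EFinP; apply: measurable_norm; exact: measurable_duhk1.
  rewrite -(@ge0_integral_affine1 R 1 (- t0) _ (or_introl erefl) ma); last by move=> s; rewrite lee_fin.
  by apply: ge0_le_integral => //=; [exact/measurable_EFinP/measurable_norm|
    apply/measurable_EFinP; apply: measurable_norm; rewrite (_ : (fun s => _) = F2)//; apply/funext => s; rewrite /F2 mul1r|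
    move=> s _; rewrite mul1r].
have lF1 : leb.-integrable setT (EFin \o F1).
  apply: (le_integrable measurableT _ _ (iT x)); first exact/measurable_EFinP.
  move=> s _; rewrite /F1 /duhk /=; case: ifPn => [/andP[-> st]|_].
    by rewrite (lt_trans st) ?ltrDl.
  by rewrite normr0 lee_fin.
have -> : duh a g (t0 + t) x = \int[leb]_s (F1 s + F2 s).
  apply: Rintegral_eqae; [exact: measurable_duhk1|exact: measurable_funD|].
  exact: (eqae_point (r := t0)) E.
rewrite (RintegralD measurableT lF1 lF2); congr (_ + _); last by apply: Rintegral_affine1; exact: measurable_duhk1.
have hb0 s : 0 < s -> s < t0 -> hb c (CD a * B * (t0 - s) `^ (- (1 / 2))) (cnv (Dk a (t0 - s)) (g s)).
  by move=> s0 st; rewrite mulrAC; apply: cnv_hb_r => //; apply: l1_Dk; rewrite subr_gt0.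
have B0 : 0 <= B := hb_ge0 (hg 0).
have cd0 : 0 <= CD a * B := mulr_ge0 (CD_ge0 a) B0.
rewrite /duh (@cnv_Rintegral _ _ _ _ leb c (cc n t) 1 (2 * CD a * t0 `^ (1 / 2) * B)
  (fun s => if 0 < s < t0 then CD a * B * (t0 - s) `^ (- (1 / 2)) else 0))//.
- apply: eq_Rintegral => s _; rewrite /F1 /duhk /=; case: ifPn => [/andP[s0 st]|_].
    rewrite (cnv_gauss_cnv_Dk a t1 (_ : 0 < t0 - s) (hg s)) ?subr_gt0//.
    by rewrite (_ : t + (t0 - s) = t0 + t - s)//; ring.
  rewrite /cnv (_ : (fun y => _) = (fun=> 0)) ?Rintegral_cst ?mul0r//.
  by apply/funext => y; rewrite mulr0.
- exact: measurable_duhk.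
- by apply: measurable_if_itv1; apply: measurable_funM => //; apply: measurable_powRs; apply: measurable_funB => //; exact: measurable_cst.
- by move=> s; rewrite /duhk /=; case: ifPn => [/andP[s0 st]|_]; [exact: hb0|exact: hb_0].
- apply: le_trans (integral_half_le t00 cd0) _.
  by rewrite lee_fin le_eqVlt; apply/orP; left; apply/eqP; ring.
Qed.

End Duhamel.

(** * From essential bounds to pointwise bounds *)

Section EssentialBounds.
Context {R : realType} {n : nat}.
Implicit Types (x y a : n.-tuple R) (g h k : n.-tuple R -> R) (M r b : R).

(** Turns an essential bound into a pointwise one within the same class almost everywhere; being
    1-Lipschitz, it respects continuity in L^1. *)
Definition clip M r : R := Num.max (- M) (Num.min M r).

Lemma clip_le M r : 0 <= M -> `|clip M r| <= M.
Proof. by move=> M0; rewrite ler_norml /clip le_max lexx ge_max ge_min lexx andbT /=; lra. Qed.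

Lemma clip_id M r : `|r| <= M -> clip M r = r.
Proof. by rewrite ler_norml => /andP[h1 h2]; rewrite /clip min_r// max_r. Qed.

Lemma clip_lip M r b : 0 <= M -> `|clip M r - clip M b| <= `|r - b|.
Proof.
move=> M0; have H u w : u <= w -> 0 <= clip M w - clip M u <= w - u.
  move=> uw; rewrite /clip; case: (leP M w) => h1; case: (leP M u) => h2;
  rewrite /Order.max; repeat case: ifPn => //; rewrite -?leNgt; lra.
have [rb|/ltW rb] := leP r b.
  have /andP[h1 h2] := H _ _ rb; rewrite (distrC (clip M r)) (distrC r) !ger0_norm//.
  by rewrite subr_ge0.
by have /andP[h1 h2] := H _ _ rb; rewrite !ger0_norm// subr_ge0.
Qed.

Lemma measurable_clip d (T : measurableType d) M (f : T -> R) :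
  measurable_fun setT f -> measurable_fun setT (fun z => clip M (f z)).
Proof.
move=> mf; apply: measurable_maxr; first exact: measurable_cst.
by apply: measurable_minr => //; exact: measurable_cst.
Qed.

Lemma integral_bool_mu (P : n.-tuple R -> bool) : measurable [set x | P x] ->
  (\int[mu n]_x (if P x then 1 else 0)%:E = mu n [set x | P x])%E.
Proof.
move=> mP; have := @integral_indic _ _ _ (mu n) setT measurableT _ mP; rewrite setIT => <-.
apply: eq_integral => x _; rewrite indicE.
by case: ifPn => h; [rewrite mem_set|rewrite memNset//; exact/negP].
Qed.

Lemma measurable_if_bool (P : n.-tuple R -> bool) : measurable [set x | P x] ->
  measurable_fun setT (fun x => (if P x then 1 else 0)%:E : \bar R).
Proof.
move=> mP; apply/measurable_EFinP; rewrite (_ : (fun x => _) = \1_[set x | P x]).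
  exact: measurable_indic.
apply/funext => x; rewrite indicE.
by case: ifPn => h; [rewrite mem_set|rewrite memNset//; exact/negP].
Qed.

Lemma iint_bool (P : n.-tuple R -> bool) : measurable [set x | P x] ->
  (iint (fun x => (if P x then 1 else 0)%:E) = mu n [set x | P x])%E.
Proof.
move=> mP; rewrite iint_mu ?integral_bool_mu//; first exact: measurable_if_bool.
by move=> x; case: (P x); rewrite lee_fin.
Qed.

Lemma ae_eqP g h : measurable_fun setT g -> measurable_fun setT h ->
  Defs.ae_eq g h -> eqae (mu n) g h.
Proof.
by move=> mg mh; rewrite /Defs.ae_eq (iint_bool (P := fun x => g x != h x))//; exact: measurable_neq.
Qed.

Lemma Lq1E g : measurable_fun setT g -> (Lqnorm 1%:E g = \int[mu n]_x `|g x|%:E)%E.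
Proof.
move=> mg; rewrite /Lqnorm invr1 poweRe1.
  rewrite iint_mu; first by apply: eq_integral => x _; rewrite powRr1.
    by apply/measurable_EFinP; under eq_fun do rewrite powRr1//; exact: measurable_norm.
  by move=> x; rewrite lee_fin powR_ge0.
rewrite iint_mu; first by apply: integral_ge0 => x _; rewrite lee_fin powR_ge0.
  by apply/measurable_EFinP; under eq_fun do rewrite powRr1//; exact: measurable_norm.
by move=> x; rewrite lee_fin powR_ge0.
Qed.

Lemma measurable_gt_norm g b : measurable_fun setT g -> measurable [set x | b < `|g x|].
Proof.
move=> mg; rewrite -[X in measurable X]setTI.
have := measurable_fun_ltr (measurable_cst b) (measurable_norm mg) => h.
have := h measurableT [set true] (I : measurable [set true]).
by rewrite (_ : _ @^-1` [set true] = [set x | b < `|g x|])//; apply/seteqP; split.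
Qed.

(** The bound [M] is on an infimum of admissible levels; a unit of room guarantees an admissible
    level below [M + 1]. *)
Lemma ess_sup_clip g M : measurable_fun setT g -> 0 <= M -> (Lqnorm +oo g <= M%:E)%E ->
  eqae (mu n) g (fun x => clip (M + 1) (g x)).
Proof.
move=> mg M0; rewrite /Lqnorm /ess_sup_abs => hM.
have : (ereal_inf [set M0 : \bar R | iint (fun x => (if (M0 < `|g x|%:E)%E then 1 else 0)%:E) = 0%E]
    < (M + 1)%:E)%E.
  by apply: le_lt_trans hM _; rewrite lte_fin ltrDl.
move=> /ereal_inf_lt [b /= hb0 bM].
have M10 : 0 <= M + 1 by rewrite addr_ge0.
have mc := measurable_clip (M + 1) mg.
apply/eqP; rewrite eq_le measure_ge0 andbT -[leRHS]hb0.
rewrite (iint_bool (P := fun x => (b < `|g x|%:E)%E)).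
  apply: le_measure; rewrite ?inE; first exact: measurable_neq.
    case: b {hb0} bM => [b| |] bM //=.
    - by under eq_set do rewrite lte_fin; exact: measurable_gt_norm.
    - by rewrite (_ : [set x | _] = setT)//; apply/seteqP; split => x //= _; exact: ltNyr.
  move=> x /= /eqP h; apply: lt_le_trans bM _; rewrite lee_fin leNgt; apply/negP => H.
  by apply: h; rewrite clip_id// ltW.
case: b {hb0} bM => [b| |] bM //=.
- by under eq_set do rewrite lte_fin; exact: measurable_gt_norm.
- by rewrite (_ : [set x | _] = setT)//; apply/seteqP; split => x //= _; exact: ltNyr.
Qed.

Lemma hb_fnl p c N g : 1 < p -> 0 <= c -> hb c N g -> hb c ((N * c) `^ (p - 1) * N) (fun x => fnl p (g x)).
Proof.
move=> p1 c0 hg; rewrite -(ger0_norm (powR_ge0 (N * c) (p - 1))).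
apply: (hb_domZ hg) => //; first by apply: measurable_fnl; exact: hb_meas hg.
move=> x; rewrite normr_fnl ler_wpM2r//; apply: powR_mono => //; first by rewrite subr_ge0 ltW.
by case: hg.
Qed.

Lemma hb_eqae c N A g h : 0 <= c -> l1 A g -> measurable_fun setT h -> eqae (mu n) g h ->
  A <= N -> (forall x, `|h x| <= N * c) -> hb c N h.
Proof.
move=> c0 [mg hg] mh e AN hh; split => //; apply: (@le_trans _ _ A%:E); last by rewrite lee_fin.
apply: le_trans hg; rewrite le_eqVlt; apply/orP; left; apply/eqP.
apply: integral_eqae; try exact: measurable_norm.
by apply: (eqae_dom mh mg _ _ _ (eqae_sym e)) => [||x ->]//; exact: measurable_norm.
Qed.

End EssentialBounds.

(** * Joint measurability from continuity in time *)

Section TimeSteps.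
Context {R : realType} {n : nat}.
Implicit Types (t s : R) (g : R -> n.-tuple R -> R).

(** Rounds a time [s >= 0] up to a strictly larger multiple of [1/(m+1)]. The result is positive for
    every [s], so only positive times are ever sampled. *)
Definition tstep (m : nat) s : R := ((Num.truncn (s * m.+1%:R)).+1)%:R / m.+1%:R.

Lemma tstep_gt0 m s : 0 < tstep m s. Proof. by rewrite divr_gt0. Qed.

Lemma tstep_dist m s : 0 <= s -> `|tstep m s - s| <= m.+1%:R^-1.
Proof.
move=> s0; have sm : 0 <= s * m.+1%:R by rewrite mulr_ge0.
have /andP[h1 h2] := truncn_itv sm.
have m0 : 0 < m.+1%:R :> R by [].
have -> : tstep m s - s = (((Num.truncn (s * m.+1%:R)).+1)%:R - s * m.+1%:R) / m.+1%:R.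
  by rewrite /tstep mulrBl mulfK// gt_eqF.
rewrite normrM (gtr0_norm (_ : 0 < m.+1%:R^-1)) ?invr_gt0// ler_piMl ?invr_ge0//.
rewrite ger0_norm ?subr_ge0 ?(ltW h2)//; move: h1 h2; rewrite -(natr1 (Num.truncn _)); lra.
Qed.

Lemma measurable_truncn_eq d (T : measurableType d) (u : T -> R) (k : nat) :
  measurable_fun setT u -> measurable [set z | Num.truncn (u z) = k].
Proof.
move=> mu'; have mb : measurable_fun setT (fun z => (u z < k.+1%:R) && ((k == 0) || (k%:R <= u z))).
  apply: measurable_and => /=; first by apply: measurable_fun_ltr => //; exact: measurable_cst.
  apply: measurable_or => /=; first exact: measurable_cst.
  by apply: measurable_fun_ler => //; exact: measurable_cst.
have := mb measurableT [set true] (I : measurable [set true]); rewrite setTI.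
rewrite (_ : _ @^-1` [set true] = [set z | Num.truncn (u z) = k])//.
apply/seteqP; split => z /=; rewrite -truncn_le_nat.
  move=> /andP[h1 h2]; apply/eqP; rewrite eqn_leq h1 /=.
  by case: k h1 h2 {mb} => [//|k] _ /=; rewrite -truncn_gt_nat.
move=> e; rewrite e leqnn /=; case: k e {mb} => [//|k] e /=.
by rewrite -truncn_gt_nat e ltnSn.
Qed.

(** Only countably many times are sampled, each on a measurable set of [s], so measurable slices
    suffice. *)
Lemma jm_tstep m g : (forall s, 0 < s -> measurable_fun setT (g s)) -> jm (fun s => g (tstep m s)).
Proof.
move=> mg; pose G k := g (k.+1%:R / m.+1%:R).
have mG k : measurable_fun setT (fun q : R * n.-tuple R => G k q.2).
  by apply: measurableT_comp => //; apply: mg; rewrite divr_gt0.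
move=> _ Y mY; rewrite setTI.
rewrite (_ : _ @^-1` Y = \bigcup_k ([set q : R * n.-tuple R | Num.truncn (q.1 * m.+1%:R) = k] `&`
    (fun q => G k q.2) @^-1` Y)).
  apply: bigcupT_measurable => k; apply: measurableI.
    by apply: measurable_truncn_eq; apply: measurable_funM => //; exact: measurable_cst.
  by rewrite -[X in measurable X]setTI; apply: mG.
apply/seteqP; split => q /=; first by move=> h; exists (Num.truncn (q.1 * m.+1%:R)).
by move=> [k _ [<-]].
Qed.

(* Continuity in time with values in L^1 makes the Duhamel integrand jointly measurable, although u itself need not be. *)
Lemma measurable_duhk_cts a g c B : 0 <= c -> (forall s, 0 < s -> hb c B (g s)) ->
  (forall s, 0 < s -> forall e, 0 < e -> exists2 d, 0 < d & forall r, 0 < r -> `|r - s| < d ->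
    (\int[mu n]_y `|g r y - g s y|%:E <= e%:E)%E) ->
  measurable_fun setT (fun q : (R * n.-tuple R) * R => duhk a g q.1.1 (q.2, q.1.2)).
Proof.
move=> c0 hg cg.
apply: (@measurable_fun_cvg _ _ _ _ (fun m (q : (R * n.-tuple R) * R) =>
   duhk a (fun s => g (tstep m s)) q.1.1 (q.2, q.1.2))).
  move=> m; apply: measurable_if_itv => /=; [exact: measurable_snd|exact: (measurableT_comp (f := fst))|].
  have jg := @jm_tstep m g (fun s hs => hb_meas (hg s hs)).
  apply: (@measurable_cnv_Dk R n a _ _ (fun q : (R * n.-tuple R) * R => q.1.1 - q.2)
    (fun q => q.1.2) (fun q => g (tstep m q.2))).
  - by apply: measurable_funB => //; exact: measurableT_comp.
  - exact: measurableT_comp.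
  - apply: (@measurableT_comp _ _ _ _ _ _ (fun q : R * n.-tuple R => g (tstep m q.1) q.2) _
      (fun q : ((R * n.-tuple R) * R) * n.-tuple R => (q.1.2, q.2))) => //.
    by apply: measurable_fun_pair => //; exact: measurableT_comp.
(* Pointwise convergence: continuity in L^1 is tested against the bounded kernel [Dk a (t - s)]. *)
move=> [[t x] s] _ /=; rewrite /duhk /=; case: ifPn => [/andP[s0 st]|_]; last exact: cvg_cst.
have ts : 0 < t - s by rewrite subr_gt0.
apply/cvgrPdist_le => e e0.
have hD := hb_Dk a ts; set K := _ * _ in hD.
have K0 : 0 <= K * cc n (t - s) by rewrite mulr_ge0 ?cc_ge0// (hb_ge0 hD).
have e1 : 0 < e / (K * cc n (t - s) + 1) by rewrite divr_gt0// ltr_wpDl.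
have [d d0 hd] := cg s s0 _ e1.
near=> m.
have md : m.+1%:R^-1 < d.
  rewrite invf_plt ?posrE//; apply: lt_trans (_ : m%:R < _); last by rewrite ltr_nat.
  by near: m; exact: nbhs_infty_gtr.
have {}hd := hd (tstep m s) (tstep_gt0 m s) (le_lt_trans (tstep_dist m (ltW s0)) md).
have h1 := hg _ s0; have h2 := hg _ (tstep_gt0 m s).
rewrite distrC -(cnvBr x hD (hb_l1 h2) (hb_l1 h1)).
have hl : l1 (e / (K * cc n (t - s) + 1)) (fun y => g (tstep m s) y - g s y).
  by split => //; apply: measurable_funB; [exact: hb_meas h2|exact: hb_meas h1].
apply: le_trans (Rintegral_l1_le (cnv_integrand_l1 x hD hl)) _.
rewrite mulrCA ler_piMr ?(ltW e0)// ler_pdivrMr ?mul1r ?lerDl// ltr_wpDl//.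
Unshelve. all: by end_near. Qed.

End TimeSteps.

(** * A regular representative of the solution *)

Section MildSolution.
Context {R : realType} {n : nat}.
Notation leb := (@lebesgue_measure R).
Implicit Types (x y a : n.-tuple R) (t s M : R) (v : R -> n.-tuple R -> R).

(* The solution u is determined only up to null sets at each time; v stands for a jointly measurable representative
   that is bounded everywhere and satisfies the integral equation at every point. *)
Definition mild a p u0 M v := [/\ 1 < p, jm v, forall s, hb 1 M (v s), hb 1 M u0 &
  forall t x, 0 < t -> v t x = cnv (gauss t) u0 x + duh a (fun s y => fnl p (v s y)) t x].

Lemma mild_fnl a p u0 M v s : mild a p u0 M v -> hb 1 (M `^ (p - 1) * M) (fun y => fnl p (v s y)).
Proof. by case=> p1 _ hv _ _; have := hb_fnl p1 ler01 (hv s); rewrite mulr1. Qed.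

Lemma duhamel_restart a g B (u0 : n.-tuple R -> R) N t0 t x : hb 1 N u0 -> jm g ->
  (forall s, hb 1 B (g s)) -> 0 < t0 -> 0 < t ->
  cnv (gauss (t0 + t)) u0 x + duh a g (t0 + t) x =
  cnv (gauss t) (fun y => cnv (gauss t0) u0 y + duh a g t0 y) x + duh a (fun s => g (t0 + s)) t x.
Proof.
move=> h0 mg hg t00 t1; rewrite (duh_restart a x ler01 mg hg t00 t1) addrA; congr (_ + _).
have hG := @hb_gauss R n _ t1; have hG0 := @hb_gauss R n _ t00.
have [_ hd] := duh_hb1 a ler01 t00 mg (fun s _ _ => hg s).
have hc := cnv_hb_r ler01 (hb_l1 hG0) h0.
rewrite (cnvDr x hG (hb_l1 hc) (hb_l1 hd)); congr (_ + _).
rewrite (cnvA (@cc_ge0 R n t0) hG hG0 (hb_l1 h0)) (cnv_gauss_gauss t1 t00).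
by rewrite addrC.
Qed.

Lemma mild_restart a p u0 M v t0 t x : mild a p u0 M v -> 0 < t0 -> 0 < t ->
  v (t0 + t) x = cnv (gauss t) (v t0) x + duh a (fun s y => fnl p (v (t0 + s) y)) t x.
Proof.
move=> hm t00 t1; have [p1 mv hv h0 E] := hm.
have -> : v t0 = (fun y => cnv (gauss t0) u0 y + duh a (fun s y => fnl p (v s y)) t0 y).
  by apply/funext => y; exact: E.
rewrite (E _ _ (addr_gt0 t00 t1)).
exact: (duhamel_restart a x h0 (jm_fnl p mv) (fun s => mild_fnl s hm) t00 t1).
Qed.

(** Connects the Duhamel term of the statement, with its derivative of a heat flow, to [duh]. The
    bounds depend on [s] to admit the Gaussian profile, whose supremum blows up at time zero;
    measurability in [s] is left to the caller, since for the solution it comes from continuity in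
    time. *)
Lemma duhamel_duh a p (u ub : R -> n.-tuple R -> R) (c B : R -> R) t x : 0 < t -> 1 < p ->
  (forall s, 0 < s -> [/\ measurable_fun setT (u s), 0 <= c s, hb (c s) (B s) (ub s) & eqae (mu n) (u s) (ub s)]) ->
  measurable_fun setT (fun s => duhk a (fun s y => fnl p (ub s y)) t (s, x)) ->
  duhamel a (fnl p) u t x = duh a (fun s y => fnl p (ub s y)) t x.
Proof.
move=> t0 p1 H md; rewrite /duhamel.
have E s : (if 0 < s < t then dirder a (heat (t - s) (fun y => fnl p (u s y))) x else 0) =
    duhk a (fun s y => fnl p (ub s y)) t (s, x).
  rewrite /duhk /=; case: ifPn => // /andP[s0 st].
  have [mu' cs0 hub e] := H s s0; have ts : 0 < t - s by rewrite subr_gt0.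
  have mfu : measurable_fun setT (fun y => fnl p (u s y)) by exact: measurable_fnl.
  have mub := hb_meas hub; have hfb := hb_fnl p1 cs0 hub.
  have mfb := hb_meas hfb.
  have e' : eqae (mu n) (fun y => fnl p (u s y)) (fun y => fnl p (ub s y)).
    by apply: (eqae_dom mu' mub mfu mfb _ e) => y ->.
  have lfu : l1 ((B s * c s) `^ (p - 1) * B s) (fun y => fnl p (u s y)).
    split => //; have [_ h _] := hfb; apply: le_trans h.
    rewrite le_eqVlt; apply/orP; left; apply/eqP; apply: integral_eqae; try exact: measurable_norm.
    by apply: (eqae_dom mfu mfb _ _ _ e') => [||y ->]//; exact: measurable_norm.
  rewrite (dirder_heat a x ts lfu); apply: cnv_eqae => //; exact: measurable_Dk1.
rewrite Rintegral_itv_if.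
  by apply: eq_Rintegral => s _; exact: E.
by rewrite (_ : (fun s => _) = (fun s => duhk a (fun s y => fnl p (ub s y)) t (s, x)))//; apply/funext.
Qed.

(** Bounded, jointly measurable and satisfying the equation pointwise are three demands that no
    single modification of [u] meets at once; they are secured one after the other by [ub], [vt],
    [w] and [v]. *)
Lemma global_solution_mild a p (u0 : n.-tuple R -> R) (u : R -> n.-tuple R -> R) : 1 < p ->
  measurable_fun setT u0 -> (Lqnorm 1%:E u0 < +oo)%E -> (Lqnorm +oo u0 < +oo)%E ->
  global_solution a (fnl p) u0 u ->
  exists M u0b v, [/\ mild a p u0b M v, eqae (mu n) u0 u0b &
    forall t, 0 < t -> eqae (mu n) (u t) (v t)].
Proof.
move=> p1 mu0 l0 s0 [Hm [Hc [[M1 HM1] [_ [_ [[M2 HM2] HE]]]]]].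
have m1 t : 0 <= t -> measurable_fun setT (u t) by move=> /Hm[].
have ess_ge0 (g : n.-tuple R -> R) N : measurable_fun setT g -> (Lqnorm +oo g <= N%:E)%E -> (Lqnorm +oo g <= `|N|%:E)%E.
  by move=> _ h; apply: le_trans h _; rewrite lee_fin ler_norm.
have [M0 hM0] : exists M0 : R, (Lqnorm +oo u0 <= M0%:E)%E.
  case: (Lqnorm +oo u0) s0 => [r| |] // _; first by exists r.
  by exists 0; rewrite leNye.
have [L0 hL0] : exists L0 : R, (Lqnorm 1%:E u0 <= L0%:E)%E.
  case: (Lqnorm 1%:E u0) l0 => [r| |] // _; first by exists r.
  by exists 0; rewrite leNye.
(* The final [1] is the room that [ess_sup_clip] asks for. *)
pose M := `|M0| + `|L0| + `|M1| + `|M2| + 1.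
have [nM0 nL0 nM1 nM2] : [/\ `|M0| + 1 <= M, `|L0| <= M, `|M1| <= M & `|M2| + 1 <= M].
  have := normr_ge0 M0; have := normr_ge0 L0; have := normr_ge0 M1; have := normr_ge0 M2.
  by rewrite /M; split; lra.
have Mp : 0 <= M by apply: le_trans nL0.
have cl (g : n.-tuple R -> R) N : measurable_fun setT g -> (Lqnorm +oo g <= N%:E)%E -> `|N| + 1 <= M ->
    eqae (mu n) g (fun x => clip M (g x)).
  move=> mg hN NM; have h := ess_sup_clip mg (normr_ge0 N) (ess_ge0 _ _ mg hN).
  apply: (eqae_dom mg (measurable_clip _ mg) mg (measurable_clip _ mg) _ h) => y e.
  rewrite clip_id// e; apply: le_trans NM; apply: clip_le; exact: addr_ge0.
pose u0b x := clip M (u0 x).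
have e0 : eqae (mu n) u0 u0b by exact: cl hM0 nM0.
have l10 : l1 `|L0| u0.
  by split => //; rewrite -(Lq1E mu0); apply: le_trans hL0 _; rewrite lee_fin ler_norm.
have h0 : hb 1 M u0b.
  by apply: (hb_eqae ler01 l10 (measurable_clip _ mu0) e0 nL0) => x; rewrite mulr1 clip_le.
(* Bounded everywhere, but joint measurability is not known for it. *)
pose ub s y := clip M (u s y).
have lu t : 0 <= t -> l1 `|M1| (u t).
  move=> t0; split; first exact: m1; rewrite -(Lq1E (m1 _ t0)).
  by apply: le_trans (HM1 _ t0) _; rewrite lee_fin ler_norm.
have eu t : 0 < t -> eqae (mu n) (u t) (ub t).
  by move=> t0; exact: (cl _ _ (m1 _ (ltW t0)) (HM2 _ t0) nM2).
have hub t : 0 < t -> hb 1 M (ub t).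
  move=> t0; apply: (hb_eqae ler01 (lu _ (ltW t0)) (measurable_clip _ (m1 _ (ltW t0))) (eu _ t0) nM1) => x.
  by rewrite mulr1 clip_le.
pose B := (M * 1) `^ (p - 1) * M.
have hfb t : 0 < t -> hb 1 B (fun y => fnl p (ub t y)) by move=> t0; exact: hb_fnl p1 ler01 (hub t t0).
pose Lp := p * M `^ (p - 1) + 1.
have Lp0 : 0 < Lp by rewrite /Lp ltr_wpDl// mulr_ge0 ?powR_ge0// ltW// (lt_trans ltr01).
(* Continuity of [u] in L^1 passes to the flux, since [clip] is Lipschitz and so is [fnl p] on the
   clipped range. *)
have cts s : 0 < s -> forall e, 0 < e -> exists2 d, 0 < d & forall r, 0 < r -> `|r - s| < d ->
    (\int[mu n]_y `|fnl p (ub r y) - fnl p (ub s y)|%:E <= e%:E)%E.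
  move=> hs e e1; have [d d0 hd] := Hc s (ltW hs) (e / Lp) (divr_gt0 e1 Lp0).
  exists d => // r r0 rd; have {}hd := hd r (ltW r0) rd.
  have mr := m1 _ (ltW r0); have ms := m1 _ (ltW hs).
  have lrs : l1 (e / Lp) (fun y => u r y - u s y).
    split; first exact: measurable_funB.
    by rewrite -(Lq1E (measurable_funB mr ms)) ltW.
  have := l1Z Lp lrs; rewrite (gtr0_norm Lp0) mulrC divfK ?gt_eqF// => lz.
  have [] := @l1_mono R n e e (fun y => fnl p (ub r y) - fnl p (ub s y)) _ lz _ _ (lexx e) => //.
    by apply: measurable_funB; [exact: hb_meas (hfb _ r0)|exact: hb_meas (hfb _ hs)].
  move=> y; apply: le_trans (fnl_lip p1 (clip_le _ Mp) (clip_le _ Mp)) _.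
  rewrite [leRHS]normrM (gtr0_norm Lp0); apply: ler_pM => //; last exact: clip_lip.
    by apply: mulr_ge0; [exact: ltW (lt_trans ltr01 p1)|exact: powR_ge0].
  by rewrite /Lp lerDl.
have md := measurable_duhk_cts a ler01 hfb cts.
have mdt t x : measurable_fun setT (fun s => duhk a (fun s y => fnl p (ub s y)) t (s, x)).
  apply: (@measurableT_comp _ _ _ _ _ _ (fun q : (R * n.-tuple R) * R =>
    duhk a (fun s y => fnl p (ub s y)) q.1.1 (q.2, q.1.2)) _ (fun s : R => ((t, x), s))) => //.
  exact: measurable_fun_pair.
(* The right-hand side of the equation evaluated on [ub]: jointly measurable, and equal to [u t] off
   a null set for each [t > 0]. *)
pose vt t x := cnv (gauss t) u0b x + duh a (fun s y => fnl p (ub s y)) t x.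
(* Clipped again, because a pointwise bound for [vt] is derived only below, with the help of [w].
   The value [0] at nonpositive times is a default. *)
pose w s x := if 0 < s then clip M (vt s x) else 0.
have jvt : jm vt.
  apply: measurable_funD.
    apply: (@measurable_Rintegral _ _ _ (R * n.-tuple R)%type _ (mu n) (fun q : (R * n.-tuple R) * n.-tuple R =>
      gauss q.1.1 (vsub q.1.2 q.2) * u0b q.2)).
    apply: measurable_funM; last by apply: measurableT_comp => //; exact: hb_meas h0.
    apply: measurable_gauss; first exact: measurableT_comp.
    by apply: measurable_vsub => //; exact: measurableT_comp.
  exact: (@measurable_Rintegral _ _ _ (R * n.-tuple R)%type _ leb (fun q => duhk a (fun s y => fnl p (ub s y)) q.1.1 (q.2, q.1.2))).
have evt t : 0 < t -> eqae (mu n) (u t) (vt t).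
  move=> t0; have mvt : measurable_fun setT (vt t) by exact: jm1.
  have HEt := HE t t0.
  rewrite (_ : (fun x => _) = vt t) in HEt; first exact: (ae_eqP (m1 _ (ltW t0)) mvt HEt).
  apply/funext => x; rewrite /vt (heat_cnv x t0 l10); congr (_ + _).
    apply: cnv_eqae => //; [exact: measurable_gauss1|exact: hb_meas h0].
  apply: (@duhamel_duh a p u ub (fun=> 1) (fun=> M) t x t0 p1 _ (mdt t x)) => s hs.
  by split; [exact: m1 (ltW hs)|exact: ler01|exact: hub|exact: eu].
have jw : jm w.
  apply: measurable_fun_ifT => //=; last exact: measurable_clip.
  by apply: measurable_fun_ltr => //; exact: measurable_cst.
have ew t : 0 < t -> eqae (mu n) (u t) (w t).
  move=> t0; have mvt : measurable_fun setT (vt t) by exact: jm1.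
  have mc := measurable_clip M (m1 _ (ltW t0)); have mcv := measurable_clip M mvt.
  rewrite /w t0; apply: (eqae_trans (m1 _ (ltW t0)) mc mcv (eu _ t0)).
  by apply: (eqae_dom (m1 _ (ltW t0)) mvt mc mcv _ (evt _ t0)) => y ->.
have hw t : hb 1 M (w t).
  have [t0|t0] := ltP 0 t.
    apply: (hb_eqae ler01 (lu _ (ltW t0)) (jm1 _ jw) (ew _ t0) nM1) => x.
    by rewrite /w t0 mulr1 clip_le.
  rewrite /w ltNge t0 /=; exact: hb_le (hb_0 1) ler01 Mp.
have hfw t : hb 1 B (fun y => fnl p (w t y)) by exact: hb_fnl p1 ler01 (hw t).
have jfw := jm_fnl p jw.
(* Replacing [ub] by [w] changes the flux on null sets only, hence the Duhamel term at no point. *)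
have Ev t x : 0 < t -> vt t x = cnv (gauss t) u0b x + duh a (fun s y => fnl p (w s y)) t x.
  move=> t0; congr (_ + _); apply: eq_Rintegral => s _; rewrite /duhk /=; case: ifPn => // /andP[hs st].
  apply: cnv_eqae; [exact: measurable_Dk1|exact: hb_meas (hfb _ hs)|exact: hb_meas (hfw s)|].
  apply: (eqae_dom (hb_meas (hub _ hs)) (hb_meas (hw s)) (hb_meas (hfb _ hs)) (hb_meas (hfw s)) _ _).
    by move=> y /= ->.
  exact: (eqae_trans (hb_meas (hub _ hs)) (m1 _ (ltW hs)) (hb_meas (hw s)) (eqae_sym (eu _ hs)) (ew _ hs)).
have small t : 0 < t -> t <= 1 -> hb 1 (2 * CD a * B) (duh a (fun s y => fnl p (w s y)) t).
  move=> t0 t1; have [_ h] := duh_hb1 a ler01 t0 jfw (fun s _ _ => hfw s).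
  apply: (hb_le h ler01); apply: ler_wpM2r; first exact: hb_ge0 (hfw 0).
  rewrite -[leRHS]mulr1; apply: ler_wpM2l; first exact: mulr_ge0 (ler0n _ 2) (CD_ge0 a).
  by have := powR_mono (_ : 0 <= 1 / 2 :> R) (ltW t0) t1; rewrite powR1; apply; lra.
(* For [t > 1] the equation is restarted at [t - 1], so that the Duhamel term covers one unit of
   time and the bound does not grow with [t]. *)
have bd t : 0 < t -> hb 1 (M + 2 * CD a * B) (vt t).
  move=> t0; have [t1|t1] := leP t 1.
    have -> : vt t = (fun x => cnv (gauss t) u0b x + duh a (fun s y => fnl p (w s y)) t x).
      by apply/funext => x; exact: Ev.
    apply: hbD; last exact: small.
    by rewrite -(mul1r M); apply: cnv_hb_r => //; exact: hb_l1 (@hb_gauss R n _ t0).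
  have t10 : 0 < t - 1 by rewrite subr_gt0.
  have jws := jm_shift (t - 1) jfw.
  have [_ hd] := duh_hb1 a ler01 (ltr01 : 0 < 1 :> R) jws (fun s _ _ => hfw (t - 1 + s)).
  rewrite powR1 mulr1 in hd.
  have hG := @hb_gauss R n _ (ltr01 : 0 < 1 :> R).
  have -> : vt t = (fun x => cnv (gauss 1) (w (t - 1)) x + duh a (fun s y => fnl p (w (t - 1 + s) y)) 1 x).
    apply/funext => x; apply: etrans (Ev t x t0) _.
    have := duhamel_restart a x h0 jfw hfw t10 ltr01; rewrite subrK => ->; congr (_ + _).
    have -> : (fun y => cnv (gauss (t - 1)) u0b y + duh a (fun s y => fnl p (w s y)) (t - 1) y) = vt (t - 1).
      by apply/funext => y; exact: esym (Ev _ y t10).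
    apply: cnv_eqae; [exact: measurable_gauss1|exact: jm1|exact: hb_meas (hw (t - 1))|].
    exact: (eqae_trans (jm1 _ jvt) (m1 _ (ltW t10)) (hb_meas (hw (t - 1))) (eqae_sym (evt _ t10)) (ew _ t10)).
  by apply: hbD => //; rewrite -(mul1r M); apply: cnv_hb_r => //; exact: hb_l1 hG.
(* Now [vt] itself, unclipped, meets all three demands. *)
pose v s x := if 0 < s then vt s x else 0.
have B0 : 0 <= B := hb_ge0 (hfw 0).
have MB : M <= M + 2 * CD a * B.
  by rewrite lerDl; exact: mulr_ge0 (mulr_ge0 (ler0n _ 2) (CD_ge0 a)) B0.
have vE s : 0 < s -> v s = vt s by move=> hs; apply/funext => y; rewrite /v hs.
have jv : jm v.
  by apply: measurable_fun_ifT => //=; apply: measurable_fun_ltr => //; exact: measurable_cst.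
exists (M + 2 * CD a * B), u0b, v.
split; [split|exact: e0|by move=> t t0; rewrite (vE t t0); exact: evt].
- exact: p1.
- exact: jv.
- move=> s; have [hs|hs] := ltP 0 s; first by rewrite (vE s hs); exact: bd.
  by rewrite /v ltNge hs /=; apply: (hb_le (hb_0 1) ler01); exact: le_trans Mp MB.
- exact: hb_le h0 ler01 MB.
- move=> t x t0.
  have jfv : jm (fun s y => fnl p (v s y)) := jm_fnl p jv.
  have ewv s : 0 < s -> s < t -> eqae (mu n) (fun y => fnl p (w s y)) (fun y => fnl p (v s y)).
    move=> hs _; rewrite (vE s hs); have mv := jm1 s jvt.
    apply: (eqae_dom (hb_meas (hw s)) mv (hb_meas (hfw s)) (measurable_fnl p mv)); first by move=> y /= ->.
    exact: (eqae_trans (hb_meas (hw s)) (m1 _ (ltW hs)) mv (eqae_sym (ew _ hs)) (evt _ hs)).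
  rewrite (vE t t0); apply: etrans (Ev t x t0) _.
  exact: (congr1 (fun r => cnv (gauss t) u0b x + r) (duh_eqae a x jfw jfv ewv)).
Qed.

End MildSolution.

(** * Hoelder continuity of the solution in space and time *)

Section Moduli.
Context {R : realType} {n : nat}.
Notation leb := (@lebesgue_measure R).
Implicit Types (x y z a : n.-tuple R) (t s h c M N A : R) (g : n.-tuple R -> R).

Lemma cnv_shift_diff c N A (k g : n.-tuple R -> R) x y : hb c N k -> l1 A g ->
  cnv k g (vsub x y) - cnv k g x = cnv (fun z => k (vsub z y) - k z) g x.
Proof.
move=> hk hg; rewrite /cnv -(RintegralB measurableT (cnv_integrable (vsub x y) hk hg) (cnv_integrable x hk hg)).
apply: eq_Rintegral => z _; rewrite mulrBl; congr (k _ * _ - _).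
by apply: eq_from_tnth => i; rewrite !tnth_mktuple; ring.
Qed.

Lemma kb_cnv_shift K e k th t y c N g : 0 <= c -> 0 <= K -> kb K e k -> 0 <= th -> th <= 1 -> 0 < t ->
  hb c N g ->
  hb c (K * t `^ (- (e + th / 2)) * nrm y `^ th * N) (fun x => cnv (k t) g (vsub x y) - cnv (k t) g x).
Proof.
move=> c0 K0 hk h0 h1 t0 hg; have hd := kb_holder y K0 hk h0 h1 t0.
have [hkt _] := hk t t0.
under eq_fun do rewrite (cnv_shift_diff _ _ hkt (hb_l1 hg)).
exact: cnv_hb_r c0 (hb_l1 hd) hg.
Qed.

Lemma measurable_nrm_powR th : measurable_fun setT (fun z : n.-tuple R => nrm z `^ th).
Proof. by apply: measurable_powRs; apply: measurable_nrm; exact: measurable_id. Qed.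

(** Minkowski over [z] of [k z] times the increment of [g] by [z]. It serves [gauss], of mass one,
    to compare the flow with [g], and [Dk], of mass zero, to gain a power of time. *)
Lemma cnv_modulus c N C A th (k g : n.-tuple R -> R) : 0 <= c -> 0 <= C -> hb c N g ->
  (forall y, hb c (C * nrm y `^ th) (fun x => g (vsub x y) - g x)) ->
  (mu n).-integrable setT (EFin \o k) ->
  (\int[mu n]_z (nrm z `^ th * `|k z|)%:E <= A%:E)%E ->
  hb c (C * A) (fun x => cnv k g x - (\int[mu n]_z k z) * g x).
Proof.
move=> c0 C0 hg hm ik hA; have mg := hb_meas hg.
have mk : measurable_fun setT k by apply/measurable_EFinP; case/integrableP: ik.
pose F (p : n.-tuple R * n.-tuple R) := k p.1 * (g (vsub p.2 p.1) - g p.2).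
have mF : measurable_fun setT F.
  apply: measurable_funM; first exact: measurableT_comp.
  by apply: measurable_funB; [apply: measurableT_comp => //; exact: measurable_vsub|exact: measurableT_comp].
have mb : measurable_fun setT (fun z : n.-tuple R => C * (nrm z `^ th * `|k z|)).
  by apply: measurable_funM => //; apply: measurable_funM; [exact: measurable_nrm_powR|exact: measurable_norm].
have [iF hF] : (forall x, (mu n).-integrable setT (fun z => (F (z, x))%:E)) /\
    hb c (C * A) (fun x => \int[mu n]_z F (z, x)).
  apply: (hb_integral c0 mF mb).
    move=> z; have := hbZ (k z) (hm z); rewrite /F /=.
    by rewrite (_ : `|k z| * _ = C * (nrm z `^ th * `|k z|)); last by ring.
  rewrite integralZl_EFin//.
  - by rewrite EFinM lee_wpmul2l// lee_fin.
  - by apply: measurable_funM; [exact: measurable_nrm_powR|exact: measurable_norm].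
  - by move=> z; rewrite mulr_ge0 ?powR_ge0.
rewrite (_ : (fun x => _) = (fun x => \int[mu n]_z F (z, x))) => //; apply/funext => x.
have lk : l1 (fine (\int[mu n]_z `|k z|%:E)) k.
  split => //; rewrite fineK//; have := integrable_abse ik => /(integrable_fin_num measurableT).
  by [].
have i1 : (mu n).-integrable setT (fun z => (g (vsub x z) * k z)%:E) := cnv_integrable x hg lk.
have i2 : (mu n).-integrable setT (fun z => (g x * k z)%:E).
  have := integrableZl measurableT (g x) ik.
  by apply: eq_integrable => // z _; rewrite /= EFinM.
rewrite (cnvC mk mg) /cnv mulrC -(RintegralZl (g x) measurableT ik) -(RintegralB measurableT i1 i2).
by apply: eq_Rintegral => z _; rewrite /F /=; ring.
Qed.

Lemma moment_gauss th t : 0 <= th -> th <= 1 -> 0 < t ->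
  (\int[mu n]_z (nrm z `^ th * `|gauss t z|)%:E <= (3 * cG n * t `^ (th / 2))%:E)%E.
Proof.
move=> h0 h1 t0; have t20 : 0 < 2 * t by rewrite mulr_gt0.
have c0 : 0 <= cG n :> R := le_trans ler01 (@cG_ge1 R n).
have K0 : 0 <= 3 * cG n * t `^ (th / 2) := mulr_ge0 (mulr_ge0 (ler0n _ 3) c0) (powR_ge0 _ _).
apply: (@le_trans _ _ (\int[mu n]_z (3 * cG n * t `^ (th / 2) * gauss (2 * t) z)%:E)%E).
  apply: le_integral_EFin.
  - by apply: measurable_funM; [exact: measurable_nrm_powR|apply: measurable_norm; exact: measurable_gauss1].
  - by apply: measurable_funM => //; exact: measurable_gauss1.
  - by move=> z; rewrite mulr_ge0 ?powR_ge0.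
  - by move=> z; rewrite ger0_norm ?gauss_ge0// nrm_powR_gauss_le.
rewrite integralZl_EFin//; [|exact: measurable_gauss1|by move=> z; exact: gauss_ge0].
by rewrite integral_gauss// mule1.
Qed.

Definition CM a : R := 3 * nrm a * cG n ^+ 2 * 2.

Lemma CM_ge0 a : 0 <= CM a.
Proof.
have c0 : 0 <= cG n :> R := le_trans ler01 (@cG_ge1 R n).
exact: mulr_ge0 (mulr_ge0 (mulr_ge0 (ler0n _ 3) (nrm_ge0 a)) (exprn_ge0 2 c0)) (ler0n _ 2).
Qed.

Lemma moment_Dk a th t : 0 <= th -> th <= 1 -> 0 < t ->
  (\int[mu n]_z (nrm z `^ th * `|Dk a t z|)%:E <= (CM a * t `^ (- (1 / 2) + th / 2))%:E)%E.
Proof.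
move=> h0 h1 t0; have t20 : 0 < 4 * t by rewrite mulr_gt0.
have K0 : 0 <= CM a * t `^ (- (1 / 2) + th / 2) := mulr_ge0 (CM_ge0 a) (powR_ge0 _ _).
apply: (@le_trans _ _ (\int[mu n]_z (CM a * t `^ (- (1 / 2) + th / 2) * gauss (4 * t) z)%:E)%E).
  apply: le_integral_EFin.
  - by apply: measurable_funM; [exact: measurable_nrm_powR|apply: measurable_norm; exact: measurable_Dk1].
  - by apply: measurable_funM => //; exact: measurable_gauss1.
  - by move=> z; rewrite mulr_ge0 ?powR_ge0.
  - move=> z; apply: le_trans (nrm_powR_Dk_le a z h0 h1 t0) _.
    apply: ler_wpM2r; first exact: gauss_ge0.
    apply: ler_wpM2r; first exact: powR_ge0.
    apply: ler_wpM2l.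
      have c0 : 0 <= cG n :> R := le_trans ler01 (@cG_ge1 R n).
      exact: mulr_ge0 (mulr_ge0 (ler0n _ 3) (nrm_ge0 a)) (exprn_ge0 2 c0).
    by rewrite -[leRHS]powRr1// powR_exp_mono//; lra.
rewrite integralZl_EFin//; [|exact: measurable_gauss1|by move=> z; exact: gauss_ge0].
by rewrite integral_gauss// mule1.
Qed.

Lemma cnv_gauss_modulus c N C th t g : 0 <= c -> 0 <= C -> hb c N g -> 0 <= th -> th <= 1 -> 0 < t ->
  (forall y, hb c (C * nrm y `^ th) (fun x => g (vsub x y) - g x)) ->
  hb c (C * (3 * cG n * t `^ (th / 2))) (fun x => cnv (gauss t) g x - g x).
Proof.
move=> c0 C0 hg h0 h1 t0 hm; have := cnv_modulus c0 C0 hg hm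
  (l1_integrable (hb_l1 (@hb_gauss R n _ t0))) (moment_gauss h0 h1 t0).
by rewrite Rintegral_gauss//; under eq_fun do rewrite mul1r.
Qed.

Lemma cnv_Dk_modulus a c N C th t g : 0 <= c -> 0 <= C -> hb c N g -> 0 <= th -> th <= 1 -> 0 < t ->
  (forall y, hb c (C * nrm y `^ th) (fun x => g (vsub x y) - g x)) ->
  hb c (C * (CM a * t `^ (- (1 / 2) + th / 2))) (cnv (Dk a t) g).
Proof.
move=> c0 C0 hg h0 h1 t0 hm; have := cnv_modulus c0 C0 hg hm
  (l1_integrable (hb_l1 (hb_Dk a t0))) (moment_Dk a h0 h1 t0).
by rewrite Rintegral_Dk//; under eq_fun do rewrite mul0r subr0.
Qed.

Lemma hb_shiftD c N A (f g h : n.-tuple R -> R) y : (forall z, f z = g z + h z) ->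
  hb c N (fun x => g (vsub x y) - g x) -> hb c A (fun x => h (vsub x y) - h x) ->
  hb c (N + A) (fun x => f (vsub x y) - f x).
Proof.
move=> E hg hh; have := hbD hg hh; congr (hb _ _ _).
by apply/funext => x; rewrite !E; ring.
Qed.

Lemma hb_fnl_diff p c m N (g1 g2 : n.-tuple R -> R) : 1 < p -> 0 <= c ->
  measurable_fun setT g1 -> measurable_fun setT g2 ->
  (forall x, `|g1 x| <= m) -> (forall x, `|g2 x| <= m) ->
  hb c N (fun x => g1 x - g2 x) ->
  hb c (p * m `^ (p - 1) * N) (fun x => fnl p (g1 x) - fnl p (g2 x)).
Proof.
move=> p1 c0 m1 m2 b1 b2 hd.
have K0 : 0 <= p * m `^ (p - 1) := mulr_ge0 (ltW (lt_trans ltr01 p1)) (powR_ge0 _ _).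
rewrite -{1}(ger0_norm K0); apply: (hb_domZ hd) => //.
  by apply: measurable_funB; exact: measurable_fnl.
by move=> x; exact: fnl_lip.
Qed.

Variables (a : n.-tuple R) (p M : R) (u0 : n.-tuple R -> R) (v : R -> n.-tuple R -> R).
Hypothesis hm : mild a p u0 M v.

Let p1 : 1 < p. Proof. by case: hm. Qed.
Let hv s : hb 1 M (v s). Proof. by case: hm. Qed.
Let jv : jm v. Proof. by case: hm. Qed.
Let hf s : hb 1 (M `^ (p - 1) * M) (fun y => fnl p (v s y)). Proof. exact: mild_fnl hm. Qed.

Lemma mild_restart_fun t h : 0 < t -> 0 < h -> v (t + h) = fun x =>
  cnv (gauss h) (v t) x + duh a (fun s y => fnl p (v (t + s) y)) h x.
Proof. by move=> t0 h0; apply/funext => x; exact: mild_restart hm t0 h0. Qed.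

(** Restarted at [t - 1], the increments of the kernel of order [3/4] cost [(1 - s)^(-7/8)] in the
    Duhamel term, still integrable with integral [8]; order one would not be. *)
Lemma mild_holder_space : exists2 C : R, 0 <= C & forall t, 1 < t -> forall y,
  hb 1 (C * nrm y `^ (3 / 4)) (fun x => v t (vsub x y) - v t x).
Proof.
pose B := M `^ (p - 1) * M; have hfB s : hb 1 B (fun y => fnl p (v s y)) := hf s.
have M0 := hb_ge0 (hv 0); have B0 : 0 <= B := hb_ge0 (hfB 0).
have c0 : 0 <= cG n :> R := le_trans ler01 (@cG_ge1 R n).
have C1 : 0 <= 4 * cG n * M := mulr_ge0 (mulr_ge0 (ler0n _ 4) c0) M0.
have C2 : 0 <= 8 * (CD a * B) := mulr_ge0 (ler0n _ 8) (mulr_ge0 (CD_ge0 a) B0).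
exists (4 * cG n * M + 8 * (CD a * B)); first exact: addr_ge0.
move=> t t1 y; have t10 : 0 < t - 1 by rewrite subr_gt0.
have h34 : 0 <= 3 / 4 :> R by lra.
have h34' : 3 / 4 <= 1 :> R by lra.
pose g s z := fnl p (v (t - 1 + s) z).
have mg : jm g by apply: (@jm_shift R n (fun s y => fnl p (v s y))); exact: jm_fnl jv.
have hg s : hb 1 B (g s) by exact: hfB.
have [ig hd] := duh_hb1 a ler01 (ltr01 : 0 < 1 :> R) mg (fun s _ _ => hg s).
have E z : v t z = cnv (gauss 1) (v (t - 1)) z + duh a g 1 z.
  by have := mild_restart z hm t10 (ltr01 : 0 < 1 :> R); rewrite subrK.
have hG := kb_cnv_shift y ler01 (mulr_ge0 (ler0n _ 4) c0) (@gauss_kb R n) h34 h34' (ltr01 : 0 < 1 :> R) (hv (t - 1)).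
have hD : hb 1 (8 * (CD a * B) * nrm y `^ (3 / 4)) (fun x => duh a g 1 (vsub x y) - duh a g 1 x).
  pose b s := if 0 < s < 1 then CD a * nrm y `^ (3 / 4) * B * (1 - s) `^ (- (7 / 8)) else 0.
  pose F (q : R * n.-tuple R) := duhk a g 1 (q.1, vsub q.2 y) - duhk a g 1 q.
  have md := measurable_duhk a 1 mg.
  have mp : measurable_fun setT (fun q : R * n.-tuple R => (q.1, vsub q.2 y)).
    by apply: measurable_fun_pair => //; apply: measurable_vsub => //; exact: measurable_cst.
  have mF : measurable_fun setT F := measurable_funB (measurableT_comp md mp) md.
  have K0 : 0 <= CD a * nrm y `^ (3 / 4) * B := mulr_ge0 (mulr_ge0 (CD_ge0 a) (powR_ge0 _ _)) B0.
  have mb : measurable_fun setT b.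
    apply: measurable_if_itv1; apply: measurable_funM => //; apply: measurable_powRs.
    by apply: measurable_funB => //; exact: measurable_cst.
  have [] := @hb_integral R n _ _ leb 1 (8 * (CD a * B) * nrm y `^ (3 / 4)) b F ler01 mF mb.
  - move=> s; rewrite /F /b /duhk /=; case: ifPn => [/andP[s0 s1]|_]; last first.
      by rewrite (_ : (fun x => _) = (fun _ => 0)); [exact: hb_0|apply/funext => x; rewrite subrr].
    have s10 : 0 < 1 - s by rewrite subr_gt0.
    have := kb_cnv_shift y ler01 (CD_ge0 a) (Dk_kb a) h34 h34' s10 (hg s).
    rewrite (_ : - (1 / 2 + 3 / 4 / 2) = - (7 / 8)); last by field.
    by rewrite (mulrAC (CD a)) (mulrAC _ _ B).
  - rewrite /b (@integral_if_refl R 1 (fun s => CD a * nrm y `^ (3 / 4) * B * s `^ (- (7 / 8)))); last 2 first.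
    + by apply: measurable_funM => //; exact: measurable_powR.
    + by move=> s; exact: mulr_ge0 K0 (powR_ge0 _ _).
    rewrite (_ : (fun s => _) = (fun s : R => (CD a * nrm y `^ (3 / 4) * B * (if 0 < s < 1 then s `^ (- (7 / 8)) else 0))%:E)); last first.
      by apply/funext => s; case: ifP => // _; rewrite mulr0.
    rewrite integralZl_EFin//.
    + apply: (@le_trans _ _ ((CD a * nrm y `^ (3 / 4) * B)%:E * (1 `^ (1 - 7 / 8) / (1 - 7 / 8))%:E)%E).
        by apply: lee_wpmul2l; [rewrite lee_fin|apply: integral_powR_le => //; lra].
      by rewrite -EFinM lee_fin powR1 le_eqVlt; apply/orP; left; apply/eqP; field.
    + by apply: measurable_if_itv1; exact: measurable_powR.
    + by move=> s; case: ifP => // _; exact: powR_ge0.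
  - move=> _; rewrite (_ : (fun x => _) = (fun x => duh a g 1 (vsub x y) - duh a g 1 x)) => //.
    by apply/funext => x; rewrite /duh -(RintegralB measurableT (ig (vsub x y)) (ig x)).
rewrite mulrDl; apply: (hb_shiftD E _ hD); apply: (hb_le hG ler01).
by rewrite powR1 mulr1 (mulrAC _ _ M).
Qed.

(** Parabolic scaling halves the spatial exponent for the heat flow; the Duhamel increment is
    [O(h^(1/2))], which is smaller as [h <= 1]. *)
Lemma mild_holder_time : exists2 C : R, 0 <= C & forall t h, 1 < t -> 0 < h -> h <= 1 ->
  hb 1 (C * h `^ (3 / 8)) (fun x => v (t + h) x - v t x).
Proof.
have [C C0 HC] := mild_holder_space.
pose B := M `^ (p - 1) * M; have hfB s : hb 1 B (fun y => fnl p (v s y)) := hf s.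
have B0 : 0 <= B := hb_ge0 (hfB 0).
have c0 : 0 <= cG n :> R := le_trans ler01 (@cG_ge1 R n).
have K1 : 0 <= C * (3 * cG n) := mulr_ge0 C0 (mulr_ge0 (ler0n _ 3) c0).
have K2 : 0 <= 2 * CD a * B := mulr_ge0 (mulr_ge0 (ler0n _ 2) (CD_ge0 a)) B0.
exists (C * (3 * cG n) + 2 * CD a * B); first exact: addr_ge0.
move=> t h t1 h0 h1; have t0 : 0 < t := lt_trans ltr01 t1.
have h34 : 0 <= 3 / 4 :> R by lra.
have h34' : 3 / 4 <= 1 :> R by lra.
have mg : jm (fun s z => fnl p (v (t + s) z)).
  by apply: (@jm_shift R n (fun s y => fnl p (v s y))); exact: jm_fnl jv.
have [_ hd] := duh_hb1 a ler01 h0 mg (fun s _ _ => hfB (t + s)).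
have hG := cnv_gauss_modulus ler01 C0 (hv t) h34 h34' h0 (HC t t1).
rewrite (mild_restart_fun t0 h0).
rewrite (_ : (fun x => _) = (fun x => (cnv (gauss h) (v t) x - v t x) +
  duh a (fun s y => fnl p (v (t + s) y)) h x)); last by apply/funext => x; ring.
rewrite mulrDl; apply: hbD.
  apply: (hb_le hG ler01); rewrite (_ : 3 / 4 / 2 = 3 / 8); last by field.
  by rewrite [leLHS]mulrA.
apply: (hb_le hd ler01); rewrite mulrAC; apply: ler_wpM2l => //.
by apply: powR_exp_anti => //; lra.
Qed.

End Moduli.

(** * The L^2 inner product and the heat flow *)

Section InnerProduct.
Context {R : realType} {n : nat}.
Implicit Types (x y z a : n.-tuple R) (t s h c N A : R) (g k P Q : n.-tuple R -> R).

Definition ip P Q : R := \int[mu n]_x (P x * Q x).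

Lemma ipC P Q : ip P Q = ip Q P.
Proof. by apply: eq_Rintegral => x _; rewrite mulrC. Qed.

Lemma ip_integrable c N A P Q : hb c N P -> l1 A Q -> (mu n).-integrable setT (fun x => (P x * Q x)%:E).
Proof. by move=> hP hQ; exact: l1_integrable (hb_mul_l1 hP hQ). Qed.

Lemma ip_le c N A P Q : hb c N P -> l1 A Q -> `|ip P Q| <= N * c * A.
Proof. by move=> hP hQ; apply: Rintegral_l1_le; exact: hb_mul_l1. Qed.

Lemma ip_ge0 P : 0 <= ip P P.
Proof. by apply: Rintegral_ge0 => x _; rewrite -expr2 sqr_ge0. Qed.

Lemma voppK x : vopp (vopp x) = x.
Proof. by apply: eq_from_tnth => i; rewrite !tnth_mktuple opprK. Qed.

Lemma vopp_vsub0 y : vopp (vsub (vzero n) y) = y.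
Proof. by apply: eq_from_tnth => i; rewrite !tnth_mktuple; ring. Qed.

Lemma ip_cnv P Q : ip P Q = cnv (fun z => P (vopp z)) Q (vzero n).
Proof. by apply: eq_Rintegral => y _; rewrite vopp_vsub0. Qed.

Lemma hb_vopp c N g : hb c N g -> hb c N (fun z => g (vopp z)).
Proof.
move=> hg; have := hb_refl (vzero n) hg; congr (hb _ _ _).
by apply/funext => x; congr (g _); apply: eq_from_tnth => i; rewrite !tnth_mktuple; ring.
Qed.

(** The inner product is a convolution evaluated at the origin, so the adjoint of a convolution
    follows from associativity and commutativity. The sign [e] covers the even heat kernel and the
    odd [Dk]. *)
Lemma ip_cnv_parity e c c' N N' A k P g : (forall z, k (vopp z) = e * k z) -> 0 <= c ->
  hb c N k -> hb c' N' P -> l1 A g -> ip P (cnv k g) = e * ip (cnv k P) g.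
Proof.
move=> ek c0 hk hP hg; have hP' := hb_vopp hP.
have mP := hb_meas hP; have mk := hb_meas hk.
rewrite ip_cnv (cnvA c0 hP' hk hg) (cnvC (hb_meas hP') mk) {1}/cnv.
rewrite -RintegralZl//; last first.
  exact: ip_integrable (cnv_hb c0 hk (hb_l1 hP)) hg.
apply: eq_Rintegral => y _; rewrite mulrA; congr (_ * _).
rewrite -{1}(voppK (vsub _ _)) vopp_vsub0 cnv_vopp//; last exact: hb_meas hP'.
rewrite /cnv -RintegralZl//; last exact: cnv_integrable hk (hb_l1 hP).
by apply: eq_Rintegral => z _; rewrite ek voppK mulrA.
Qed.

Lemma ip_cnv_gauss t c N A P g : 0 < t -> hb c N P -> l1 A g ->
  ip P (cnv (gauss t) g) = ip (cnv (gauss t) P) g.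
Proof.
move=> t0 hP hg; rewrite (@ip_cnv_parity 1 _ _ _ _ _ (gauss t) P g _ (cc_ge0 t) (hb_gauss t0) hP hg) ?mul1r//.
by move=> z; rewrite gauss_vopp mul1r.
Qed.

Lemma ip_cnv_Dk a t c N A P g : 0 < t -> hb c N P -> l1 A g ->
  ip P (cnv (Dk a t) g) = - ip (cnv (Dk a t) P) g.
Proof.
move=> t0 hP hg; rewrite (@ip_cnv_parity (-1) _ _ _ _ _ (Dk a t) P g _ (cc_ge0 t) (hb_Dk a t0) hP hg) ?mulN1r//.
by move=> z; rewrite Dk_vopp mulN1r.
Qed.

Lemma ipDr c N A B P Q g : hb c N P -> l1 A Q -> l1 B g ->
  ip P (fun x => Q x + g x) = ip P Q + ip P g.
Proof.
move=> hP hQ hg; rewrite /ip -(RintegralD measurableT (ip_integrable hP hQ) (ip_integrable hP hg)).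
by apply: eq_Rintegral => x _; rewrite mulrDr.
Qed.

Lemma ip_sqrD c N A P Q : hb c N P -> hb c A Q ->
  ip (fun x => P x + Q x) (fun x => P x + Q x) = ip P P + 2 * ip P Q + ip Q Q.
Proof.
move=> hP hQ; rewrite (ipDr (hbD hP hQ) (hb_l1 hP) (hb_l1 hQ)) !(ipC (fun x => _ + _)).
rewrite (ipDr hP (hb_l1 hP) (hb_l1 hQ)) (ipDr hQ (hb_l1 hP) (hb_l1 hQ)) (ipC Q P); ring.
Qed.

Lemma ip_amgm c N P Q : hb c N P -> hb c N Q -> 2 * ip P Q <= ip P P + ip Q Q.
Proof.
move=> hP hQ; have i1 := ip_integrable hP (hb_l1 hP); have i2 := ip_integrable hP (hb_l1 hQ).
have i3 := ip_integrable hQ (hb_l1 hQ).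
rewrite -(RintegralD measurableT i1 i3) -(RintegralZl 2 measurableT i2).
apply: le_Rintegral => //.
- have := integrableZl measurableT 2 i2.
  by apply: eq_integrable => // x _; rewrite /= EFinM.
- have := integrableD measurableT i1 i3.
  by apply: eq_integrable => // x _; rewrite /= EFinD.
- move=> x _; have := sqr_ge0 (P x - Q x); lra.
Qed.

(** The decrements of a convex sequence decrease, so [K] times the first dominates the total
    drop. *)
Lemma convex_drop (e : nat -> R) (K : nat) : (forall k : nat, 2 * e k.+1 <= e k + e k.+2) ->
  e 0%N - e K <= K%:R * (e 0%N - e 1%N).
Proof.
move=> cvx; have dec (k : nat) : e k - e k.+1 <= e 0%N - e 1%N.
  by elim: k => [//|k IH]; have := cvx k; lra.
elim: K => [|K IH]; first by rewrite mul0r subrr.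
by have := dec K; rewrite -natr1 mulrDl mul1r; lra.
Qed.

Lemma iter_heat h A g (K : nat) : 0 < h -> l1 A g ->
  iter K.+1 (cnv (gauss h)) g = cnv (gauss (K.+1%:R * h)) g.
Proof.
move=> h0 hg; elim: K => [|K IH]; first by rewrite mul1r.
have Kh : 0 < K.+1%:R * h by rewrite mulr_gt0.
rewrite iterS IH (cnvA (cc_ge0 _) (hb_gauss h0) (hb_gauss Kh) hg) (cnv_gauss_gauss h0 Kh).
by congr (cnv (gauss _) g); rewrite -[in RHS]natr1; ring.
Qed.

(* The heat semigroup is self-adjoint, so k |-> |S^k u|^2 is convex and its first step drops by at least the average. *)
Lemma ip_heat_convex h M g (K : nat) : 0 < h -> hb 1 M g ->
  ip g g - cc n (K.+1%:R * h) * M ^+ 2 <=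
  K.+1%:R * (ip g g - ip (cnv (gauss h) g) (cnv (gauss h) g)).
Proof.
move=> h0 hg; have G1 : l1 1 (@gauss R n h) := hb_l1 (hb_gauss h0).
have hw (k : nat) : hb 1 M (iter k (cnv (gauss h)) g).
  by elim: k => [//|k IH] /=; have := cnv_hb_r ler01 G1 IH; rewrite mul1r.
have cvx (k : nat) : 2 * ip (iter k.+1 (cnv (gauss h)) g) (iter k.+1 (cnv (gauss h)) g) <=
    ip (iter k (cnv (gauss h)) g) (iter k (cnv (gauss h)) g) +
    ip (iter k.+2 (cnv (gauss h)) g) (iter k.+2 (cnv (gauss h)) g).
  rewrite [X in 2 * X](_ : _ = ip (iter k.+2 (cnv (gauss h)) g) (iter k (cnv (gauss h)) g)).
    by rewrite ipC; exact: ip_amgm (hw k) (hw k.+2).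
  exact: ip_cnv_gauss h0 (hw k.+1) (hb_l1 (hw k)).
apply: le_trans (@convex_drop (fun k : nat => ip (iter k (cnv (gauss h)) g) (iter k (cnv (gauss h)) g)) K.+1 cvx).
rewrite lerD2l lerN2; have hK : hb (cc n (K.+1%:R * h)) M (iter K.+1 (cnv (gauss h)) g).
  have Kh : 0 < K.+1%:R * h by rewrite mulr_gt0.
  by rewrite (iter_heat K h0 (hb_l1 hg)); have := cnv_hb (cc_ge0 _) (hb_gauss Kh) (hb_l1 hg); rewrite mul1r.
have := ip_le hK (hb_l1 (hw K.+1)); rewrite (ger0_norm (ip_ge0 _)).
by rewrite mulrAC mulrC -expr2.
Qed.

End InnerProduct.

(** * Decay of the energy and smallness at some time *)

Section Energy.
Context {R : realType} {n : nat}.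
Notation leb := (@lebesgue_measure R).
Implicit Types (x y z : n.-tuple R) (t s h c N A : R).
Variables (a : n.-tuple R) (p M : R) (u0 : n.-tuple R -> R) (v : R -> n.-tuple R -> R).
Hypothesis hm : mild a p u0 M v.

Let p1 : 1 < p. Proof. by case: hm. Qed.
Let hv s : hb 1 M (v s). Proof. by case: hm. Qed.
Let jv : jm v. Proof. by case: hm. Qed.
Let hf s : hb 1 (M `^ (p - 1) * M) (fun y => fnl p (v s y)). Proof. exact: mild_fnl hm. Qed.
Let vM s x : `|v s x| <= M. Proof. by have [_ _ /(_ x)] := hv s; rewrite mulr1. Qed.

Lemma integral_refl_powR_le h K b : 0 < h -> 0 <= K -> b < 1 ->
  (\int[leb]_s (if 0 < s < h then K * (h - s) `^ (- b) else 0)%:E <= (K * (h `^ (1 - b) / (1 - b)))%:E)%E.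
Proof.
move=> h0 K0 b1; rewrite (@integral_if_refl R h (fun s => K * s `^ (- b))); last 2 first.
- by apply: measurable_funM => //; exact: measurable_powR.
- by move=> s; exact: mulr_ge0 K0 (powR_ge0 _ _).
rewrite (_ : (fun s => _) = (fun s : R => (K * (if 0 < s < h then s `^ (- b) else 0))%:E)); last first.
  by apply/funext => s; case: ifP => // _; rewrite mulr0.
rewrite integralZl_EFin//.
- by rewrite [leRHS]EFinM; apply: lee_wpmul2l; [rewrite lee_fin|exact: integral_powR_le].
- by apply: measurable_if_itv1; exact: measurable_powR.
- by move=> s; case: ifP => // _; exact: powR_ge0.
Qed.

(** The pairing is moved inside the time integral, where cancellation can be used slice by slice;
    norm bounds of the slices alone would give only [h^(1/2)]. *)
Lemma ip_duh_le P c N g h B K : hb c N P -> 0 < h -> jm g -> (forall s, 0 < s -> s < h -> hb 1 B (g s)) ->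
  (forall s, 0 < s -> s < h -> `|ip P (cnv (Dk a (h - s)) (g s))| <= K) ->
  `|ip P (duh a g h)| <= K * h.
Proof.
move=> hP h0 mg hg hK.
pose b s := if 0 < s < h then CD a * B * (h - s) `^ (- (1 / 2)) else 0.
have h2 : 0 < h / 2 by rewrite divr_gt0.
have h2' : h / 2 < h by rewrite ltr_pdivrMr// ltr_pMr// ltr1n.
have B0 : 0 <= B := hb_ge0 (hg _ h2 h2').
have K0 : 0 <= CD a * B := mulr_ge0 (CD_ge0 a) B0.
have mb : measurable_fun setT b.
  apply: measurable_if_itv1; apply: measurable_funM => //; apply: measurable_powRs.
  by apply: measurable_funB => //; exact: measurable_cst.
have hF s : hb 1 (b s) (fun x => duhk a g h (s, x)).
  rewrite /b /duhk /=; case: ifPn => [/andP[s0 sh]|_]; last exact: hb_0.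
  have := cnv_hb_r ler01 (l1_Dk a (_ : 0 < h - s)) (hg s s0 sh); rewrite subr_gt0 => /(_ sh).
  by rewrite mulrAC.
have hB := integral_refl_powR_le h0 K0 (_ : 1 / 2 < 1 :> R); have := hB _; rewrite -/b => {}hB.
have {}hB : (\int[leb]_s (b s)%:E <= (CD a * B * (h `^ (1 - 1 / 2) / (1 - 1 / 2)))%:E)%E by apply: hB; lra.
have E := @cnv_Rintegral R n _ _ leb 1 c N _ b (duhk a g h) _ (vzero n) ler01 (hb_vopp hP)
  (measurable_duhk a h mg) mb hF hB.
rewrite ip_cnv /duh E => {E}; pose r s := cnv (fun z => P (vopp z)) (fun y => duhk a g h (s, y)) (vzero n).
have rE s : r s = if 0 < s < h then ip P (cnv (Dk a (h - s)) (g s)) else 0.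
  rewrite /r -ip_cnv /duhk /=; case: ifP => // _.
  by rewrite /ip; under eq_Rintegral do rewrite mulr0; rewrite Rintegral_cst// mul0r.
have K1 : 0 <= K by exact: le_trans (normr_ge0 _) (hK _ h2 h2').
have rK s : `|r s| <= K * (if 0 < s < h then s `^ (- 0) else 0).
  rewrite rE; case: ifPn => [/andP[s0 sh]|_]; last by rewrite mulr0 normr0.
  by rewrite oppr0 powRr0 mulr1; exact: hK.
have mr : measurable_fun setT r.
  have mF : measurable_fun setT (fun q : R * n.-tuple R => P (vopp (vsub (vzero n) q.2)) * duhk a g h q).
    apply: measurable_funM; last exact: measurable_duhk.
    apply: (@measurableT_comp _ _ _ _ _ _ (fun x => P (vopp (vsub (vzero n) x))) _ snd) => //.
    by apply: (measurableT_comp (hb_meas (hb_vopp hP))); exact: measurable_vsub1.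
  exact: (measurable_Rintegral (mu n) mF).
have mi : measurable_fun setT (fun s => if 0 < s < h then s `^ (- 0) else 0).
  by apply: measurable_if_itv1; exact: measurable_powR.
have ir : (\int[leb]_s `|r s|%:E <= (K * h)%:E)%E.
  apply: (@le_trans _ _ (\int[leb]_s (K * (if 0 < s < h then s `^ (- 0) else 0))%:E)%E).
    by apply: le_integral_EFin => //; [exact: measurable_norm|exact: measurable_funM].
  rewrite integralZl_EFin//; last by move=> s; case: ifP => // _; exact: powR_ge0.
  rewrite [leRHS]EFinM; apply: lee_wpmul2l; first by rewrite lee_fin.
  by have := integral_powR_le h0 (ltr01 : 0 < 1 :> R); rewrite subr0 divr1 powRr1// ltW.
rewrite -lee_fin EFin_normr_Rintegral//; last first.
  apply/integrableP; split; first exact/measurable_EFinP.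
  by apply: le_lt_trans (ltry (K * h)); exact: ir.
have mrE : measurable_fun setT (EFin \o r) by exact/measurable_EFinP.
exact: le_trans (le_abse_integral leb measurableT mrE) ir.
Qed.

(* The Duhamel increment enters at first order only through the flux term, which vanishes when the solution is replaced
   by the heat flow; what remains is of order h^(5/4). *)
Lemma energy_step : exists2 C : R, 0 <= C & forall t h, 1 < t -> 0 < h -> h <= 1 / 2 ->
  ip (v (t + h)) (v (t + h)) <= ip (cnv (gauss h) (v t)) (cnv (gauss h) (v t)) + C * h `^ (5 / 4).
Proof.
have [C1 C10 H1] := mild_holder_space hm; have [C2 C20 H2] := mild_holder_time hm.
have c0 : 0 <= cG n :> R := le_trans ler01 (@cG_ge1 R n).
have h34 : 0 <= 3 / 4 :> R by lra.
have h34' : 3 / 4 <= 1 :> R by lra.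
have P0 : 0 <= p * M `^ (p - 1) := mulr_ge0 (ltW (lt_trans ltr01 p1)) (powR_ge0 _ _).
pose L := p * M `^ (p - 1); rewrite -/L in P0.
pose C3 := L * C1; have C30 : 0 <= C3 := mulr_ge0 P0 C10.
pose C4 := C1 * CM a; have C40 : 0 <= C4 := mulr_ge0 C10 (CM_ge0 a).
pose C5 := C1 * (3 * cG n); have C50 : 0 <= C5 := mulr_ge0 C10 (mulr_ge0 (ler0n _ 3) c0).
pose C6 := C4 * (L * (C2 + 2 * C5)).
have C60 : 0 <= C6 := mulr_ge0 C40 (mulr_ge0 P0 (addr_ge0 C20 (mulr_ge0 (ler0n _ 2) C50))).
pose C7 := C3 * CM a * 2; have C70 : 0 <= C7 := mulr_ge0 (mulr_ge0 C30 (CM_ge0 a)) (ler0n _ 2).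
exists (2 * C6 + C7 ^+ 2); first exact: addr_ge0 (mulr_ge0 (ler0n _ 2) C60) (exprn_ge0 2 C70).
move=> t h t1 h0 h12; have t0 : 0 < t := lt_trans ltr01 t1.
have h1 : h <= 1 by lra.
pose g s y := fnl p (v (t + s) y).
have mg : jm g by apply: (@jm_shift R n (fun s y => fnl p (v s y))); exact: jm_fnl jv.
have hg s : hb 1 (M `^ (p - 1) * M) (g s) by exact: hf.
have gmod s y : 0 < s -> hb 1 (C3 * nrm y `^ (3 / 4)) (fun x => g s (vsub x y) - g s x).
  move=> s0; have t1s : 1 < t + s by lra.
  rewrite -mulrA; apply: (hb_fnl_diff p1 ler01) (H1 (t + s) t1s y) => //.
    by apply: (measurableT_comp (hb_meas (hv _))); exact: measurable_vsub2.
  exact: hb_meas (hv _).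
have hP : hb 1 M (cnv (gauss h) (v t)).
  by have := cnv_hb_r ler01 (hb_l1 (hb_gauss h0)) (hv t); rewrite mul1r.
(* The square of this increment enters the energy. The crude size [h^(1/2)] would make it of first
   order; the Hoelder bound of the flux improves the size to [h^(7/8)]. *)
have hQ : hb 1 (C7 * h `^ (7 / 8)) (duh a g h).
  have K0 : 0 <= C3 * CM a := mulr_ge0 C30 (CM_ge0 a).
  have mb : measurable_fun setT (fun s => C3 * CM a * (h - s) `^ (- (1 / 8))).
    apply: measurable_funM => //; apply: measurable_powRs.
    by apply: measurable_funB => //; exact: measurable_cst.
  have hI : (\int[leb]_s (if (0 < s < h)%R then C3 * CM a * (h - s) `^ (- (1 / 8)) else 0)%:E <=
      (C7 * h `^ (7 / 8))%:E)%E.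
    have b1 : 1 / 8 < 1 :> R by lra.
    apply: le_trans (integral_refl_powR_le h0 K0 b1) _; rewrite lee_fin /C7 -mulrA.
    apply: (ler_wpM2l K0); rewrite (_ : 1 - 1 / 8 = 7 / 8); last by field.
    by have := powR_ge0 h (7 / 8); lra.
  apply: (duh_hb ler01 mg mb _ hI).2 => s s0 sh.
  have hs0 : 0 < h - s by rewrite subr_gt0.
  have := cnv_Dk_modulus a ler01 C30 (hg s) h34 h34' hs0 (fun y => gmod s y s0).
  by rewrite mulrA (_ : - (1 / 2) + 3 / 4 / 2 = - (1 / 8)); last by field.
have key s : 0 < s -> s < h -> `|ip (cnv (gauss h) (v t)) (cnv (Dk a (h - s)) (g s))| <= C6 * h `^ (1 / 4).
  move=> s0 sh; have hs0 : 0 < h - s by rewrite subr_gt0.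
  have h2s : 0 < h - s + h by exact: addr_gt0.
  rewrite (ip_cnv_Dk a hs0 hP (hb_l1 (hg s))) normrN.
  rewrite (_ : cnv (Dk a (h - s)) (cnv (gauss h) (v t)) = cnv (Dk a (h - s + h)) (v t)); last first.
    rewrite (cnvA (cc_ge0 h) (hb_Dk a hs0) (hb_gauss h0) (hb_l1 (hv t))).
    by rewrite (cnvC (measurable_Dk1 a _) (measurable_gauss1 h)) (cnv_gauss_Dk a h0 hs0) [h + _]addrC.
  have hW' := cnv_Dk_modulus a ler01 C10 (hv t) h34 h34' h2s (H1 t t1).
  have hWd := cnv_gauss_modulus ler01 C10 (hv t) h34 h34' h2s (H1 t t1).
  have hW : hb 1 M (cnv (gauss (h - s + h)) (v t)).
    by have := cnv_hb_r ler01 (hb_l1 (hb_gauss h2s)) (hv t); rewrite mul1r.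
  (* Moving [Dk a (h - s)] onto the heat flow of [v t] produces the kernel at time [2 h - s]. At
     this same time the flux of the heat flow pairs to zero, so it may be subtracted from [g s],
     leaving a difference of order [h^(3/8)]. *)
  have F0 := flux0 a p1 h2s ler01 (hv t).
  have hvd := H2 t s t1 s0 (le_trans (ltW sh) h1).
  have hd : hb 1 (L * (C2 * s `^ (3 / 8) + C5 * (h - s + h) `^ (3 / 4 / 2)))
      (fun x => g s x - fnl p (cnv (gauss (h - s + h)) (v t) x)).
    apply: (hb_fnl_diff p1 ler01 (hb_meas (hv (t + s))) (hb_meas hW) (vM _)).
      by move=> x; case: hW => _ _ /(_ x); rewrite mulr1.
    have := hbB hvd hWd; rewrite mulrA; congr (hb _ _ _); apply/funext => x; ring.
  have := ip_le hW' (hb_l1 hd).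
  have -> : ip (cnv (Dk a (h - s + h)) (v t)) (fun x => g s x - fnl p (cnv (gauss (h - s + h)) (v t) x)) =
      ip (cnv (Dk a (h - s + h)) (v t)) (g s).
    have := ipDr hW' (hb_l1 hd) (hb_l1 (hb_fnl p1 ler01 hW)).
    rewrite [X in _ = _ + X]ipC [X in _ = _ + X]F0 addr0 => <-.
    by congr (ip _ _); apply/funext => x; rewrite subrK.
  move/le_trans; apply; rewrite mulr1.
  have Q1 : (h - s + h) `^ (- (1 / 2) + 3 / 4 / 2) <= h `^ (- (1 / 8)).
    rewrite (_ : - (1 / 2) + 3 / 4 / 2 = - (1 / 8)); last by field.
    by apply: powR_anti => //; lra.
  have Q2 : s `^ (3 / 8) <= h `^ (3 / 8) by apply: powR_mono; [lra|exact: ltW|exact: ltW].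
  have Q3 : (h - s + h) `^ (3 / 4 / 2) <= 2 * h `^ (3 / 8).
    rewrite (_ : 3 / 4 / 2 = 3 / 8); last by field.
    apply: (@le_trans _ _ ((2 * h) `^ (3 / 8))); first by apply: powR_mono; lra.
    rewrite (powRM _ (ler0n _ 2) (ltW h0)); apply: ler_wpM2r; first exact: powR_ge0.
    by rewrite -[leRHS]powRr1//; apply: powR_exp_mono; lra.
  rewrite (_ : 1 / 4 = - (1 / 8) + 3 / 8); last by field.
  rewrite (powR_add _ _ h0) /C6 [leRHS]mulrACA.
  have Q4 : 0 <= C2 * s `^ (3 / 8) + C5 * (h - s + h) `^ (3 / 4 / 2).
    exact: addr_ge0 (mulr_ge0 C20 (powR_ge0 _ _)) (mulr_ge0 C50 (powR_ge0 _ _)).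
  apply: ler_pM => //.
  + exact: mulr_ge0 C10 (mulr_ge0 (CM_ge0 a) (powR_ge0 _ _)).
  + exact: mulr_ge0.
  + by rewrite mulrA; exact: ler_wpM2l.
  rewrite -[leRHS]mulrA; apply: (ler_wpM2l P0); rewrite [leRHS]mulrDl; apply: lerD; first exact: ler_wpM2l.
  by rewrite -[leRHS]mulrA [leRHS]mulrCA; exact: ler_wpM2l.
rewrite (mild_restart_fun hm t0 h0) (ip_sqrD hP hQ) -addrA lerD2l [leRHS]mulrDl.
apply: lerD.
  rewrite -mulrA; apply: (ler_wpM2l (ler0n _ 2)); apply: le_trans (ler_norm _) _.
  apply: le_trans (ip_duh_le hP h0 mg (fun s _ _ => hg s) key) _.
  rewrite -mulrA; apply: (ler_wpM2l C60); rewrite -{2}(powRr1 (ltW h0)) -(powR_add _ _ h0).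
  by rewrite (_ : 1 / 4 + 1 = 5 / 4)//; field.
apply: le_trans (ler_norm _) _; apply: le_trans (ip_le hQ (hb_l1 hQ)) _.
rewrite mulr1 mulrACA -expr2; apply: (ler_wpM2l (exprn_ge0 2 C70)).
rewrite -(powR_add _ _ h0); apply: powR_exp_anti => //; lra.
Qed.

Lemma powR_small (K r e : R) : 0 <= K -> 0 < r -> 0 < e ->
  exists2 d : R, 0 < d & forall h, 0 < h -> h <= d -> K * h `^ r <= e.
Proof.
move=> K0 r0 e0; have K1 : 0 < K + 1 by exact: ltr_wpDl.
exists ((e / (K + 1)) `^ r^-1); first by rewrite powR_gt0// divr_gt0.
move=> h h0 hd; apply: (@le_trans _ _ (K * (e / (K + 1)))); last first.
  by rewrite mulrCA ler_piMr ?(ltW e0)// ler_pdivrMr// mul1r lerDl.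
apply: (ler_wpM2l K0); apply: le_trans (powR_mono (ltW r0) (ltW h0) hd) _.
by rewrite -powRrM mulVf ?gt_eqF// powRr1// divr_ge0 ?ltW.
Qed.

Lemma cc_small (e : R) : (0 < n)%N -> 0 < e -> exists2 t, 1 <= t & cc n t <= e.
Proof.
move=> n0 e0; have r0 : 0 < n%:R / 2 :> R by rewrite divr_gt0// ltr0n.
have [d d0 hd] := powR_small ler01 r0 e0.
have d1 : 0 < Num.min d 1 by rewrite lt_min d0 ltr01.
exists (Num.min d 1)^-1; first by rewrite invf_ge1// ge_min lexx orbT.
have := hd _ d1 _; rewrite mul1r ge_min lexx => /(_ isT).
by rewrite /cc -(powR_inv1 (ltW d1)) -powRrM mulN1r opprK.
Qed.

(** Suppose that the energy stays above [e]. The heat flow over a fixed time [tau] would bring it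
    below [e/2], so by convexity a step of length [h] loses at least [h e / (2 tau)]. The error
    [C h^(5/4)] consumes at most half of this, and after enough steps the energy would be
    negative. *)
Lemma energy_small (e : R) : (0 < n)%N -> 0 < e -> exists2 T, 1 < T & ip (v T) (v T) <= e.
Proof.
move=> n0 e0; have [C C0 HC] := energy_step.
apply: contrapT => hne.
have low t : 1 < t -> e <= ip (v t) (v t).
  by move=> t1; rewrite leNgt; apply/negP => he; apply: hne; exists t => //; exact: ltW.
have M1 : 0 < M ^+ 2 + 1 by rewrite ltr_wpDl// sqr_ge0.
have e2 : 0 < e / 2 by rewrite divr_gt0.
(* A time after which the heat flow of anything bounded by [M] in L^1 has energy at most [e/2]. *)
have [tau tau1 htau] := @cc_small (e / 2 / (M ^+ 2 + 1)) n0 (divr_gt0 e2 M1).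
have tau0 : 0 < tau := lt_le_trans ltr01 tau1.
have hM : cc n tau * M ^+ 2 <= e / 2.
  apply: (@le_trans _ _ (e / 2 / (M ^+ 2 + 1) * M ^+ 2)); first by rewrite ler_wpM2r// sqr_ge0.
  by rewrite mulrAC ler_pdivrMr//; apply: ler_wpM2l; [exact: ltW|rewrite lerDl].
have e4 : 0 < e / (4 * tau) by rewrite divr_gt0// mulr_gt0.
have [d d0 hd] := @powR_small C (1 / 4) (e / (4 * tau)) C0 ltac:(lra) e4.
(* Enough subdivisions of [tau] for the step to be at most [d] and [1/2]. *)
pose K := Num.truncn (tau / Num.min d (1 / 2)).
have m0 : 0 < Num.min d (1 / 2) by rewrite lt_min d0/=; lra.
pose h := tau / K.+1%:R.
have h0 : 0 < h by rewrite divr_gt0.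
have hm2 : h <= Num.min d (1 / 2).
  rewrite ler_pdivrMr// mulrC -ler_pdivrMr//; apply: ltW.
  by have /andP[_] := truncn_itv (ltW (divr_gt0 tau0 m0)).
have hd' : h <= d by apply: le_trans hm2 _; rewrite ge_min lexx.
have h12 : h <= 1 / 2 by apply: le_trans hm2 _; rewrite ge_min lexx orbT.
have Kh : K.+1%:R * h = tau by rewrite mulrC divfK.
have drop t : 1 < t -> ip (v (t + h)) (v (t + h)) <= ip (v t) (v t) - h * (e / (4 * tau)).
  move=> t1; apply: le_trans (HC t h t1 h0 h12) _.
  have H1 : C * h `^ (5 / 4) <= h * (e / (4 * tau)).
    rewrite (_ : 5 / 4 = 1 / 4 + 1); last by field.
    rewrite (powR_add _ _ h0) (powRr1 (ltW h0)) [leLHS]mulrA [leLHS]mulrC.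
    exact: (ler_wpM2l (ltW h0) (hd _ h0 hd')).
  have H2 : h * (2 * (e / (4 * tau))) <= ip (v t) (v t) - ip (cnv (gauss h) (v t)) (cnv (gauss h) (v t)).
    have := ip_heat_convex K h0 (hv t); rewrite Kh => H.
    have Ht := low t t1.
    rewrite /h mulrAC ler_pdivrMr// mulrC.
    rewrite [leRHS]mulrC; apply: le_trans H.
    rewrite (_ : 2 * _ * tau = e / 2); last by field; rewrite gt_eqF.
    by move: hM Ht; generalize (cc n tau * M ^+ 2); generalize (ip (v t) (v t)) => ? ?; lra.
  by move: H1 H2; generalize (C * h `^ (5 / 4)) (ip (v t) (v t)) (ip (cnv (gauss h) (v t)) (cnv (gauss h) (v t))) => ? ? ?;
    rewrite mulrCA; generalize (h * (e / (4 * tau))) => ?; lra.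
have it (j : nat) : ip (v (2 + j%:R * h)) (v (2 + j%:R * h)) <= ip (v 2) (v 2) - j%:R * (h * (e / (4 * tau))).
  elim: j => [|j IH]; first by rewrite !mul0r addr0 subr0.
  have t1 : 1 < 2 + j%:R * h.
    by apply: (@lt_le_trans _ _ 2); [rewrite ltr1n|rewrite lerDl mulr_ge0// ltW].
  have := drop _ t1; rewrite -(natr1 j) 2!(mulrDl j%:R) !mul1r addrA => /le_trans; apply.
  by rewrite opprD addrA lerD2r.
have x0 : 0 < h * (e / (4 * tau)) by exact: mulr_gt0.
(* One step more than the initial energy can pay for. *)
have := it (Num.truncn (ip (v 2) (v 2) / (h * (e / (4 * tau))))).+1.
rewrite leNgt => /negP; apply; apply: lt_le_trans (ip_ge0 _).
rewrite subr_lt0 -ltr_pdivrMr//.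
by have /andP[_] := truncn_itv (divr_ge0 (ip_ge0 (v 2)) (ltW x0)).
Qed.

(** By the Hoelder bound a short heat flow changes [v T] little, uniformly in [T]. After the flow
    the supremum is controlled by the L^2 norm through [2 G |v| <= l G v^2 + G / l]. *)
Lemma sup_small (e : R) : (0 < n)%N -> 0 < e -> exists2 T, 1 < T & forall x, `|v T x| <= e.
Proof.
move=> n0 e0; have [C C0 HC] := mild_holder_space hm.
have c0 : 0 <= cG n :> R := le_trans ler01 (@cG_ge1 R n).
have h34 : 0 <= 3 / 4 :> R by lra.
have h34' : 3 / 4 <= 1 :> R by lra.
have e3 : 0 < e / 3 by rewrite divr_gt0.
have [sg sg0 hsg] := @powR_small (C * (3 * cG n)) (3 / 4 / 2) (e / 3)
  (mulr_ge0 C0 (mulr_ge0 (ler0n _ 3) c0)) ltac:(lra) e3.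
(* The weight for which [1 / l = e/3]; [T] is chosen so that the other term is bounded by [e/3]
   too. *)
pose l := 3 / e; have l0 : 0 < l by rewrite divr_gt0.
have lc0 : 0 < l * cc n sg by rewrite mulr_gt0// powR_gt0.
have [T T1 hT] := energy_small n0 (divr_gt0 e3 lc0).
exists T => // x.
have := cnv_gauss_modulus ler01 C0 (hv T) h34 h34' sg0 (HC T T1).
case=> _ _ /(_ x); rewrite mulr1 mulrA => H1; have {}H1 := le_trans H1 (hsg _ sg0 (lexx _)).
suff H2 : `|cnv (gauss sg) (v T) x| <= e / 3 + e / 3.
  rewrite -[v T x](subKr (cnv (gauss sg) (v T) x)); apply: le_trans (ler_normB _ _) _.
  by apply: le_trans (lerD H2 H1) _; lra.
have v2 : l1 (M * 1 * M) (fun y => v T y * v T y) := hb_mul_l1 (hv T) (hb_l1 (hv T)).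
have g1 := hb_refl x (hb_gauss sg0 : hb (cc n sg) 1 (@gauss R n sg)).
have bnd : l1 (1 / 2 * (l * cc n sg * (e / 3 / (l * cc n sg)) + l^-1))
    (fun y => gauss sg (vsub x y) * v T y).
  have mv := hb_meas (hv T); have mg := hb_meas g1.
  have m1 : measurable_fun setT (fun y => l * cc n sg * (v T y * v T y)).
    by apply: measurable_funM => //; exact: measurable_funM.
  have m2 : measurable_fun setT (fun y => l^-1 * gauss sg (vsub x y)) by exact: measurable_funM.
  have vv0 y : 0 <= v T y * v T y by rewrite -expr2 sqr_ge0.
  have n1 y : 0 <= l * cc n sg * (v T y * v T y) by exact: mulr_ge0 (ltW lc0) (vv0 y).
  have li0 : 0 <= l^-1 by rewrite invr_ge0 ltW.
  have n2 y : 0 <= l^-1 * gauss sg (vsub x y) := mulr_ge0 li0 (gauss_ge0 _ _).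
  split; first exact: measurable_funM.
  apply: (@le_trans _ _ (\int[mu n]_y (1 / 2 * (l * cc n sg * (v T y * v T y) + l^-1 * gauss sg (vsub x y)))%:E)%E).
    apply: le_integral_EFin.
    - by apply: measurable_norm; exact: measurable_funM.
    - by apply: measurable_funM => //; exact: measurable_funD.
    - by move=> y; exact: normr_ge0.
    - move=> y; rewrite normrM (ger0_norm (gauss_ge0 _ _)).
      have G0 := gauss_ge0 sg (vsub x y).
      have Gc : gauss sg (vsub x y) <= cc n sg.
        by case: g1 => _ _ /(_ y); rewrite mul1r ger0_norm.
      rewrite -(mulrA l); apply: (@le_trans _ _ (1 / 2 * (l * (gauss sg (vsub x y) * (v T y * v T y)) + l^-1 * gauss sg (vsub x y)))).
        rewrite -[v T y * v T y]expr2 -real_normK ?num_real//.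
        have := mulr_ge0 (mulr_ge0 li0 G0) (sqr_ge0 (l * `|v T y| - 1)).
        rewrite [X in 0 <= X](_ : _ = l * (gauss sg (vsub x y) * `|v T y| ^+ 2) + l^-1 * gauss sg (vsub x y)
          - 2 * (gauss sg (vsub x y) * `|v T y|)); last by field; rewrite gt_eqF.
        by move=> H; lra.
      have half0 : 0 <= 1 / 2 :> R by lra.
      apply: (ler_wpM2l half0).
      rewrite lerD2r; apply: (ler_wpM2l (ltW l0)); exact: ler_wpM2r.
  rewrite integralZl_EFin//; [|exact: measurable_funD|by move=> y; exact: addr_ge0].
  rewrite integralD_EFin// integralZl_EFin ?(ltW lc0)//; last exact: measurable_funM.
  rewrite integralZl_EFin//; last by move=> y; exact: gauss_ge0.
  rewrite [leRHS]EFinM; apply: lee_wpmul2l; first by rewrite lee_fin; lra.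
  rewrite [leRHS]EFinD; apply: leeD.
    rewrite [leRHS]EFinM; apply: lee_wpmul2l; first by rewrite lee_fin ltW.
    rewrite -[leLHS]fineK; last exact: (integrable_fin_num measurableT (l1_integrable v2)).
    by rewrite lee_fin.
  rewrite -[leRHS]mule1; apply: lee_wpmul2l; first by rewrite lee_fin.
  case: g1 => _ h _; apply: le_trans h; apply: le_integral_EFin => //.
  - exact: measurable_norm.
  - by move=> y; exact: gauss_ge0.
  - by move=> y; exact: ler_norm.
have := Rintegral_l1_le bnd.
move=> /le_trans; apply.
rewrite mulrCA mulfV ?gt_eqF// mulr1 /l invf_div; have := e0; lra.
Qed.

End Energy.

(** * The weight [t^(-n/2)] under convolution and Duhamel integrals *)

Section Weights.
Context {R : realType} {n : nat}.
Notation leb := (@lebesgue_measure R).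
Implicit Types (a x : n.-tuple R) (r s t b c K N : R) (k g : n.-tuple R -> R).

Lemma ccM s t : 0 <= s -> 0 <= t -> cc n (s * t) = cc n s * cc n t.
Proof. exact: powRM. Qed.

Lemma cc_gt0 t : 0 < t -> 0 < cc n t.
Proof. exact: powR_gt0. Qed.

(** The larger of two times is at least half of their sum, and halving a time costs the factor
    [cG]. *)
Lemma cc_max_le r s t : 0 < t -> t <= 2 * Num.max r s -> cc n (Num.max r s) <= cG n * cc n t.
Proof.
move=> t0 h; have t20 : 0 < t / 2 by rewrite divr_gt0.
apply: (@le_trans _ _ (cc n (t / 2))); first by apply: cc_anti => //; rewrite ler_pdivrMr// mulrC.
have i2 : 0 <= 2^-1 :> R by rewrite invr_ge0.
rewrite (ccM (ltW t0) i2) mulrC /cG {1}/cc -(powR_inv1 (ler0n _ 2)) -powRrM.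
by rewrite mulN1r opprK.
Qed.

(* Of the two factors, put the one with the larger time in the supremum norm and the other one in L^1. *)
Lemma hb_cnv s r K N k g : 0 < s -> 0 < r -> hb (cc n s) K k -> hb (cc n r) N g ->
  hb (cc n (s + r)) (cG n * (K * N)) (cnv k g).
Proof.
move=> s0 r0 hk hg; have sr0 : 0 < s + r by exact: addr_gt0.
have K0 := hb_ge0 hk; have N0 := hb_ge0 hg; have KN := mulr_ge0 K0 N0.
have hm : hb (cc n (Num.max r s)) (K * N) (cnv k g).
  case: (leP r s) => rs; first exact: cnv_hb (cc_ge0 _) hk (hb_l1 hg).
  exact: cnv_hb_r (cc_ge0 _) (hb_l1 hk) hg.
have M2 : s + r <= 2 * Num.max r s by rewrite mulr2n mulrDl !mul1r addrC; apply: lerD; rewrite le_max lexx ?orbT.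
have [mg h1 h2] := hm; have G1 := @cG_ge1 R n.
split => //; first by apply: le_trans h1 _; rewrite lee_fin ler_peMl.
move=> x; apply: le_trans (h2 x) _; rewrite (mulrC (cG n)) -[leRHS]mulrA; apply: (ler_wpM2l KN).
exact: cc_max_le.
Qed.

Lemma duh_hb_beta a (g : R -> n.-tuple R -> R) t c B e b : 0 <= c -> 0 < t -> jm g -> 0 <= B ->
  0 <= e -> e < 1 -> 0 <= b -> b < 1 ->
  (forall s, 0 < s -> s < t -> hb c (B * ((t - s) `^ (- e) * s `^ (- b))) (cnv (Dk a (t - s)) (g s))) ->
  (forall x, leb.-integrable setT (fun s => (duhk a g t (s, x))%:E)) /\
  hb c (B * (betaC e b * t `^ (1 - e - b))) (duh a g t).
Proof.
move=> c0 t0 mg B0 e0 e1 b0 b1 hg.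
have mb : measurable_fun setT (fun s => (t - s) `^ (- e) * s `^ (- b)).
  apply: measurable_funM; last exact: measurable_powR.
  by apply: measurable_powRs; apply: measurable_funB => //; exact: measurable_cst.
apply: (duh_hb c0 mg (measurable_funM (measurable_cst B) mb) hg).
rewrite (_ : (fun s => _) = (fun s : R => (B * (if 0 < s < t then (t - s) `^ (- e) * s `^ (- b) else 0))%:E)); last first.
  by apply/funext => s; case: ifP => // _; rewrite mulr0.
rewrite integralZl_EFin//.
- by rewrite [leRHS]EFinM; apply: lee_wpmul2l; [rewrite lee_fin|exact: integral_beta_le].
- exact: measurable_if_itv1.
- by move=> s; case: ifP => // _; rewrite mulr_ge0 ?powR_ge0.
Qed.

Lemma betaC_ge0 e b : e < 1 -> b < 1 -> 0 <= betaC e b :> R.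
Proof. by move=> e1 b1; rewrite addr_ge0// divr_ge0 ?powR_ge0// subr_ge0 ltW. Qed.

End Weights.

(** * The decay rate of the heat flow for the solution *)

Section Decay.
Context {R : realType} {n : nat}.
Implicit Types (x y z : n.-tuple R) (t s h c N A : R).
Variables (a : n.-tuple R) (p M : R) (u0 : n.-tuple R -> R) (v : R -> n.-tuple R -> R).
Hypothesis hm : mild a p u0 M v.
Hypothesis crit : (p - 1) * (n%:R / 2) = 3 / 4.

Let p1 : 1 < p. Proof. by case: hm. Qed.
Let hv s : hb 1 M (v s). Proof. by case: hm. Qed.
Let jv : jm v. Proof. by case: hm. Qed.
Let M0 : 0 <= M := hb_ge0 (hv 0).
Let c0 : 0 <= cG n :> R := le_trans ler01 (@cG_ge1 R n).
Let half1 : 1 / 2 < 1 :> R. Proof. lra. Qed.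
Let half0 : 0 <= 1 / 2 :> R. Proof. lra. Qed.

(** Here the value of [p] turns into a decay rate: for a solution of Gaussian size the flux is
    [s^(-3/4)] times the solution. *)
Lemma cc_powR s : cc n s `^ (p - 1) = s `^ (- (3 / 4)).
Proof. by rewrite /cc -powRrM mulNr mulrC crit. Qed.

(* Since p is above the critical exponent 1 + 1/n, the Duhamel term gains d^(-1/4): a bound with constant N improves itself once d is large. *)
Lemma decay_improve d N T s : 0 < d -> 0 < T -> 0 < N -> M <= N -> 0 < s ->
  hb (cc n d) (N / (2 * cG n)) (v T) ->
  CD a * cG n * betaC (1 / 2) (1 / 2) * N `^ (p - 1) * d `^ (- (1 / 4)) <= 1 / 4 ->
  (forall r, 0 < r -> r < s -> forall x, `|v (T + r) x| <= N * cc n (r + d)) ->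
  hb (cc n (s + d)) (3 / 4 * N) (v (T + s)).
Proof.
move=> d0 T0 N0 MN s0 hT small bnd; have sd0 : 0 < s + d by exact: addr_gt0.
pose g r y := fnl p (v (T + r) y).
have mg : jm g by apply: (@jm_shift R n (fun s y => fnl p (v s y))); exact: jm_fnl jv.
have hl : hb (cc n (s + d)) (1 / 2 * N) (cnv (gauss s) (v T)).
  have := hb_cnv s0 d0 (hb_gauss s0) hT; rewrite mul1r.
  by rewrite (_ : cG n * _ = 1 / 2 * N)//; field; rewrite gt_eqF// (lt_le_trans ltr01)// cG_ge1.
pose B := CD a * cG n * (N `^ (p - 1) * d `^ (- (1 / 4)) * N).
have P0 : 0 <= N `^ (p - 1) * d `^ (- (1 / 4)) := mulr_ge0 (powR_ge0 _ _) (powR_ge0 _ _).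
have B0 : 0 <= B := mulr_ge0 (mulr_ge0 (CD_ge0 a) c0) (mulr_ge0 P0 (ltW N0)).
have hD r : 0 < r -> r < s -> hb (cc n (s + d)) (B * ((s - r) `^ (- (1 / 2)) * r `^ (- (1 / 2))))
    (cnv (Dk a (s - r)) (g r)).
  move=> r0 rs; have sr0 : 0 < s - r by rewrite subr_gt0.
  have rd0 : 0 < r + d by exact: addr_gt0.
  have hvr : hb (cc n (r + d)) N (v (T + r)).
    have [m1 i1 _] := hv (T + r); split => //; last exact: bnd.
    by apply: le_trans i1 _; rewrite lee_fin.
  have hgr := hb_fnl p1 (cc_ge0 _) hvr.
  have := hb_cnv sr0 rd0 (hb_Dk a sr0) hgr; rewrite addrA subrK => H.
  apply: (hb_le H (cc_ge0 _)); rewrite /B -/(CD a) (powRM _ (ltW N0) (cc_ge0 _)) cc_powR.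
  have q : (r + d) `^ (- (3 / 4)) <= d `^ (- (1 / 4)) * r `^ (- (1 / 2)).
    rewrite (_ : - (3 / 4) = - (1 / 4) + - (1 / 2)); last by field.
    rewrite (powR_add _ _ rd0); apply: ler_pM; rewrite ?powR_ge0//.
      by apply: powR_anti => //; lra.
    by apply: powR_anti => //; lra.
  have K0 : 0 <= cG n * CD a * (s - r) `^ (- (1 / 2)) * N `^ (p - 1) * N.
    exact: mulr_ge0 (mulr_ge0 (mulr_ge0 (mulr_ge0 c0 (CD_ge0 a)) (powR_ge0 _ _)) (powR_ge0 _ _)) (ltW N0).
  rewrite [leLHS](_ : _ = cG n * CD a * (s - r) `^ (- (1 / 2)) * N `^ (p - 1) * N * (r + d) `^ (- (3 / 4))); last by ring.
  rewrite [leRHS](_ : _ = cG n * CD a * (s - r) `^ (- (1 / 2)) * N `^ (p - 1) * N *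
    (d `^ (- (1 / 4)) * r `^ (- (1 / 2)))); last by ring.
  by apply: ler_wpM2l.
have [_ hd] := duh_hb_beta (cc_ge0 _) s0 mg B0 half0 half1 half0 half1 hD.
rewrite (mild_restart_fun hm T0 s0); apply: (hb_le (hbD hl hd) (cc_ge0 _)).
rewrite (_ : 1 - 1 / 2 - 1 / 2 = 0); last by field.
rewrite powRr0 mulr1.
rewrite [X in _ + X <= _](_ : _ = CD a * cG n * betaC (1 / 2) (1 / 2) * N `^ (p - 1) * d `^ (- (1 / 4)) * N); last first.
  by rewrite /B; ring.
have := ler_wpM2r (ltW N0) small; move: (_ * N) => X HX.
by move: HX; lra.
Qed.

(** The continuity half of the bootstrap: the improved constant [3/4 N] at time [s] leaves room for
    [N] on an interval whose length is uniform over [[0, L]]. *)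
Lemma decay_step d N T L : 0 < d -> 1 < T -> 0 < N ->
  exists2 e : R, 0 < e & forall s, 0 <= s -> s <= L -> hb (cc n (s + d)) (3 / 4 * N) (v (T + s)) ->
  forall r, s <= r -> r <= s + e -> forall x, `|v (T + r) x| <= N * cc n (r + d).
Proof.
move=> d0 T1 N0; have [C C0 HC] := mild_holder_time hm.
have n20 : 0 <= n%:R / 2 :> R by rewrite divr_ge0.
(* The variation of the weight may cost [7/6] and that of [v] may add [1/8], as
   [1/8 + 3/4 * 7/6 = 1]. *)
have [k k0 kd] : exists2 k : R, 0 < k & (1 + k) `^ (n%:R / 2) <= 7 / 6.
  have n1 : 0 < n%:R / 2 + 1 :> R by exact: ltr_wpDl.
  pose b : R := (7 / 6) `^ ((n%:R / 2 + 1)^-1).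
  have h76 : 0 <= 7 / 6 :> R by lra.
  have b1 : 1 < b.
    rewrite ltNge; apply/negP => H; have := powR_mono (ltW n1) (powR_ge0 _ _) H.
    by rewrite -powRrM mulVf ?gt_eqF// powRr1// powR1; lra.
  exists (b - 1); first by rewrite subr_gt0.
  rewrite addrCA subrr addr0 -powRrM -[leRHS]powRr1//; apply: powR_exp_mono; first by lra.
  by rewrite mulrC ler_pdivrMr// mul1r lerDl.
(* The weight at the latest time in range, so that one [e] serves every [s <= L]. *)
have x0 : 0 < N / 8 * cc n (Num.max L 0 + 1 + d).
  apply: mulr_gt0; first by lra.
  by apply: cc_gt0; rewrite -addrA ltr_wpDl ?addr_gt0// le_max lexx orbT.
have [e1 e10 he1] := @powR_small R C (3 / 8) _ C0 ltac:(lra) x0.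
pose e := Num.min (Num.min e1 1) (k * d).
have kd0 : 0 < k * d by exact: mulr_gt0.
have e0 : 0 < e by rewrite !lt_min e10 ltr01 kd0.
have ee1 : e <= e1 by rewrite !ge_min lexx.
have el1 : e <= 1 by rewrite !ge_min lexx orbT.
have ekd : e <= k * d by rewrite !ge_min lexx !orbT.
exists e => // s s0 sL hs r sr rse x.
have sd0 : 0 < s + d by exact: ltr_wpDl.
have rd0 : 0 < r + d by exact: lt_le_trans sd0 (lerD sr (lexx d)).
have cb : cc n (s + d) <= 7 / 6 * cc n (r + d).
  apply: (@le_trans _ _ ((1 + k) `^ (n%:R / 2) * cc n (r + d))); last by apply: ler_wpM2r => //; exact: cc_ge0.
  have k10 : 0 < 1 + k by exact: addr_gt0.
  have -> : (1 + k) `^ (n%:R / 2) = cc n (1 + k)^-1.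
    by rewrite /cc -(powR_inv1 (ltW k10)) -powRrM mulN1r opprK.
  have ki0 : 0 < (1 + k)^-1 by rewrite invr_gt0.
  rewrite -(ccM (ltW ki0) (ltW rd0)); apply: cc_anti; first exact: mulr_gt0.
  rewrite mulrC ler_pdivrMr// mulrDr mulr1.
  apply: (@le_trans _ _ (s + e + d)); first exact: lerD.
  rewrite addrAC; apply: lerD => //; apply: le_trans ekd _; rewrite mulrC.
  by apply: (ler_wpM2r (ltW k0)); rewrite lerDr.
have [_ _ /(_ x) vs] := hs.
have Ts : 1 < T + s by exact: ltr_wpDr.
have dv : `|v (T + r) x - v (T + s) x| <= N / 8 * cc n (r + d).
  have [->|rs] := eqVneq r s; first by rewrite subrr normr0 mulr_ge0 ?cc_ge0//; lra.
  have h0 : 0 < r - s by rewrite subr_gt0 lt_neqAle eq_sym rs.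
  have he : r - s <= e by rewrite lerBlDl.
  have [_ _ /(_ x)] := HC (T + s) (r - s) Ts h0 (le_trans he el1).
  rewrite (_ : T + s + (r - s) = T + r); last by ring.
  move=> /le_trans; apply; rewrite mulr1; apply: le_trans (he1 _ h0 (le_trans he ee1)) _.
  apply: ler_wpM2l; first by lra.
  apply: cc_anti => //; apply: lerD => //; apply: le_trans rse _; apply: lerD => //.
  by rewrite le_max sL.
rewrite -(subrK (v (T + s) x) (v (T + r) x)); apply: le_trans (ler_normD _ _) _.
apply: le_trans (lerD dv vs) _.
have := ler_wpM2l (ltW N0) cb; move: (cc n (s + d)) (cc n (r + d)) => X Y H.
apply: (@le_trans _ _ (N / 8 * Y + 3 / 4 * (N * (7 / 6 * Y)))).
  by rewrite lerD2l -[leLHS]mulrA; apply: ler_wpM2l => //; lra.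
by rewrite le_eqVlt; apply/orP; left; apply/eqP; field.
Qed.

(** The order of choices matters: [N] from [M] alone, then [d] from [N] to make the Duhamel constant
    small, then [T] from [d] so that the solution is below [(M + 1) d^(-n/2)] there. The shifted
    weight [cc n (s + d)] is finite at [s = 0], where the bootstrap starts. *)
Lemma decay : exists2 N : R, 0 <= N & forall t, 0 < t -> hb (cc n t) N (v t).
Proof.
have n0 : (0 < n)%N.
  by case: n crit => // crit0; move: crit0; rewrite mul0r mulr0; lra.
pose N := 2 * cG n * (M + 1).
have G1 := @cG_ge1 R n.
have G0 : 0 < cG n :> R := lt_le_trans ltr01 G1.
have M1 : 0 < M + 1 by exact: ltr_wpDl.
have N0 : 0 < N by exact: mulr_gt0 (mulr_gt0 (ltr0n _ 2) G0) M1.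
have MN : M + 1 <= N by rewrite ler_peMl ?ltW//; lra.
have MN' : M <= N by apply: le_trans MN; rewrite lerDl.
pose K := CD a * cG n * betaC (1 / 2) (1 / 2) * N `^ (p - 1).
have K0 : 0 <= K := mulr_ge0 (mulr_ge0 (mulr_ge0 (CD_ge0 a) c0) (betaC_ge0 half1 half1)) (powR_ge0 _ _).
have q4 : 0 < 1 / 4 :> R by lra.
have [d' d'0 hd'] := powR_small K0 q4 q4.
pose d := d'^-1; have d0 : 0 < d by rewrite invr_gt0.
have small : K * d `^ (- (1 / 4)) <= 1 / 4.
  by have := hd' d' d'0 (lexx _); rewrite /d -(powR_inv1 (ltW d'0)) -powRrM mulN1r opprK.
have [T T1 hT] := sup_small hm n0 (mulr_gt0 M1 (@cc_gt0 R n _ d0)).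
have T0 : 0 < T := lt_trans ltr01 T1.
have hT' : hb (cc n d) (N / (2 * cG n)) (v T).
  have -> : N / (2 * cG n) = M + 1 by rewrite /N mulrAC mulfV ?mul1r// gt_eqF// mulr_gt0.
  have [m1 i1 _] := hv T; split => //; apply: le_trans i1 _; by rewrite lee_fin lerDl.
have imp s : 0 <= s -> (forall r, 0 < r -> r < s -> forall x, `|v (T + r) x| <= N * cc n (r + d)) ->
    hb (cc n (s + d)) (3 / 4 * N) (v (T + s)).
  rewrite le_eqVlt => /orP[/eqP <- _|s0]; last exact: decay_improve.
  rewrite add0r addr0; apply: (hb_le hT' (cc_ge0 _)).
  rewrite ler_pdivrMr ?mulr_gt0//; have := ler_wpM2l (ltW N0) G1; nra.
(* Continuous induction by steps of length [e], which may depend on the final time [s] since [N]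
   does not deteriorate from step to step. *)
have all s : 0 <= s -> forall x, `|v (T + s) x| <= N * cc n (s + d).
  move=> s0; have [e e0 he] := decay_step s d0 T1 N0.
  have it (j : nat) : forall r, 0 <= r -> r <= j%:R * e -> r <= s -> forall x, `|v (T + r) x| <= N * cc n (r + d).
    elim: j => [|j IH] r r0 rj rs.
      have -> : r = 0 by apply: le_anti; rewrite r0 -(mul0r e) rj.
      move=> x; have [|_ _ /(_ x)] := imp 0 (lexx _) _; first by move=> q q0 q1; have := lt_trans q0 q1; rewrite ltxx.
      by move/le_trans; apply; rewrite add0r; apply: (ler_wpM2r (cc_ge0 _)); lra.
    have [rje|rje] := leP r (j%:R * e); first exact: IH.
    have je0 : 0 <= j%:R * e by rewrite mulr_ge0// ltW.
    have js : j%:R * e <= s by exact: le_trans (ltW rje) rs.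
    apply: (he (j%:R * e) je0 js) (ltW rje) _; last by move: rj; rewrite -natr1 mulrDl mul1r.
    by apply: imp => // q q0 qj; apply: IH (ltW q0) (ltW qj) (le_trans (ltW qj) js).
  apply: (it (Num.truncn (s / e)).+1) => //; apply: ltW; rewrite -ltr_pdivrMr//.
  by have /andP[_] := truncn_itv (divr_ge0 s0 (ltW e0)).
(* Then [l t <= t - T + d] for [t >= T], which converts the shifted weight into [cc n t]; earlier
   times use the bound [M]. *)
pose l := Num.min 1 (d / T).
have l0 : 0 < l by rewrite lt_min ltr01 divr_gt0.
have cT := @cc_gt0 R n _ T0; have cl := @cc_gt0 R n _ l0.
pose N' := M + N * cc n l + M / cc n T.
have N1 : 0 <= N * cc n l := mulr_ge0 (ltW N0) (ltW cl).
have N2 : 0 <= M / cc n T := divr_ge0 M0 (ltW cT).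
have N'0 : 0 <= N' by rewrite !addr_ge0.
exists N' => // t t0; have [m1 i1 s1] := hv t; split => //.
  by apply: le_trans i1 _; rewrite lee_fin /N' -addrA lerDl addr_ge0.
move=> x; have [tT|Tt] := ltP t T.
  apply: le_trans (s1 x) _; rewrite mulr1.
  apply: (@le_trans _ _ (M / cc n T * cc n t)).
    by rewrite -mulrA ler_peMr// mulrC ler_pdivlMr// mul1r; apply: cc_anti => //; exact: ltW.
  by apply: (ler_wpM2r (cc_ge0 _)); rewrite lerDr addr_ge0.
have tT0 : 0 <= t - T by rewrite subr_ge0.
have := all (t - T) tT0 x; rewrite addrCA subrr addr0 => /le_trans; apply.
apply: (@le_trans _ _ (N * cc n l * cc n t)); last first.
  by apply: (ler_wpM2r (cc_ge0 _)); rewrite /N' addrAC lerDr addr_ge0.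
rewrite -mulrA; apply: (ler_wpM2l (ltW N0)); rewrite -(ccM (ltW l0) (ltW t0)).
apply: cc_anti; first exact: mulr_gt0.
apply: (@le_trans _ _ (l * (t - T) + l * T)); first by rewrite -mulrDr subrK.
apply: lerD; first by rewrite ler_piMl// ge_min lexx.
by rewrite -ler_pdivlMr// ge_min lexx orbT.
Qed.

End Decay.

(** * Moments of the data and powers of Gaussians *)

Section Moments.
Context {R : realType} {n : nat}.
Implicit Types (a x y z : n.-tuple R) (t s K e th A : R) (g : n.-tuple R -> R).

(** The counterpart of [cnv_modulus] with regularity on the kernel and the moment on [g]: away from
    the mass term, a moment of order [th] gains [t^(-th/2)]. *)
Lemma cnv_moment K e k th t A B g : 0 <= K -> kb K e k -> 0 <= th -> th <= 1 -> 0 < t -> l1 B g ->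
  (\int[mu n]_y (nrm y `^ th * `|g y|)%:E <= A%:E)%E ->
  hb (cc n t) (K * t `^ (- (e + th / 2)) * A) (fun x => cnv (k t) g x - (\int[mu n]_y g y) * k t x).
Proof.
move=> K0 hk h0 h1 t0 hg hA; have [hkt _] := hk t t0.
have mk := hb_meas hkt; have [mg _] := hg; have ig := l1_integrable hg.
have C0 : 0 <= K * t `^ (- (e + th / 2)) := mulr_ge0 K0 (powR_ge0 _ _).
pose F (q : n.-tuple R * n.-tuple R) := g q.1 * (k t (vsub q.2 q.1) - k t q.2).
have mF : measurable_fun setT F.
  apply: measurable_funM; first exact: measurableT_comp.
  by apply: measurable_funB; [apply: measurableT_comp => //; exact: measurable_vsub|exact: measurableT_comp].
have mm : measurable_fun setT (fun y : n.-tuple R => nrm y `^ th * `|g y|).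
  by apply: measurable_funM; [exact: measurable_nrm_powR|exact: measurable_norm].
have mb : measurable_fun setT (fun y : n.-tuple R => K * t `^ (- (e + th / 2)) * (nrm y `^ th * `|g y|)).
  exact: measurable_funM.
have [iF hF] : (forall x, (mu n).-integrable setT (fun y => (F (y, x))%:E)) /\
    hb (cc n t) (K * t `^ (- (e + th / 2)) * A) (fun x => \int[mu n]_y F (y, x)).
  apply: (hb_integral (cc_ge0 _) mF mb).
    move=> y; have := hbZ (g y) (kb_holder y K0 hk h0 h1 t0); rewrite /F /=.
    by rewrite (_ : `|g y| * _ = K * t `^ (- (e + th / 2)) * (nrm y `^ th * `|g y|)); last by ring.
  rewrite integralZl_EFin//.
  - by rewrite [leRHS]EFinM lee_wpmul2l// lee_fin.
  - by move=> y; rewrite mulr_ge0 ?powR_ge0.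
rewrite (_ : (fun x => _) = (fun x => \int[mu n]_y F (y, x))) => //; apply/funext => x.
have i2 : (mu n).-integrable setT (fun y => (k t x * g y)%:E).
  have := integrableZl measurableT (k t x) ig.
  by apply: eq_integrable => // y _; rewrite /= EFinM.
rewrite /cnv [in LHS]mulrC -(RintegralZl (k t x) measurableT ig) -(RintegralB measurableT (cnv_integrable x hkt hg) i2).
by apply: eq_Rintegral => y _; rewrite /F /=; ring.
Qed.

Lemma gauss_time_le s t z : 0 < s -> s <= t -> gauss s z <= (t / s) `^ (n%:R / 2) * gauss t z.
Proof.
move=> s0 st; have t0 : 0 < t := lt_le_trans s0 st.
have p0 : 0 < 4 * pi :> R by rewrite mulr_gt0 ?pi_gt0.
have c0 : (t / s) `^ (n%:R / 2) = cc n (s / t).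
  by rewrite -(invf_div t s) /cc -(powR_inv1 (divr_ge0 (ltW t0) (ltW s0))) -powRrM mulN1r opprK.
rewrite c0 /gauss mulrA; apply: ler_pM; rewrite ?powR_ge0 ?expR_ge0//.
  rewrite le_eqVlt; apply/orP; left; apply/eqP.
  rewrite /cc -powRM; [|by rewrite divr_ge0 ?ltW|by rewrite ltW// mulr_gt0].
  by congr (_ `^ _); field; rewrite gt_eqF.
rewrite ler_expR !mulNr lerN2; apply: ler_wpM2l; first exact: sqnorm_ge0.
by rewrite lef_pV2 ?posrE ?mulr_gt0// ler_wpM2l.
Qed.

(** A power of a Gaussian is again a Gaussian, at the time [s / p], which makes the flux of the
    profile explicit. *)
Lemma fnl_gauss p (m : R) : 1 < p -> (p - 1) * (n%:R / 2) = 3 / 4 ->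
  exists K : R, forall s z, 0 < s -> fnl p (m * gauss s z) = K * s `^ (- (3 / 4)) * gauss (s / p) z.
Proof.
move=> p1 crit; have p0 : 0 < p := lt_trans ltr01 p1.
have q0 : 0 < 4 * pi :> R by rewrite mulr_gt0 ?pi_gt0.
exists (`|m| `^ (p - 1) * m * ((4 * pi) `^ (- (3 / 4)) * cc n p)) => s z s0.
have qs : 0 < 4 * pi * s by exact: mulr_gt0.
rewrite /fnl normrM (ger0_norm (gauss_ge0 _ _)) (powRM _ (normr_ge0 _) (gauss_ge0 _ _)).
suff -> : gauss s z `^ (p - 1) = (4 * pi) `^ (- (3 / 4)) * s `^ (- (3 / 4)) * expR (- (p - 1) * sqnorm z / (4 * s)).
  have -> : gauss (s / p) z = cc n p^-1 * ((4 * pi * s) `^ (- (n%:R / 2)) * (expR (- sqnorm z / (4 * s)) *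
      expR (- (p - 1) * sqnorm z / (4 * s)))).
    rewrite -expRD [RHS]mulrA /gauss /cc -powRM ?invr_ge0 ?(ltW p0) ?(ltW qs)//; congr (_ `^ _ * expR _).
      by field; rewrite gt_eqF.
    by field; rewrite !gt_eqF.
  have cp : cc n p * cc n p^-1 = 1.
    by rewrite -ccM ?invr_ge0 ?ltW// mulfV ?gt_eqF// /cc powR1.
  rewrite /gauss.
  rewrite [RHS](_ : _ = `|m| `^ (p - 1) * m * ((4 * pi) `^ (- (3 / 4)) * s `^ (- (3 / 4)) * ((4 * pi * s) `^ (- (n%:R / 2)) *
    (expR (- sqnorm z / (4 * s)) * expR (- (p - 1) * sqnorm z / (4 * s))))) * (cc n p * cc n p^-1)); last by ring.
  by rewrite cp; ring.
rewrite /gauss powRM ?powR_ge0 ?expR_ge0// -powRrM mulNr [n%:R / 2 * _]mulrC crit.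
rewrite (powRM _ (ltW q0) (ltW s0)); congr (_ * _).
by rewrite /powR gt_eqF ?expR_gt0// expRK; congr expR; ring.
Qed.

End Moments.

(** * The first corrector *)

Section Corrector.
Context {R : realType} {n : nat}.
Notation leb := (@lebesgue_measure R).
Implicit Types (x y z : n.-tuple R) (t s : R).
Variables (a : n.-tuple R) (p m : R).
Hypothesis p1 : 1 < p.
Hypothesis crit : (p - 1) * (n%:R / 2) = 3 / 4.

Let c0 : 0 <= cG n :> R := le_trans ler01 (@cG_ge1 R n).

Definition fA s y : R := fnl p (m * gauss s y).

Lemma jm_fA : jm fA.
Proof.
apply: jm_fnl; apply: measurable_funM; first exact: measurable_cst.
by apply: measurable_gauss; [exact: measurable_fst|exact: measurable_snd].
Qed.

(** The semigroup law collapses the slice to one kernel. Its time [t - s + s/p] stays between [t/p]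
    and [t], so there is no singularity at [s = t]. *)
Lemma duhk_fA : exists K : R, forall s t x, 0 < s -> s < t ->
  duhk a fA t (s, x) = K * s `^ (- (3 / 4)) * Dk a (t - s + s / p) x.
Proof.
have [K hK] := fnl_gauss m p1 crit; exists K => s t x s0 st; rewrite /duhk /= s0 st /=.
have p0 : 0 < p := lt_trans ltr01 p1.
have ts : 0 < t - s by rewrite subr_gt0.
have sp : 0 < s / p by exact: divr_gt0.
rewrite (_ : fA s = (fun y => K * s `^ (- (3 / 4)) * gauss (s / p) y)); last first.
  by apply/funext => y; exact: hK.
rewrite (cnvZr _ _ (hb_Dk a ts) (hb_l1 (hb_gauss sp))); congr (_ * _).
by rewrite (cnvC (measurable_Dk1 a _) (measurable_gauss1 _)) (cnv_gauss_Dk a sp ts) addrC.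
Qed.

(** As the kernel time is comparable with [t], only [s^(-3/4)] is integrated, with constant
    [1 / (1 - 3/4) = 4]. The bound is pointwise and Gaussian because it later has to control
    moments. *)
Lemma corrector_bound : exists2 C : R, 0 <= C & forall t x, 0 < t ->
  leb.-integrable setT (fun s => (duhk a fA t (s, x))%:E) /\
  `|duh a fA t x| <= C * t `^ (- (1 / 4)) * gauss (2 * t) x.
Proof.
have [K hK] := duhk_fA; have p0 : 0 < p := lt_trans ltr01 p1.
pose L := `|K| * (nrm a * cG n * p `^ (1 / 2) * p `^ (n%:R / 2)).
have L0 : 0 <= L by rewrite !mulr_ge0 ?nrm_ge0 ?powR_ge0.
exists (4 * L); first exact: mulr_ge0.
have pi1 : 0 <= 1 - p^-1 by rewrite subr_ge0 invf_le1// ltW.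
move=> t x t0.
have bnd s : `|duhk a fA t (s, x)| <= L * t `^ (- (1 / 2)) * gauss (2 * t) x * (if 0 < s < t then s `^ (- (3 / 4)) else 0).
  case: (boolP (0 < s < t)) => [/andP[s0 st]|hs]; last by rewrite /duhk /= (negbTE hs) normr0 mulr0.
  rewrite hK// normrM normrM (ger0_norm (powR_ge0 _ _)).
  have tau : t / p <= t - s + s / p.
    have := mulr_ge0 (_ : 0 <= t - s) pi1; rewrite subr_ge0 (ltW st) => /(_ isT).
    by rewrite [X in 0 <= X](_ : _ = t - s + s / p - t / p); [rewrite subr_ge0|ring].
  have tau2 : t - s + s / p <= t.
    rewrite -subr_ge0 [X in 0 <= X](_ : _ = s * (1 - p^-1)); last by ring.
    exact: mulr_ge0 (ltW s0) pi1.
  move: (t - s + s / p) tau tau2 => r r1 r2.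
  have tp : 0 < t / p by exact: divr_gt0.
  have r0 : 0 < r := lt_le_trans tp r1.
  have D1 := Dk_le a x r0.
  have D2 : r `^ (- (1 / 2)) <= p `^ (1 / 2) * t `^ (- (1 / 2)).
    apply: (@le_trans _ _ ((t / p) `^ (- (1 / 2)))); first by apply: powR_anti => //; lra.
    have pi0 : 0 <= p^-1 by rewrite invr_ge0 ltW.
    rewrite (powRM _ (ltW t0) pi0) [leLHS]mulrC -(powR_inv1 (ltW p0)) -powRrM.
    by rewrite mulN1r opprK.
  have D3 : gauss (2 * r) x <= p `^ (n%:R / 2) * gauss (2 * t) x.
    have r20 : 0 < 2 * r by exact: mulr_gt0.
    apply: le_trans (gauss_time_le x r20 (ler_wpM2l (ler0n _ 2) r2)) _.
    apply: ler_wpM2r; first exact: gauss_ge0.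
    apply: powR_mono; [exact: divr_ge0|by rewrite divr_ge0 ?mulr_ge0 ?(ltW t0) ?(ltW r0)|].
    rewrite -mulf_div divff// mul1r ler_pdivrMr// mulrC -ler_pdivrMr//.
  have D4 : `|Dk a r x| <= nrm a * cG n * p `^ (1 / 2) * p `^ (n%:R / 2) * t `^ (- (1 / 2)) * gauss (2 * t) x.
    apply: le_trans D1 _.
    rewrite [leRHS](_ : _ = nrm a * cG n * (p `^ (1 / 2) * t `^ (- (1 / 2))) * (p `^ (n%:R / 2) * gauss (2 * t) x)); last by ring.
    have k0 : 0 <= nrm a * cG n := mulr_ge0 (nrm_ge0 a) c0.
    apply: ler_pM => //; [exact: mulr_ge0 k0 (powR_ge0 _ _)|exact: gauss_ge0|exact: ler_wpM2l].
  have k0 : 0 <= `|K| * s `^ (- (3 / 4)) := mulr_ge0 (normr_ge0 _) (powR_ge0 _ _).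
  apply: le_trans (ler_wpM2l k0 D4) _.
  by rewrite le_eqVlt; apply/orP; left; apply/eqP; rewrite /L; ring.
have K0 : 0 <= L * t `^ (- (1 / 2)) * gauss (2 * t) x := mulr_ge0 (mulr_ge0 L0 (powR_ge0 _ _)) (gauss_ge0 _ _).
have mi : measurable_fun setT (fun s => if 0 < s < t then s `^ (- (3 / 4)) else 0).
  by apply: measurable_if_itv1; exact: measurable_powR.
have md : measurable_fun setT (fun s => duhk a fA t (s, x)) := measurable_duhk1 a t x jm_fA.
have I : (\int[leb]_s `|duhk a fA t (s, x)|%:E <= (4 * L * t `^ (- (1 / 4)) * gauss (2 * t) x)%:E)%E.
  apply: (@le_trans _ _ (\int[leb]_s (L * t `^ (- (1 / 2)) * gauss (2 * t) x * (if 0 < s < t then s `^ (- (3 / 4)) else 0))%:E)%E).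
    by apply: le_integral_EFin => //; [exact: measurable_norm|exact: measurable_funM].
  rewrite integralZl_EFin//; last by move=> s; case: ifP => // _; exact: powR_ge0.
  have b1 : 3 / 4 < 1 :> R by lra.
  apply: (@le_trans _ _ ((L * t `^ (- (1 / 2)) * gauss (2 * t) x)%:E * (t `^ (1 - 3 / 4) / (1 - 3 / 4))%:E)%E).
    by apply: lee_wpmul2l; [rewrite lee_fin|exact: integral_powR_le].
  rewrite -EFinM lee_fin.
  have -> : t `^ (- (1 / 4)) = t `^ (- (1 / 2)) * t `^ (1 - 3 / 4).
    by rewrite -powR_add//; congr (_ `^ _); field.
  by rewrite le_eqVlt; apply/orP; left; apply/eqP; field.
have ir : leb.-integrable setT (fun s => (duhk a fA t (s, x))%:E).
  apply/integrableP; split; first exact/measurable_EFinP.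
  exact: le_lt_trans I (ltry _).
split => //; rewrite -lee_fin EFin_normr_Rintegral//.
have mrE : measurable_fun setT (EFin \o (fun s => duhk a fA t (s, x))) by exact/measurable_EFinP.
exact: le_trans (le_abse_integral leb measurableT mrE) I.
Qed.

(** Each slice is a multiple of the odd kernel [Dk]. *)
Lemma corrector_odd t x : 0 < t -> duh a fA t (vopp x) = - duh a fA t x.
Proof.
move=> t0; have [K hK] := duhk_fA; have [C _ hC] := corrector_bound.
rewrite /duh -[RHS]mulN1r -RintegralZl//; last by case: (hC t x t0).
apply: eq_Rintegral => s _; rewrite mulN1r; case: (boolP (0 < s < t)) => [/andP[s0 st]|hs].
  by rewrite !hK// Dk_vopp mulrN.
by rewrite /duhk /= (negbTE hs) oppr0.
Qed.

End Corrector.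

(** * Duhamel integrals of decaying fluxes *)

Section DuhamelDecay.
Context {R : realType} {n : nat}.
Notation leb := (@lebesgue_measure R).
Implicit Types (a x y z : n.-tuple R) (t s c e b A B : R) (g : R -> n.-tuple R -> R).

Lemma powRVN (x r : R) : 0 <= x -> x^-1 `^ (- r) = x `^ r.
Proof. by move=> x0; rewrite -(powR_inv1 x0) -powRrM mulN1r opprK. Qed.

(** The slower power is used for [t <= 1], the faster one for [t > 1]. This keeps exponents below
    one, and so integrable at zero, while improving on the slower decay. *)
Lemma hb_interp c A B t e1 e e2 (g : n.-tuple R -> R) : 0 <= c -> 0 < t -> 0 <= A -> 0 <= B ->
  e1 <= e -> e <= e2 -> hb c (A * t `^ (- e1)) g -> hb c (B * t `^ (- e2)) g ->
  hb c ((A + B) * t `^ (- e)) g.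
Proof.
move=> c0 t0 A0 B0 h1 h2 hA hB; have [t1|t1] := leP t 1.
  apply: (hb_le hA c0); apply: (@le_trans _ _ (A * t `^ (- e))).
    by apply: ler_wpM2l => //; apply: powR_exp_anti => //; rewrite lerN2.
  by apply: ler_wpM2r; [exact: powR_ge0|rewrite lerDl].
apply: (hb_le hB c0); apply: (@le_trans _ _ (B * t `^ (- e))).
  by apply: ler_wpM2l => //; apply: powR_exp_mono; [exact: ltW|rewrite lerN2].
by apply: ler_wpM2r; [exact: powR_ge0|rewrite lerDr].
Qed.

(** By [hb_cnv] the weights at [t - s] and [s] combine into the one at [t], which leaves a scalar
    Beta integral. *)
Lemma duh_decay a g B b t : 0 < t -> jm g -> 0 <= B -> 0 <= b -> b < 1 ->
  (forall s, 0 < s -> s < t -> hb (cc n s) (B * s `^ (- b)) (g s)) ->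
  (forall x, leb.-integrable setT (fun s => (duhk a g t (s, x))%:E)) /\
  hb (cc n t) (cG n * CD a * B * betaC (1 / 2) b * t `^ (1 / 2 - b)) (duh a g t).
Proof.
move=> t0 mg B0 b0 b1 hg.
have c0 : 0 <= cG n :> R := le_trans ler01 (@cG_ge1 R n).
have half1 : 1 / 2 < 1 :> R by lra.
have half0 : 0 <= 1 / 2 :> R by lra.
have K0 : 0 <= cG n * CD a * B := mulr_ge0 (mulr_ge0 c0 (CD_ge0 a)) B0.
have hD s : 0 < s -> s < t ->
    hb (cc n t) (cG n * CD a * B * ((t - s) `^ (- (1 / 2)) * s `^ (- b))) (cnv (Dk a (t - s)) (g s)).
  move=> s0 st; have ts : 0 < t - s by rewrite subr_gt0.
  have := hb_cnv ts s0 (hb_Dk a ts) (hg s s0 st); rewrite subrK -/(CD a).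
  by congr (hb _ _ _); ring.
have [i h] := duh_hb_beta (cc_ge0 t) t0 mg K0 half0 half1 b0 b1 hD.
split => //; move: h; rewrite (_ : 1 - 1 / 2 - b = 1 / 2 - b); last by field.
by rewrite mulrA.
Qed.

Lemma jm_duh a g : jm g -> jm (duh a g).
Proof.
move=> mg.
apply: (@measurable_Rintegral _ _ _ (R * n.-tuple R)%type _ leb (fun q => duhk a g q.1.1 (q.2, q.1.2))).
rewrite /duhk /=; apply: (@measurable_if_itv R _ _ (fun q : (R * n.-tuple R) * R => q.2) (fun q => q.1.1)) => //.
  by apply: measurableT_comp.
  by apply: measurableT_comp.
apply: (@measurable_cnv_Dk R n a _ _ (fun q : (R * n.-tuple R) * R => q.1.1 - q.2) (fun q => q.1.2)
  (fun q : (R * n.-tuple R) * R => g q.2)).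
- by apply: measurable_funB => //; exact: measurableT_comp.
- exact: measurableT_comp.
- apply: (@measurableT_comp _ _ _ _ _ _ (fun q : R * n.-tuple R => g q.1 q.2) _
    (fun q : ((R * n.-tuple R) * R) * n.-tuple R => (q.1.2, q.2))) => //.
  by apply: measurable_fun_pair => //; exact: measurableT_comp.
Qed.

Lemma hb_scale c c' k B (g : n.-tuple R -> R) : 1 <= k -> c <= k * c' -> hb c B g -> hb c' (k * B) g.
Proof.
move=> k1 ck hg; have B0 := hb_ge0 hg; have [mg h1 h2] := hg; split => //.
  by apply: le_trans h1 _; rewrite lee_fin ler_peMl.
by move=> x; apply: le_trans (h2 x) _; rewrite (mulrC k) -mulrA; exact: ler_wpM2l.
Qed.

(* Near s = 0 the weight is integrable, for large s it decays faster than 1/s; the kernel then contributes its size t^(-1/2). *)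
Lemma duh_tail a g C k : jm g -> 0 < k -> 0 <= C ->
  (forall s, 0 < s -> hb (cc n s) (C * (if s < 1 then s `^ (- (3 / 4)) else s `^ (- 1 - k))) (g s)) ->
  exists2 C' : R, 0 <= C' & forall t, 0 < t ->
    (forall x, leb.-integrable setT (fun s => (duhk a g t (s, x))%:E)) /\
    hb (cc n t) (C' * t `^ (- (1 / 2))) (duh a g t).
Proof.
move=> mg k0 C0 hg.
have c0 : 0 <= cG n :> R := le_trans ler01 (@cG_ge1 R n).
have K0 : 0 <= cG n * (CD a * C) := mulr_ge0 c0 (mulr_ge0 (CD_ge0 a) C0).
have ki0 : 0 <= k^-1 by rewrite invr_ge0 ltW.
exists (cG n * (CD a * C) * (2 * (4 + k^-1) + 4)); first by rewrite mulr_ge0// addr_ge0// mulr_ge0// addr_ge0.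
move=> t t0; have t20 : 0 < t / 2 by rewrite divr_gt0.
pose b1 s : R := if 0 < s < 1 then s `^ (- (3 / 4)) else 0.
pose b2 s : R := if 1 <= s < t then s `^ (- 1 - k) else 0.
pose b3 s : R := if 0 < s < t then (t - s) `^ (- (1 / 2)) else 0.
have b10 s : 0 <= b1 s by rewrite /b1; case: ifP => // _; exact: powR_ge0.
have b20 s : 0 <= b2 s by rewrite /b2; case: ifP => // _; exact: powR_ge0.
have b30 s : 0 <= b3 s by rewrite /b3; case: ifP => // _; exact: powR_ge0.
have mb1 : measurable_fun setT b1 by apply: measurable_if_itv1; exact: measurable_powR.
have mb2 : measurable_fun setT b2.
  rewrite (_ : b2 = (fun s => if 1 <= s then (if s < t then s `^ (- 1 - k) else 0) else 0)); last first.
    by apply/funext => s; rewrite /b2; case: (1 <= s).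
  apply: measurable_fun_ifT => //=; first by apply: measurable_fun_ler => //; exact: measurable_cst.
  by apply: measurable_fun_ifT => //=; apply: measurable_fun_ltr => //; exact: measurable_cst.
have mb3 : measurable_fun setT b3.
  by apply: measurable_if_itv1; apply: measurable_powRs; apply: measurable_funB => //; exact: measurable_cst.
(* For [s <= t/2] the kernel is at most [2 t^(-1/2)] and the weight is integrated; for [s > t/2] the
   weight is at most [1/s < 2/t] and the kernel is integrated. *)
pose b s := cG n * (CD a * C) * (2 * t `^ (- (1 / 2)) * (b1 s + b2 s) + 2 * t^-1 * b3 s).
have h20 : 0 <= 2 * t `^ (- (1 / 2)) := mulr_ge0 (ler0n _ 2) (powR_ge0 _ _).
have h2i : 0 <= 2 * t^-1 by rewrite mulr_ge0// invr_ge0 ltW.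
have mb12 : measurable_fun setT (fun s => 2 * t `^ (- (1 / 2)) * (b1 s + b2 s)).
  by apply: measurable_funM => //; exact: measurable_funD.
have mb3' : measurable_fun setT (fun s => 2 * t^-1 * b3 s) by exact: measurable_funM.
have mb : measurable_fun setT b by apply: measurable_funM => //; exact: measurable_funD.
have n12 s : 0 <= 2 * t `^ (- (1 / 2)) * (b1 s + b2 s) := mulr_ge0 h20 (addr_ge0 (b10 s) (b20 s)).
have n3 s : 0 <= 2 * t^-1 * b3 s := mulr_ge0 h2i (b30 s).
have bs0 s : 0 <= b s := mulr_ge0 K0 (addr_ge0 (n12 s) (n3 s)).
apply: (duh_hb (cc_ge0 t) mg mb).
  move=> s s0 st; have ts : 0 < t - s by rewrite subr_gt0.
  have := hb_cnv ts s0 (hb_Dk a ts) (hg s s0); rewrite subrK -/(CD a) => h.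
  apply: (hb_le h (cc_ge0 _)).
  rewrite [leLHS](_ : _ = cG n * (CD a * C) * ((t - s) `^ (- (1 / 2)) * (if s < 1 then s `^ (- (3 / 4)) else s `^ (- 1 - k)))); last by ring.
  apply: (ler_wpM2l K0).
  have [sh|sh] := leP s (t / 2).
    apply: (@le_trans _ _ (2 * t `^ (- (1 / 2)) * (b1 s + b2 s))); last by rewrite lerDl.
    apply: ler_pM; rewrite ?powR_ge0//; first by case: ifP => // _; exact: powR_ge0.
      apply: (@le_trans _ _ ((t / 2) `^ (- (1 / 2)))); first by apply: powR_anti => //; lra.
      have i20 : 0 <= 2^-1 :> R by rewrite invr_ge0.
      rewrite (powRM _ (ltW t0) i20) mulrC; apply: ler_wpM2r; first exact: powR_ge0.
      by rewrite (powRVN _ (ler0n _ 2)) -[leRHS]powRr1//; apply: powR_exp_mono; lra.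
    rewrite /b1 /b2 s0 st /=; have [s1|s1] := ltP s 1; first by rewrite addr0.
    by rewrite add0r.
  apply: (@le_trans _ _ (2 * t^-1 * b3 s)); last by rewrite lerDr.
  rewrite /b3 s0 st /= mulrC; apply: ler_wpM2r; first exact: powR_ge0.
  apply: (@le_trans _ _ s^-1).
    rewrite -(powR_inv1 (ltW s0)); have [s1|s1] := ltP s 1.
      by apply: powR_exp_anti => //; [exact: ltW|lra].
    by apply: powR_exp_mono => //; lra.
  rewrite -[leRHS]invrK lef_pV2 ?posrE//; last by rewrite invr_gt0 mulr_gt0// invr_gt0.
  by rewrite invfM invrK mulrC; exact: ltW.
apply: (@le_trans _ _ (\int[leb]_s (b s)%:E)%E).
  apply: le_integral_EFin => //.
  - exact: measurable_if_itv1.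
  - by move=> s; case: ifP.
  - by move=> s; case: ifP => // _; exact: bs0.
have I1 : (\int[leb]_s (b1 s)%:E <= (4 : R)%:E)%E.
  have b1' : 3 / 4 < 1 :> R by lra.
  have := integral_powR_le (ltr01 : 0 < 1 :> R) b1'; move/le_trans; apply.
  by rewrite powR1 lee_fin le_eqVlt; apply/orP; left; apply/eqP; field.
have I2 : (\int[leb]_s (b2 s)%:E <= (k^-1)%:E)%E := integral_powR_tail t k0.
have I3 : (\int[leb]_s (b3 s)%:E <= (2 * t `^ (1 / 2))%:E)%E.
  have b1' : 1 / 2 < 1 :> R by lra.
  have := integral_refl_powR_le t0 ler01 b1'.
  rewrite (_ : (fun s => _) = (fun s : R => (b3 s)%:E)); last first.
    by apply/funext => s; rewrite /b3; case: ifP => // _; rewrite [1 * (t - s) `^ _]mul1r.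
  rewrite [1 * (_ / _)]mul1r.
  move/le_trans; apply; rewrite lee_fin (_ : 1 - 1 / 2 = 1 / 2); last by field.
  by rewrite le_eqVlt; apply/orP; left; apply/eqP; field.
rewrite /b integralZl_EFin//; [|exact: measurable_funD|by move=> s; exact: addr_ge0].
rewrite -[leRHS]/((_ * _ * _)%:E) -mulrA [leRHS]EFinM; apply: lee_wpmul2l; first by rewrite lee_fin.
rewrite integralD_EFin// integralZl_EFin//; [|exact: measurable_funD|by move=> s; exact: addr_ge0].
rewrite (@integralZl_EFin _ _ _ leb _ b3)// integralD_EFin// [(_ + 4) * _]mulrDl [leRHS]EFinD; apply: leeD.
  rewrite mulrAC [leRHS]EFinM; apply: lee_wpmul2l; first by rewrite lee_fin.
  by rewrite EFinD; apply: leeD.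
apply: (@le_trans _ _ ((2 * t^-1)%:E * (2 * t `^ (1 / 2))%:E)%E).
  by apply: lee_wpmul2l => //; rewrite lee_fin.
rewrite -EFinM lee_fin -(powR_inv1 (ltW t0)) mulrACA -(powR_add _ _ t0).
rewrite (_ : - 1 + 1 / 2 = - (1 / 2)); last by field.
by apply: ler_wpM2r; [exact: powR_ge0|lra].
Qed.

End DuhamelDecay.

(** * Successive approximations of the solution *)

Section Asymptotics.
Context {R : realType} {n : nat}.
Notation leb := (@lebesgue_measure R).
Implicit Types (x y z : n.-tuple R) (t s c A : R).
Variables (a : n.-tuple R) (p M N m1 : R) (u0 : n.-tuple R -> R) (v : R -> n.-tuple R -> R).
Hypothesis hm : mild a p u0 M v.
Hypothesis crit : (p - 1) * (n%:R / 2) = 3 / 4.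
Hypothesis MN : M <= N.
Hypothesis hN : forall t, 0 < t -> hb (cc n t) N (v t).
Hypothesis hmom : (\int[mu n]_y (nrm y * `|u0 y|)%:E <= m1%:E)%E.

Let p1 : 1 < p. Proof. by case: hm. Qed.
Let p0 : 0 <= p := ltW (lt_trans ltr01 p1).
Let jv : jm v. Proof. by case: hm. Qed.
Let M0 : 0 <= M. Proof. by case: hm => _ _ /(_ 0)/hb_ge0. Qed.
Let N0 : 0 <= N := le_trans M0 MN.
Let c0 : 0 <= cG n :> R := le_trans ler01 (@cG_ge1 R n).
Let m : R := \int[mu n]_y u0 y.
Let w : R -> n.-tuple R -> R := duh a (fA p m).

Let mM : `|m| <= M.
Proof. by apply: Rintegral_l1_le; have [_ _ _ h _] := hm; exact: hb_l1 h. Qed.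

Let hA t : 0 < t -> hb (cc n t) N (fun x => m * gauss t x).
Proof.
move=> t0; have := hbZ m (hb_gauss t0 : hb (cc n t) 1 (@gauss R n t)); rewrite mulr1 => h.
by apply: (hb_le h (cc_ge0 _)); exact: le_trans mM MN.
Qed.

Let m1_ge0 : 0 <= m1.
Proof.
rewrite -lee_fin; apply: le_trans hmom; apply: integral_ge0 => y _.
by rewrite lee_fin mulr_ge0 ?nrm_ge0.
Qed.

Let sup_hb c A (g : n.-tuple R -> R) x : hb c A g -> `|g x| <= A * c.
Proof. by case. Qed.

Lemma linear_part t : 0 < t ->
  hb (cc n t) (4 * cG n * m1 * t `^ (- (1 / 2))) (fun x => cnv (gauss t) u0 x - m * gauss t x).
Proof.
move=> t0; have [_ _ _ hu _] := hm.
have := @cnv_moment R n (4 * cG n) 0 (@gauss R n) 1 t m1 M u0 (mulr_ge0 (ler0n _ 4) c0) gauss_kb ler01 (lexx _) t0 (hb_l1 hu).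
rewrite add0r mulrAC; apply.
by rewrite (_ : (fun y => _) = (fun y => (nrm y * `|u0 y|)%:E))//; apply/funext => y; rewrite powRr1 ?nrm_ge0.
Qed.

Lemma linear_part0 t : 0 < t -> hb (cc n t) (2 * N) (fun x => cnv (gauss t) u0 x - m * gauss t x).
Proof.
move=> t0; have [_ _ _ hu _] := hm.
have := hbB (cnv_hb (cc_ge0 t) (hb_gauss t0) (hb_l1 hu)) (hA t0); rewrite mul1r => h.
by apply: (hb_le h (cc_ge0 _)); rewrite mulr2n mulrDl !mul1r lerD2r.
Qed.

(** The first moment gives the exponent [1/2], the mass alone gives [0]; the power in between is
    matched to that of the Duhamel term added to it, for small and large [t] alike. *)
Lemma linear_part_interp t e : 0 <= e -> e <= 1 / 2 -> 0 < t ->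
  hb (cc n t) ((2 * N + 4 * cG n * m1) * t `^ (- e)) (fun x => cnv (gauss t) u0 x - m * gauss t x).
Proof.
move=> e0 e1 t0; apply: (hb_interp (cc_ge0 _) t0 _ _ e0 e1); last exact: linear_part.
- exact: mulr_ge0.
- exact: mulr_ge0 (mulr_ge0 (ler0n _ 4) c0) m1_ge0.
- by rewrite oppr0 powRr0 mulr1; exact: linear_part0.
Qed.

Lemma flux_hb s (g : n.-tuple R -> R) : 0 < s -> hb (cc n s) N g ->
  hb (cc n s) (N `^ (p - 1) * N * s `^ (- (3 / 4))) (fun y => fnl p (g y)).
Proof.
move=> s0 hg; have := hb_fnl p1 (cc_ge0 _) hg.
by rewrite (powRM _ N0 (cc_ge0 _)) (cc_powR crit) mulrAC.
Qed.

Let mild_eq t x : 0 < t -> v t x = cnv (gauss t) u0 x + duh a (fun s y => fnl p (v s y)) t x.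
Proof. by case: hm => _ _ _ _; apply. Qed.

Let L0 : 0 <= 2 * N + 4 * cG n * m1 := addr_ge0 (mulr_ge0 (ler0n _ 2) N0) (mulr_ge0 (mulr_ge0 (ler0n _ 4) c0) m1_ge0).
Let h34 : 0 <= 3 / 4 :> R. Proof. lra. Qed.
Let h34' : 3 / 4 < 1 :> R. Proof. lra. Qed.
Let NN0 : 0 <= N `^ (p - 1) * N := mulr_ge0 (powR_ge0 _ _) N0.

(** The flux of size [s^(-3/4)] contributes [t^(1/2 - 3/4)]. *)
Lemma gauss_approx : exists2 C : R, 0 <= C & forall t, 0 < t ->
  hb (cc n t) (C * t `^ (- (1 / 4))) (fun x => v t x - m * gauss t x).
Proof.
pose K := cG n * CD a * (N `^ (p - 1) * N) * betaC (1 / 2) (3 / 4).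
have K0 : 0 <= K.
  apply: mulr_ge0; first exact: mulr_ge0 (mulr_ge0 c0 (CD_ge0 a)) NN0.
  by apply: betaC_ge0; lra.
exists (2 * N + 4 * cG n * m1 + K).
  exact: addr_ge0.
move=> t t0.
have [_ hd] := duh_decay a t0 (jm_fnl p jv) NN0 h34 h34' (fun s hs _ => flux_hb hs (hN hs)).
have q0 : 0 <= 1 / 4 :> R by lra.
have q1 : 1 / 4 <= 1 / 2 :> R by lra.
have := hbD (linear_part_interp q0 q1 t0) hd.
rewrite (_ : 1 / 2 - 3 / 4 = - (1 / 4)); last by field.
rewrite -mulrDl; congr (hb _ _ _); apply/funext => x; rewrite (mild_eq x t0); ring.
Qed.

Lemma flux_diff s X : 0 < s -> hb (cc n s) X (fun x => v s x - m * gauss s x) ->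
  hb (cc n s) (p * N `^ (p - 1) * s `^ (- (3 / 4)) * X) (fun x => fnl p (v s x) - fA p m s x).
Proof.
move=> s0 hX.
have := hb_fnl_diff p1 (cc_ge0 _) (hb_meas (hN s0)) (hb_meas (hA s0)) (fun x => sup_hb x (hN s0))
  (fun x => sup_hb x (hA s0)) hX.
by rewrite (powRM _ N0 (cc_ge0 _)) (cc_powR crit) mulrA.
Qed.

(** The two ends are the sizes of the separate fluxes, [3/4], and the gain [1/4] from
    [gauss_approx], in total [1]. *)
Lemma flux_diff_interp e : 3 / 4 <= e -> e <= 1 -> exists2 C : R, 0 <= C & forall s, 0 < s ->
  hb (cc n s) (C * s `^ (- e)) (fun x => fnl p (v s x) - fA p m s x).
Proof.
move=> e0 e1; have [C C0 hC] := gauss_approx.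
have K0 : 0 <= p * N `^ (p - 1) := mulr_ge0 p0 (powR_ge0 _ _).
have K1 : 0 <= p * N `^ (p - 1) * (2 * N) := mulr_ge0 K0 (mulr_ge0 (ler0n _ 2) N0).
have K2 : 0 <= p * N `^ (p - 1) * C := mulr_ge0 K0 C0.
exists (p * N `^ (p - 1) * (2 * N) + p * N `^ (p - 1) * C); first exact: addr_ge0.
move=> s s0; apply: (hb_interp (cc_ge0 _) s0 K1 K2 e0 e1).
  rewrite mulrAC; apply: flux_diff => //; have := hbB (hN s0) (hA s0).
  by rewrite mulr2n mulrDl mul1r.
have := flux_diff s0 (hC s s0); congr (hb _ _ _).
rewrite (_ : - (1 : R) = - (3 / 4) + - (1 / 4)); last by field.
by rewrite (powR_add _ _ s0); ring.
Qed.

Let jfA : jm (fA p m) := @jm_fA R n p m.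
Let jfv : jm (fun s y => fnl p (v s y)) := jm_fnl p jv.
Let jd : jm (fun s y => fnl p (v s y) - fA p m s y).
Proof. exact: measurable_funB. Qed.

Lemma duh_flux_diff t x : 0 < t ->
  v t x - (m * gauss t x + w t x) =
  (cnv (gauss t) u0 x - m * gauss t x) + duh a (fun s y => fnl p (v s y) - fA p m s y) t x.
Proof.
move=> t0.
have [i1 _] := duh_decay a t0 jfv NN0 h34 h34' (fun s hs _ => flux_hb hs (hN hs)).
have [i2 _] := duh_decay a t0 jfA NN0 h34 h34' (fun s hs _ => flux_hb hs (hA hs)).
rewrite -(duhB (i1 x) (i2 x)) ?(mild_eq x t0) /w; first by ring.
move=> s s0 st; exists (cc n s), (N `^ (p - 1) * N * s `^ (- (3 / 4))).
by split; [exact: cc_ge0|exact: flux_hb (hN s0)|exact: flux_hb (hA s0)].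
Qed.

(** The flux difference is taken with exponent [7/8], since [1] is not integrable at zero; hence
    [1/2 - 7/8 = -3/8], which suffices for the remainder estimate. *)
Lemma corrector_approx : exists2 C : R, 0 <= C & forall t, 0 < t ->
  hb (cc n t) (C * t `^ (- (3 / 8))) (fun x => v t x - (m * gauss t x + w t x)).
Proof.
have e0 : 3 / 4 <= 7 / 8 :> R by lra.
have e1 : 7 / 8 <= 1 :> R by lra.
have [C C0 hC] := flux_diff_interp e0 e1.
have b0 : 0 <= 7 / 8 :> R by lra.
have b1 : 7 / 8 < 1 :> R by lra.
have K0 : 0 <= cG n * CD a * C * betaC (1 / 2) (7 / 8).
  apply: mulr_ge0; first exact: mulr_ge0 (mulr_ge0 c0 (CD_ge0 a)) C0.
  by apply: betaC_ge0; lra.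
exists (2 * N + 4 * cG n * m1 + cG n * CD a * C * betaC (1 / 2) (7 / 8)).
  exact: addr_ge0.
move=> t t0; have [_ hd] := duh_decay a t0 jd C0 b0 b1 (fun s hs _ => hC s hs).
have q0 : 0 <= 3 / 8 :> R by lra.
have q1 : 3 / 8 <= 1 / 2 :> R by lra.
have := hbD (linear_part_interp q0 q1 t0) hd.
rewrite (_ : 1 / 2 - 7 / 8 = - (3 / 8)); last by field.
by rewrite -mulrDl; congr (hb _ _ _); apply/funext => x; rewrite (duh_flux_diff x t0).
Qed.

(* The linearization p|A|^(p-1) w of f(v) - f(A) is odd, hence of mass zero; it is cut off at s < 1, where it is not integrable in time. *)
Let go s x : R := if 1 <= s then p * `|m * gauss s x| `^ (p - 1) * w s x else 0.

Let jw : jm w. Proof. exact: jm_duh. Qed.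

Let jgo : jm go.
Proof.
apply: measurable_fun_ifT => //=.
  by apply: measurable_fun_ler => //; exact: measurable_cst.
apply: measurable_funM => //; apply: measurable_funM => //; apply: measurable_powRs; apply: measurable_norm.
by apply: measurable_funM => //; apply: measurable_gauss; [exact: measurable_fst|exact: measurable_snd].
Qed.

Let Apow s x : 0 < s -> `|m * gauss s x| `^ (p - 1) <= N `^ (p - 1) * s `^ (- (3 / 4)).
Proof.
move=> s0; have q0 : 0 <= p - 1 by rewrite subr_ge0 ltW.
apply: le_trans (powR_mono q0 (normr_ge0 _) (sup_hb x (hA s0))) _.
by rewrite (powRM _ N0 (cc_ge0 _)) (cc_powR crit).
Qed.

(** A pointwise Gaussian bound is kept, because a moment of [go] is taken afterwards. *)
Lemma linearized_le : exists2 C : R, 0 <= C & forall s x, 0 < s ->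
  `|go s x| <= C * s `^ (- 1) * gauss (2 * s) x.
Proof.
have [C C0 hC] := corrector_bound a m p1 crit.
have K0 : 0 <= p * N `^ (p - 1) := mulr_ge0 p0 (powR_ge0 _ _).
exists (p * N `^ (p - 1) * C); first exact: mulr_ge0.
move=> s x s0; have [_ hw] := hC s x s0.
have -> : s `^ (- 1) = s `^ (- (3 / 4)) * s `^ (- (1 / 4)) by rewrite -powR_add//; congr (_ `^ _); field.
rewrite /go; case: ifP => _; last first.
  by rewrite normr0 !mulr_ge0 ?powR_ge0 ?gauss_ge0.
rewrite normrM (ger0_norm (mulr_ge0 p0 (powR_ge0 _ _))).
rewrite [leRHS](_ : _ = p * (N `^ (p - 1) * s `^ (- (3 / 4))) * (C * s `^ (- (1 / 4)) * gauss (2 * s) x)); last by ring.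
apply: ler_pM => //; first exact: mulr_ge0 p0 (powR_ge0 _ _).
by apply: ler_wpM2l => //; exact: Apow.
Qed.

Lemma linearized_odd s x : 0 < s -> go s (vopp x) = - go s x.
Proof.
move=> s0; have hw : w s (vopp x) = - w s x := corrector_odd a m p1 crit x s0.
rewrite /go; case: (1 <= s); last by rewrite oppr0.
by rewrite gauss_vopp hw mulrN.
Qed.

Lemma linearized_hb C s : 0 <= C -> (forall s x, 0 < s -> `|go s x| <= C * s `^ (- 1) * gauss (2 * s) x) ->
  0 < s -> hb (cc n s) (C * s `^ (- 1)) (go s).
Proof.
move=> C0 hC s0; have s20 : 0 < 2 * s by exact: mulr_gt0.
have k0 : 0 <= C * s `^ (- 1) := mulr_ge0 C0 (powR_ge0 _ _).
have := hbZ (C * s `^ (- 1)) (hb_gauss s20 : hb (cc n (2 * s)) 1 (@gauss R n (2 * s))).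
rewrite (ger0_norm k0) mulr1 => h; apply: (hb_dom h (jm1 s jgo) _ (lexx _) (cc_ge0 _)).
  move=> x; rewrite [leRHS]ger0_norm; first exact: hC.
  exact: mulr_ge0 k0 (gauss_ge0 _ _).
by apply: cc_anti => //; rewrite ler_peMl ?ltW// ltr1n.
Qed.

(** The size [s^(-1)] alone would, with the cutoff at [s = 1], produce a logarithm. The vanishing
    mass and the moment of order [1/2] give slices of size [(t - s)^(-3/4) s^(-3/4)] instead, whose
    integral is of order [t^(-1/2)]. *)
Lemma linearized_duh : exists2 C : R, 0 <= C & forall t, 0 < t ->
  (forall x, leb.-integrable setT (fun s => (duhk a go t (s, x))%:E)) /\
  hb (cc n t) (C * t `^ (- (1 / 2))) (duh a go t).
Proof.
have [C C0 hC] := linearized_le.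
have G1 := @cG_ge1 R n.
pose K := CD a * (6 * cG n * C).
have K0 : 0 <= K := mulr_ge0 (CD_ge0 a) (mulr_ge0 (mulr_ge0 (ler0n _ 6) c0) C0).
have half0 : 0 <= 1 / 2 :> R by lra.
have half1 : 1 / 2 <= 1 :> R by lra.
have hgo s : 0 < s -> hb (cc n s) (C * s `^ (- 1)) (go s) := linearized_hb C0 hC.
have mom s : 0 < s -> (\int[mu n]_y (nrm y `^ (1 / 2) * `|go s y|)%:E <= (6 * cG n * C * s `^ (- (3 / 4)))%:E)%E.
  move=> s0; have s20 : 0 < 2 * s by exact: mulr_gt0.
  have k0 : 0 <= C * s `^ (- 1) := mulr_ge0 C0 (powR_ge0 _ _).
  have mg := hb_meas (hgo s s0).
  have mG : measurable_fun setT (fun y : n.-tuple R => nrm y `^ (1 / 2) * `|gauss (2 * s) y|).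
    by apply: measurable_funM; [exact: measurable_nrm_powR|apply: measurable_norm; exact: measurable_gauss1].
  apply: (@le_trans _ _ (\int[mu n]_y (C * s `^ (- 1) * (nrm y `^ (1 / 2) * `|gauss (2 * s) y|))%:E)%E).
    apply: le_integral_EFin.
    - by apply: measurable_funM; [exact: measurable_nrm_powR|exact: measurable_norm].
    - exact: measurable_funM.
    - by move=> y; rewrite mulr_ge0 ?powR_ge0.
    - move=> y; rewrite mulrCA; apply: ler_wpM2l; first exact: powR_ge0.
      by rewrite (ger0_norm (gauss_ge0 _ _)); exact: hC.
  rewrite integralZl_EFin//; last by move=> y; rewrite mulr_ge0 ?powR_ge0.
  apply: (@le_trans _ _ ((C * s `^ (- 1))%:E * (3 * cG n * (2 * s) `^ (1 / 2 / 2))%:E)%E).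
    by apply: lee_wpmul2l; [rewrite lee_fin|exact: moment_gauss].
  rewrite -EFinM lee_fin.
  have -> : s `^ (- (3 / 4)) = s `^ (- 1) * s `^ (1 / 2 / 2) by rewrite -powR_add//; congr (_ `^ _); field.
  have q : (2 * s) `^ (1 / 2 / 2) <= 2 * s `^ (1 / 2 / 2).
    rewrite (powRM _ (ler0n _ 2) (ltW s0)); apply: ler_wpM2r; first exact: powR_ge0.
    by rewrite -[leRHS]powRr1//; apply: powR_exp_mono; lra.
  rewrite [leRHS](_ : _ = C * s `^ (- 1) * (3 * cG n * (2 * s `^ (1 / 2 / 2)))); last by ring.
  apply: (ler_wpM2l k0); apply: ler_wpM2l => //; exact: mulr_ge0.
have mass0 s : 0 < s -> \int[mu n]_y go s y = 0.
  move=> s0; apply: Rintegral_odd; [exact: hb_meas (hgo s s0)|by move=> z; exact: linearized_odd|].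
  exact: l1_integrable (hb_l1 (hgo s s0)).
have hD t s : 0 < s -> s < t -> hb (cc n t) (cG n * K * ((t - s) `^ (- (3 / 4)) * s `^ (- (3 / 4)))) (cnv (Dk a (t - s)) (go s)).
  move=> s0 st; have ts : 0 < t - s by rewrite subr_gt0.
  have t0 : 0 < t := lt_trans s0 st.
  have hmax : hb (cc n (Num.max (t - s) s)) (K * ((t - s) `^ (- (3 / 4)) * s `^ (- (3 / 4)))) (cnv (Dk a (t - s)) (go s)).
    (* If [t - s <= s], a spare [s^(-1/4)] is traded for [(t - s)^(-1/4)] without cancellation; if
       [t - s > s], the moment estimate applies, with the supremum bound on the kernel. *)
    have [sts|sts] := leP (t - s) s.
      have := cnv_hb_r (cc_ge0 _) (l1_Dk a ts) (hgo s s0) => h; apply: (hb_le h (cc_ge0 _)).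
      have q : s `^ (- 1) <= (t - s) `^ (- (1 / 4)) * s `^ (- (3 / 4)).
        have -> : s `^ (- 1) = s `^ (- (1 / 4)) * s `^ (- (3 / 4)) by rewrite -powR_add//; congr (_ `^ _); field.
        by apply: ler_wpM2r; [exact: powR_ge0|apply: powR_anti => //; lra].
      have -> : (t - s) `^ (- (3 / 4)) = (t - s) `^ (- (1 / 2)) * (t - s) `^ (- (1 / 4)).
        by rewrite -powR_add//; congr (_ `^ _); field.
      rewrite [leRHS](_ : _ = CD a * (t - s) `^ (- (1 / 2)) * (6 * cG n * (C * ((t - s) `^ (- (1 / 4)) * s `^ (- (3 / 4)))))); last first.
        by rewrite /K; ring.
      apply: ler_wpM2l; first exact: mulr_ge0 (CD_ge0 a) (powR_ge0 _ _).
      have C1 := ler_wpM2l C0 q; apply: le_trans C1 _.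
      rewrite ler_peMl//; first exact: mulr_ge0 C0 (mulr_ge0 (powR_ge0 _ _) (powR_ge0 _ _)).
      by move: G1; lra.
    have := @cnv_moment R n _ _ (Dk a) (1 / 2) (t - s) _ _ (go s) (CD_ge0 a) (Dk_kb a) half0 half1 ts (hb_l1 (hgo s s0)) (mom s s0).
    rewrite (mass0 s s0) (_ : - (1 / 2 + 1 / 2 / 2) = - (3 / 4)); last by field.
    rewrite [X in hb _ X _](_ : _ = K * ((t - s) `^ (- (3 / 4)) * s `^ (- (3 / 4)))); last by rewrite /K; ring.
    by congr (hb _ _ _); apply/funext => x; rewrite mul0r subr0.
  rewrite -mulrA; apply: (hb_scale G1 _ hmax); apply: cc_max_le => //.
  by rewrite mulr2n mulrDl !mul1r -{1}(subrK s t); apply: lerD; rewrite le_max lexx ?orbT.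
have q0 : 0 <= 3 / 4 :> R by lra.
have q1 : 3 / 4 < 1 :> R by lra.
have GK0 : 0 <= cG n * K := mulr_ge0 c0 K0.
exists (cG n * K * betaC (3 / 4) (3 / 4)); first exact: mulr_ge0 GK0 (betaC_ge0 q1 q1).
move=> t t0; have := duh_hb_beta (cc_ge0 _) t0 jgo GK0 q0 q1 q0 q1 (hD t).
by rewrite mulrA (_ : 1 - 3 / 4 - 3 / 4 = - (1 / 2)); last by field.
Qed.

(** For [s >= 1] there are two errors: the Taylor remainder, of size [s^(-3/4 - th/4 - 1/4)] by
    [gauss_approx], and the linear coefficient times [v - A - w], of size [s^(-3/4 - 3/8)] by
    [corrector_approx]. For [s < 1] the cutoff leaves the plain flux difference. *)
Lemma remainder_le : exists k, exists2 C : R, 0 < k /\ 0 <= C & forall s, 0 < s ->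
  hb (cc n s) (C * (if s < 1 then s `^ (- (3 / 4)) else s `^ (- 1 - k)))
    (fun x => fnl p (v s x) - fA p m s x - go s x).
Proof.
(* [fnl_taylor] needs [th <= p - 1], and [th <= 1/2] puts [s^(-9/8)] below [s^(-1 - th/4)]. *)
pose th := Num.min (p - 1) (1 / 2).
have q0 : 0 < p - 1 by rewrite subr_gt0.
have th0 : 0 < th by rewrite lt_min q0; lra.
have th2 : th <= 1 / 2 by rewrite ge_min lexx orbT.
have th1 : th <= 1 by lra.
have thp : th <= p - 1 by rewrite ge_min lexx.
have [C1 C10 h1] := gauss_approx; have [C2 C20 h2] := corrector_approx.
have e0 : 3 / 4 <= 3 / 4 :> R by lra.
have e1 : 3 / 4 <= 1 :> R by lra.
have [C3 C30 h3] := flux_diff_interp e0 e1.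
pose T := 3 * p * ((p - 1) / th + 1).
have T0 : 0 <= T.
  apply: mulr_ge0; first exact: mulr_ge0 (ler0n _ 3) p0.
  by apply: addr_ge0 => //; apply: divr_ge0; exact: ltW.
pose K1 := T * (N `^ (p - 1 - th) * C1 `^ th) * C1.
have K10 : 0 <= K1 := mulr_ge0 (mulr_ge0 T0 (mulr_ge0 (powR_ge0 _ _) (powR_ge0 _ _))) C10.
pose K2 := p * N `^ (p - 1) * C2.
have K20 : 0 <= K2 := mulr_ge0 (mulr_ge0 p0 (powR_ge0 _ _)) C20.
exists (th / 4), (C3 + (K1 + K2)); first by split; [rewrite divr_gt0|rewrite !addr_ge0].
move=> s s0; case: ifPn => [s1|].
  have hs := h3 s s0; rewrite /go leNgt s1 /=.
  rewrite (_ : (fun x => _) = (fun x => fnl p (v s x) - fA p m s x)); last by apply/funext => x; rewrite subr0.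
  by apply: (hb_le hs (cc_ge0 _)); apply: ler_wpM2r; [exact: powR_ge0|rewrite lerDl addr_ge0].
rewrite -leNgt => s1.
have hv := hN s0; have ha := hA s0; have hd := h1 s s0; have hr := h2 s s0.
have mA : measurable_fun setT (fun x => p * `|m * gauss s x| `^ (p - 1)).
  by apply: measurable_funM => //; apply: measurable_powRs; apply: measurable_norm; exact: hb_meas ha.
have mf : measurable_fun setT (fun x => fnl p (v s x) - fA p m s x) := jm1 s jd.
have hT : hb (cc n s) (K1 * s `^ (- 1 - th / 4)) (fun x => fnl p (v s x) - fA p m s x -
    p * `|m * gauss s x| `^ (p - 1) * (v s x - m * gauss s x)).
  pose L := T * (N * cc n s) `^ (p - 1 - th) * (C1 * s `^ (- (1 / 4)) * cc n s) `^ th.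
  have Lge0 : 0 <= L := mulr_ge0 (mulr_ge0 T0 (powR_ge0 _ _)) (powR_ge0 _ _).
  have mT : measurable_fun setT (fun x => fnl p (v s x) - fA p m s x -
      p * `|m * gauss s x| `^ (p - 1) * (v s x - m * gauss s x)).
    by apply: measurable_funB => //; apply: measurable_funM => //; exact: hb_meas hd.
  have hK : forall x, `|fnl p (v s x) - fA p m s x - p * `|m * gauss s x| `^ (p - 1) * (v s x - m * gauss s x)|
      <= L * `|v s x - m * gauss s x|.
    move=> x; apply: le_trans (fnl_taylor p1 th0 th1 thp (sup_hb x ha) (sup_hb x hv)) _.
    have E : `|v s x - m * gauss s x| `^ (1 + th) = `|v s x - m * gauss s x| `^ th * `|v s x - m * gauss s x|.
      by rewrite powRD ?powRr1 1?mulrC// gt_eqF// addr_gt0.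
    rewrite E mulrA -/T; apply: ler_wpM2r => //.
    apply: ler_wpM2l; first by rewrite mulr_ge0 ?powR_ge0.
    by apply: powR_mono; [exact: ltW|exact: normr_ge0|exact: sup_hb hd].
  have := hb_domZ hd mT (cc_ge0 _) hK; rewrite (ger0_norm Lge0).
  suff -> : L * (C1 * s `^ (- (1 / 4))) = K1 * s `^ (- 1 - th / 4) by [].
  have cs := cc_powR crit s.
  have E : cc n s `^ (p - 1 - th) * cc n s `^ th = s `^ (- (3 / 4)).
    by rewrite -powRD ?subrK// (gt_eqF q0).
  rewrite /L (powRM _ N0 (cc_ge0 _)) (powRM _ (mulr_ge0 C10 (powR_ge0 _ _)) (cc_ge0 _)).
  rewrite (powRM _ C10 (powR_ge0 _ _)) -powRrM.
  have -> : s `^ (- 1 - th / 4) = s `^ (- (3 / 4)) * s `^ (- (1 / 4) * th) * s `^ (- (1 / 4)).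
    by rewrite -!powR_add//; congr (_ `^ _); field.
  by rewrite -E /K1; ring.
have hR : hb (cc n s) (K2 * s `^ (- 1 - th / 4)) (fun x => p * `|m * gauss s x| `^ (p - 1) *
    (v s x - (m * gauss s x + w s x))).
  have Lge0 : 0 <= p * (N `^ (p - 1) * s `^ (- (3 / 4))) := mulr_ge0 p0 (mulr_ge0 (powR_ge0 _ _) (powR_ge0 _ _)).
  have hK x : `|p * `|m * gauss s x| `^ (p - 1) * (v s x - (m * gauss s x + w s x))| <=
      p * (N `^ (p - 1) * s `^ (- (3 / 4))) * `|v s x - (m * gauss s x + w s x)|.
    rewrite normrM (ger0_norm (mulr_ge0 p0 (powR_ge0 _ _))); apply: ler_wpM2r => //.
    by apply: ler_wpM2l => //; exact: Apow.
  have h := hb_domZ hr (measurable_funM mA (hb_meas hr)) (cc_ge0 _) hK.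
  apply: (hb_le h (cc_ge0 _)); rewrite (ger0_norm Lge0).
  rewrite [leLHS](_ : _ = K2 * (s `^ (- (3 / 4)) * s `^ (- (3 / 8)))); last by rewrite /K2; ring.
  apply: ler_wpM2l => //; rewrite -powR_add//; apply: powR_exp_mono => //; lra.
have h := hbD hT hR.
rewrite (_ : (fun x => _) = (fun x => fnl p (v s x) - fA p m s x -
    p * `|m * gauss s x| `^ (p - 1) * (v s x - m * gauss s x) +
    p * `|m * gauss s x| `^ (p - 1) * (v s x - (m * gauss s x + w s x)))); last first.
  by apply/funext => x; rewrite /go s1; ring.
apply: (hb_le h (cc_ge0 _)); rewrite -mulrDl; apply: ler_wpM2r; first exact: powR_ge0.
by rewrite lerDr.
Qed.

Lemma second_order : exists2 C : R, 0 <= C & forall t, 0 < t ->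
  hb (cc n t) (C * t `^ (- (1 / 2))) (fun x => v t x - (m * gauss t x + w t x)).
Proof.
have [C1 C10 h1] := linearized_duh; have [k [C [k0 C0] hC]] := remainder_le.
have jr : jm (fun s x => fnl p (v s x) - fA p m s x - go s x) by exact: measurable_funB.
have [C2 C20 h2] := duh_tail a jr k0 C0 hC.
have K0 : 0 <= 4 * cG n * m1 := mulr_ge0 (mulr_ge0 (ler0n _ 4) c0) m1_ge0.
exists (4 * cG n * m1 + (C1 + C2)); first by rewrite !addr_ge0.
move=> t t0; have [i1 d1] := h1 t t0; have [_ d2] := h2 t t0.
have := hbD (linear_part t0) (hbD d1 d2); rewrite -!mulrDl; congr (hb _ _ _); apply/funext => x.
have b0 : 0 <= 7 / 8 :> R by lra.
have b1 : 7 / 8 < 1 :> R by lra.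
have e0 : 3 / 4 <= 7 / 8 :> R by lra.
have e1 : 7 / 8 <= 1 :> R by lra.
have [C3 C30 h3] := flux_diff_interp e0 e1.
have [i3 _] := duh_decay a t0 jd C30 b0 b1 (fun s hs _ => h3 s hs).
have [C4 C40 h4] := linearized_le.
rewrite (duh_flux_diff x t0) -(duhB (i3 x) (i1 x)); first by ring.
move=> s s0 st; exists (cc n s), (C3 * s `^ (- (7 / 8)) + C4 * s `^ (- 1)); split; first exact: cc_ge0.
  by apply: (hb_le (h3 s s0) (cc_ge0 _)); rewrite lerDl; exact: mulr_ge0 C40 (powR_ge0 _ _).
by apply: (hb_le (linearized_hb C40 h4 s0) (cc_ge0 _)); rewrite lerDr; exact: mulr_ge0 C30 (powR_ge0 _ _).
Qed.

End Asymptotics.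

(** * Interpolation to L^q and the first moment *)

Section LqBounds.
Context {R : realType} {n : nat}.
Implicit Types (x y : n.-tuple R) (t N c r : R) (g h : n.-tuple R -> R).

(** For finite [r], [|h|^r <= (N c)^(r-1) |h|] interpolates between the two endpoints; for [q = +oo]
    the level [N c] itself is admissible. *)
Lemma Lq_le_hb c N g h (q : \bar R) : 0 <= c -> (1 <= q)%E -> measurable_fun setT g ->
  hb c N h -> eqae (mu n) g h ->
  (Lqnorm q g <= (match q with r%:E => N * c `^ (1 - r^-1) | _ => N * c end)%:E)%E.
Proof.
move=> c0 q1 mg hh e; have [mh ih sh] := hh; have N0 := hb_ge0 hh.
have Nc0 : 0 <= N * c := mulr_ge0 N0 c0.
case: q q1 => [r| |] //= r1.
  rewrite lee_fin in r1; have r0 : 0 < r := lt_le_trans ltr01 r1.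
  have r10 : 0 <= r - 1 by rewrite subr_ge0.
  have mpow (k : n.-tuple R -> R) : measurable_fun setT k -> measurable_fun setT (fun x => `|k x| `^ r).
    by move=> mk; apply: measurable_powRs; exact: measurable_norm.
  have epow : eqae (mu n) (fun x => `|g x| `^ r) (fun x => `|h x| `^ r).
    by apply: (eqae_dom mg mh (mpow g mg) (mpow h mh) _ e) => x ->.
  rewrite iint_mu; last 2 first.
  - by apply/measurable_EFinP; exact: mpow.
  - by move=> x; rewrite lee_fin powR_ge0.
  rewrite (integral_eqae (mpow g mg) (mpow h mh) epow).
  have I : (\int[mu n]_x (`|h x| `^ r)%:E <= ((N * c) `^ (r - 1) * N)%:E)%E.
    apply: (@le_trans _ _ (\int[mu n]_x ((N * c) `^ (r - 1) * `|h x|)%:E)%E).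
      apply: le_integral_EFin; [exact: mpow| |by move=> x; exact: powR_ge0|].
        by apply: measurable_funM => //; exact: measurable_norm.
      move=> x; have -> : `|h x| `^ r = `|h x| `^ (r - 1) * `|h x|.
        by rewrite -[X in _ * X]powRr1// -powRD subrK// gt_eqF.
      by apply: ler_wpM2r => //; apply: powR_mono.
    rewrite integralZl_EFin ?powR_ge0//; last exact: measurable_norm.
    by rewrite [leRHS]EFinM; apply: lee_wpmul2l; rewrite ?lee_fin ?powR_ge0.
  have ri0 : 0 <= r^-1 by rewrite invr_ge0 ltW.
  apply: (@le_trans _ _ (((N * c) `^ (r - 1) * N)%:E `^ r^-1)%E).
    apply: gt0_ler_poweR => //.
    - by rewrite in_itv/= leey andbT; apply: integral_ge0 => x _; rewrite lee_fin powR_ge0.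
    - by rewrite in_itv/= leey andbT lee_fin mulr_ge0 ?powR_ge0.
  rewrite poweR_EFin lee_fin powRM ?powR_ge0// -powRrM.
  have rr : (r - 1) * r^-1 = 1 - r^-1 by field; rewrite gt_eqF.
  rewrite rr powRM// mulrAC.
  have -> : N `^ (1 - r^-1) * N `^ r^-1 = N.
    by rewrite -powRD ?subrK ?powRr1// oner_eq0.
  by [].
rewrite /ess_sup_abs; apply: ereal_inf_lbound => /=.
have mgt : measurable [set x | ((N * c)%:E < `|g x|%:E)%E].
  by under eq_set do rewrite lte_fin; exact: measurable_gt_norm.
rewrite (iint_bool (P := fun x => ((N * c)%:E < `|g x|%:E)%E))//.
apply/eqP; rewrite eq_le measure_ge0 andbT -[leRHS]e.
apply: le_measure; rewrite ?inE//; first exact: measurable_neq.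
move=> x /=; rewrite lte_fin ltNge => /negP H; apply/eqP => E; apply: H; rewrite E; exact: sh.
Qed.

(** The weight of the statement exactly undoes the scaling by [cc] in [Lq_le_hb], for every [q] at
    once. *)
Lemma qexp_weight t (q : \bar R) (N : R) : 0 < t -> (1 <= q)%E ->
  t `^ qexp n q * (match q with r%:E => N * cc n t `^ (1 - r^-1) | _ => N * cc n t end) = N.
Proof.
move=> t0; case: q => [r| |] //= _; rewrite mulrCA /cc.
  rewrite -powRrM -powR_add// (_ : _ + _ = 0) ?powRr0 ?mulr1//; ring.
by rewrite -powR_add// subrr powRr0 mulr1.
Qed.

Lemma nrm_le_sum y : nrm y <= \sum_(j < n) `|tnth y j|.
Proof.
have S0 : 0 <= \sum_(j < n) `|tnth y j| by exact: sumr_ge0.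
rewrite -(ler_pXn2r (ltn0Sn 1)) ?nnegrE ?nrm_ge0// nrm_sqr /sqnorm [leRHS]expr2 mulr_sumr.
apply: ler_sum => j _; rewrite -real_normK ?num_real// expr2 ler_wpM2r//.
by rewrite (bigD1 j)//= lerDl sumr_ge0.
Qed.

Lemma first_moment (u0 : n.-tuple R -> R) : measurable_fun setT u0 ->
  (forall j : 'I_n, (Lqnorm 1%:E (fun x => (tnth x j * u0 x)%R) < +oo)%E) ->
  exists m1 : R, (\int[mu n]_y (nrm y * `|u0 y|)%:E <= m1%:E)%E.
Proof.
move=> mu0 hu0.
have mj j : measurable_fun setT (fun x : n.-tuple R => tnth x j * u0 x).
  by apply: measurable_funM => //; exact: measurable_tnth.
have mn := measurable_nrm (@measurable_id _ (n.-tuple R) setT).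
have le1 : (\int[mu n]_y (nrm y * `|u0 y|)%:E <= \sum_(j < n) \int[mu n]_y `|tnth y j * u0 y|%:E)%E.
  rewrite -ge0_integral_sum//; last by move=> j; apply/measurable_EFinP; exact: measurable_norm.
  apply: ge0_le_integral => //.
  - by move=> y _; rewrite lee_fin mulr_ge0 ?nrm_ge0.
  - by apply/measurable_EFinP; apply: measurable_funM => //; exact: measurable_norm.
  - by apply: emeasurable_sum => j; apply/measurable_EFinP; exact: measurable_norm.
  - move=> y _; rewrite sumEFin lee_fin; under eq_bigr do rewrite normrM.
    by rewrite -mulr_suml; apply: ler_wpM2r => //; exact: nrm_le_sum.
have fin : (\sum_(j < n) \int[mu n]_y `|tnth y j * u0 y|%:E < +oo)%E.
  by apply: lte_sum_pinfty => j _; rewrite -(Lq1E (mj j)).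
exists (fine (\sum_(j < n) \int[mu n]_y `|tnth y j * u0 y|%:E)%E); rewrite fineK// ge0_fin_numE//.
by apply: sume_ge0 => j _; apply: integral_ge0.
Qed.

End LqBounds.

(** * Transfer of the estimate from the representative to the given solution *)

Theorem theorem2p6 (R : realType) (n : nat) (a : n.-tuple R)
  (u0 : n.-tuple R -> R) (u : R -> n.-tuple R -> R) :
  (1 <= n)%N ->
  (exists i : 'I_n, tnth a i != 0) ->
  L11_Linf u0 ->
  global_solution a (fnl (1 + 3 / (2 * n%:R))) u0 u ->
  forall q : \bar R, (1%:E <= q)%E ->
  exists2 C : R, 0 < C &
    forall t : R, 4 < t ->
      ((t `^ qexp n q)%:E *
         Lqnorm q (fun x => (u t x - A01 a (fnl (1 + 3 / (2 * n%:R))) u0 t x)%R)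
       <= (C * t `^ (- (1 / 2)))%:E)%E.
Proof.
move=> n1 _ [mu0 [l0 [mom0 s0]]]; set p := 1 + 3 / (2 * n%:R) => hu q q1.
have n0 : n%:R != 0 :> R by rewrite pnatr_eq0 -lt0n.
have n0' : 0 < n%:R :> R by rewrite ltr0n.
have crit : (p - 1) * (n%:R / 2) = 3 / 4 by rewrite /p; field.
have p1 : 1 < p by rewrite /p ltrDl divr_gt0// mulr_gt0.
have [M [u0b [v [hm e0 ev]]]] := global_solution_mild p1 mu0 l0 s0 hu.
have [N N0 hN] := decay hm crit.
have [_ _ _ hu0b _] := hm; have M0 := hb_ge0 hu0b; have mu0b := hb_meas hu0b.
have [m1 hm1] := first_moment mu0 mom0.
have mn := measurable_nrm (@measurable_id _ (n.-tuple R) setT).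
have mw (g : n.-tuple R -> R) : measurable_fun setT g -> measurable_fun setT (fun y => nrm y * `|g y|).
  by move=> mg; apply: measurable_funM => //; exact: measurable_norm.
(* The clipped datum differs from [u0] on a null set and inherits its first moment; its mass is
   compared below. *)
have hmom : (\int[mu n]_y (nrm y * `|u0b y|)%:E <= m1%:E)%E.
  apply: le_trans hm1; rewrite le_eqVlt; apply/orP; left; apply/eqP.
  apply: integral_eqae; [exact: mw|exact: mw|].
  by apply: (eqae_dom mu0b mu0 (mw _ mu0b) (mw _ mu0) _ (eqae_sym e0)) => y ->.
have MMN : M <= M + N by rewrite lerDl.
have hN' t : 0 < t -> hb (cc n t) (M + N) (v t).
  by move=> t0; apply: (hb_le (hN t t0) (cc_ge0 _)); rewrite lerDr.
have [C C0 hC] := second_order hm crit MMN hN' hmom.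
pose m : R := \int[mu n]_y u0b y.
have l0' : l1 (fine (Lqnorm 1%:E u0)) u0.
  split => //; rewrite -(Lq1E mu0) fineK// ge0_fin_numE// (Lq1E mu0).
  by apply: integral_ge0.
have massE : mass u0 = m.
  by rewrite /mass (IntE (l1_integrable l0')); exact: Rintegral_eqae.
have A0E : A0 u0 = fun t x => m * gauss t x by apply/funext => t; apply/funext => x; rewrite /A0 massE.
(* The Gaussian profile is its own representative, so [duhamel_duh] is applied with twice the same
   function and the bounds [cc n s]. *)
have A01E t x : 0 < t -> A01 a (fnl p) u0 t x = m * gauss t x + duh a (fA p m) t x.
  move=> t0; rewrite /A01 A0E; congr (_ + _).
  apply: (@duhamel_duh R n a p _ (fun s x => m * gauss s x) (cc n) (fun=> `|m|) t x t0 p1).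
    move=> s hs; have hg := hbZ m (hb_gauss hs : hb (cc n s) 1 (@gauss R n s)); rewrite mulr1 in hg.
    split; [exact: hb_meas hg|exact: cc_ge0|exact: hg|].
    by rewrite /eqae (_ : [set x | _] = set0) ?measure0//; apply/seteqP; split => y //=; rewrite eqxx.
  exact: measurable_duhk1 (@jm_fA R n p m).
exists (C + 1); first by rewrite ltr_wpDl.
move=> t t4; have t0 : 0 < t by apply: lt_trans t4.
have hdt := hC t t0.
have mut : measurable_fun setT (u t) by case: hu => /(_ t (ltW t0)) [].
have mvt : measurable_fun setT (v t) := hb_meas (hN t t0).
have mA : measurable_fun setT (A01 a (fnl p) u0 t).
  rewrite (_ : A01 _ _ _ _ = fun x => m * gauss t x + duh a (fA p m) t x).
    apply: measurable_funD; first by apply: measurable_funM => //; exact: measurable_gauss1.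
    exact: jm1 (jm_duh a (@jm_fA R n p m)).
  by apply/funext => x; exact: A01E.
have mg : measurable_fun setT (fun x => u t x - A01 a (fnl p) u0 t x) by exact: measurable_funB.
have eg : eqae (mu n) (fun x => u t x - A01 a (fnl p) u0 t x)
    (fun x => v t x - (m * gauss t x + duh a (fA p m) t x)).
  apply: (eqae_dom mut mvt mg (hb_meas hdt) _ (ev t t0)) => x ->.
  by rewrite A01E.
have := Lq_le_hb (cc_ge0 t) q1 mg hdt eg => H.
apply: (@le_trans _ _ ((t `^ qexp n q)%:E * _)%E).
  by apply: lee_wpmul2l; [rewrite lee_fin powR_ge0|exact: H].
rewrite -EFinM lee_fin qexp_weight//; apply: ler_wpM2r; first exact: powR_ge0.
by rewrite lerDl.
Qed.
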